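(* Let $\Gamma$ be a special grading (by an abelian group) on an Okubo algebra $\mathcal{O}$ over a field $\mathbb{F}$. Then the short exact sequence $$1\longrightarrow\mathrm{Stab}(\Gamma)\longrightarrow\mathrm{Aut}(\Gamma)\longrightarrow W(\Gamma)\longrightarrow1$$ splits. Moreover, $\mathrm{Stab}(\Gamma)\cong\mu_3(\mathbb{F})^2$, where $\mu_3(\mathbb{F})$ is the group of cubic roots of $1$ in $\mathbb{F}$; thus $\mathrm{Stab}(\Gamma)$ is trivial if $\mathrm{char}\,\mathbb{F}=3$, or if $\mathrm{char}\,\mathbb{F}\neq3$ but $\mathbb{F}$ does not contain a primitive cubic root of $1$, and it is isomorphic to $(\mathbb{Z}/3)^2$ if $\mathrm{char}\,\mathbb{F}\neq3$ and $\mathbb{F}$ contains a primitive cubic root of $1$. Exactly the following possibilities appear for the homomorphism $\Phi_\Gamma$: (1) The image of $\Phi_\Gamma$ is trivial. In this case $\mathcal{O}$ is the split Okubo algebra, $(\mathcal{O},\Gamma)\simeq_{\mathrm{eq}}(\mathcal{O}_{1,1},\Gamma_{1,1})$, and $W(\Gamma)$ is isomorphic to the special linear group $\mathrm{SL}(2,3)=\mathrm{SL}_2(\mathbb{Z}/3)$. (2) The image of $\Phi_\Gamma$ is cyclic of order $3$. In this case $(\mathcal{O},\Gamma)\simeq_{\mathrm{eq}}(\mathcal{O}_{1,\alpha},\Gamma_{1,\alpha})$, where $\alpha\in\mathbb{F}^\times$ is such that $[\alpha]$ is a generator of the image of $\Phi_\Gamma$, and $W(\Gamma)$ is cyclic of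 order $3$. (3) The image of $\Phi_\Gamma$ is isomorphic to $(\mathbb{Z}/3)^2$. In this case $W(\Gamma)$ is trivial, and if $\alpha,\beta\in\mathbb{F}^\times$ are such that $[\alpha]$ and $[\beta]$ generate the image of $\Phi_\Gamma$, then either $(\mathcal{O},\Gamma)\simeq_{\mathrm{eq}}(\mathcal{O}_{\alpha,\beta},\Gamma_{\alpha,\beta})$ or $(\mathcal{O},\Gamma)\simeq_{\mathrm{eq}}(\mathcal{O}_{\beta,\alpha},\Gamma_{\beta,\alpha})$, but not both.
   Context: Split Okubo algebra. For a field $\mathbb{F}$, the split Okubo algebra $(\mathcal{O}_{\mathbb{F}},*,\mathrm{n})$ is the $8$-dimensional $\mathbb{F}$-algebra with basis $\{z_{i,j} : (i,j)\in(\mathbb{Z}/3)^2,\ (i,j)\neq(0,0)\}$ and multiplication $$z_{i,j}*z_{i',j'}=\begin{cases}0&\text{if }\Delta=2\text{ or }i+i'=0=j+j',\\ -z_{i+i',j+j'}&\text{if }\Delta=1,\\ z_{i+i',j+j'}&\text{otherwise,}\end{cases}\qquad \Delta=ij'-ji'\in\mathbb{Z}/3,$$ endowed with the quadratic form $\mathrm{n}$ determined by $\mathrm{n}(z_{i,j})=0$ for all $(i,j)\ne(0,0)$ and polar form $\mathrm{n}(u,v)=\mathrm{n}(u+v)-\mathrm{n}(u)-\mathrm{n}(v)$ satisfying $\mathrm{n}(z_{i,j},z_{i',j'})=1$ if $i+i'=0=j+j'$ and $0$ otherwise. Okubo algebras. An Okubo algebra over $\mathbb{F}$ is a twisted form of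 $(\mathcal{O}_{\mathbb{F}},*,\mathrm{n})$, i.e. a triple $(\mathcal{O},*,\mathrm{n})$ with $\mathcal{O}$ an $\mathbb{F}$-vector space, $*$ a bilinear product and $\mathrm{n}$ a quadratic form (the norm), that becomes isomorphic to the split Okubo algebra over an algebraic closure $\overline{\mathbb{F}}$ after extending scalars to $\overline{\mathbb{F}}$. The algebras $\mathcal{O}_{\alpha,\beta}$ and gradings $\Gamma_{\alpha,\beta}$. For $\alpha,\beta\in\mathbb{F}^\times$, fix cubic roots $\alpha^{1/3},\beta^{1/3}\in\overline{\mathbb{F}}$. Then $\mathcal{O}_{\alpha,\beta}$ is the $\mathbb{F}$-subspace of $\mathcal{O}_{\overline{\mathbb{F}}}$ with $\mathbb{F}$-basis $\tilde z_{i,j}=\alpha^{i/3}\beta^{j/3}z_{i,j}$, for integers $0\le i,j\le 2$, $(i,j)\neq(0,0)$, with the restricted product and norm. It is an Okubo algebra over $\mathbb{F}$, and $\mathcal{O}_{1,1}$ is the split one. Explicitly, if $z_{i,j}*z_{i',j'}=\epsilon\, z_{i+i',j+j'}$ with $\epsilon\in\{0,1,-1\}$, then $\tilde z_{i,j}*\tilde z_{i',j'}=\epsilon\,\alpha^{\lfloor (i+i')/3\rfloor}\beta^{\lfloor (j+j')/3\rfloor}\tilde z_{k,l}$, where $k,l\in\{0,1,2\}$ are the residues of $i+i'$, $j+j'$ modulo $3$. The grading $\Gamma_{\alpha,\beta}$ is the $(\mathbb{Z}/3)^2$-grading on $\mathcal{O}_{\alpha,\beta}$ with $\deg(\tilde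 z_{i,j})=(i,j)$ modulo $3$. Gradings. A grading $\Gamma:\mathcal{A}=\bigoplus_{g\in G}\mathcal{A}_g$ of an algebra $\mathcal{A}$ by an abelian group $G$ (written multiplicatively, so $\mathcal{A}_g\mathcal{A}_h\subseteq\mathcal{A}_{gh}$) is called special if $\mathcal{A}_e=0$ for the neutral element $e$. Two gradings $\Gamma:\mathcal{A}=\bigoplus_{g\in G}\mathcal{A}_g$ and $\Gamma':\mathcal{B}=\bigoplus_{h\in H}\mathcal{B}_h$ are equivalent, written $(\mathcal{A},\Gamma)\simeq_{\mathrm{eq}}(\mathcal{B},\Gamma')$, if there is an algebra isomorphism $\varphi:\mathcal{A}\to\mathcal{B}$ such that for every $g\in G$ with $\mathcal{A}_g\ne0$ there is $h\in H$ with $\varphi(\mathcal{A}_g)=\mathcal{B}_h$. $\mathrm{Aut}(\Gamma)$ is the group of algebra automorphisms of $\mathcal{A}$ that permute the nonzero homogeneous components of $\Gamma$; $\mathrm{Stab}(\Gamma)$ is its (normal) subgroup of automorphisms mapping each homogeneous component onto itself; and $W(\Gamma)=\mathrm{Aut}(\Gamma)/\mathrm{Stab}(\Gamma)$ is the Weyl group of $\Gamma$. The homomorphism $\Phi_\Gamma$. For a special grading $\Gamma:\mathcal{O}=\bigoplus_{g\in G}\mathcal{O}_g$ on an Okubo algebra, let $H$ be the subgroup of $G$ generated by the support $\{g\in G:\mathcal{O}_g\ne0\}$. It is known that $H$ is the disjoint union of $\{e\}$ and the support, that $H\cong(\mathbb{Z}/3)^2$, and that $$\Phi_\Gamma:H\to\mathbb{F}^\times/(\mathbb{F}^\times)^3,\quad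 \Phi_\Gamma(e)=[1],\quad \Phi_\Gamma(h)=[\mathrm{n}(u,u*u)]\ \text{ for any }0\ne u\in\mathcal{O}_h,\ h\neq e,$$ is a well-defined group homomorphism, where $[\alpha]=\alpha(\mathbb{F}^\times)^3$. *)

(* Defs.v *)
Set Warnings "-notation-overridden,-ambiguous-paths,-redundant-canonical-projection,-projection-no-head-constant".
From HB Require Import structures.
From mathcomp Require Import all_boot all_algebra.
From mathcomp Require Import boolp classical_sets.
From mathcomp Require Import ring.

Set Implicit Arguments.
Unset Strict Implicit.
Unset Printing Implicit Defensive.

Import GRing.Theory.
Local Open Scope ring_scope.
Local Open Scope quotient_scope.

Definition group_iso (G H : groupType) : Prop :=
  exists f : {multiplicative G -> H}, bijective f.

Definition trivial_group (G : groupType) : Prop := forall x : G, x = 1%g.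

Record subgroup (G : groupType) := Subgroup {
  subgroup_mem :> {pred G};
  subgroup_closed : group_closed subgroup_mem
}.

Definition group_of (G : groupType) (S : subgroup G) : Type :=
  {x : G | x \in S}.

HB.instance Definition _ (G : groupType) (S : subgroup G) :=
  SubChoice.copy (group_of S) {x : G | x \in S}.
HB.instance Definition _ (G : groupType) (S : subgroup G) :=
  SubChoice_isSubGroup.Build G (fun x => x \in S) (group_of S)
    (subgroup_closed S).

Definition generated (G : groupType) (A : set G) : set G :=
  [set x | forall S : subgroup G, (forall y, A y -> y \in S) -> x \in S].

(* The range of a morphism is a subgroup, so this says that A is a subgroup of G
   isomorphic to K. *)
Definition subgroup_iso (G : groupType) (A : set G) (K : groupType) : Prop :=
  exists2 f : {multiplicative K -> G}, injective f & range f = A.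

Record normal_subgroup (G : groupType) := NormalSubgroup {
  normal_sub :> subgroup G;
  normal_conj : forall x y : G, x \in normal_sub -> (x ^ y)%g \in normal_sub
}.

Section Quotient.
Local Open Scope group_scope.
Variables (G : groupType) (N : normal_subgroup G).

Let N1 : 1 \in N. Proof. exact: (subgroup_closed N).1. Qed.
Let NF x y : x \in N -> y \in N -> x / y \in N.
Proof. exact: (subgroup_closed N).2. Qed.
Let NV x : x \in N -> x^-1 \in N.
Proof. by move=> Nx; rewrite -[_^-1]mul1g NF. Qed.
Let NM x y : x \in N -> y \in N -> x * y \in N.
Proof. by move=> Nx Ny; rewrite -[y]invgK NF ?NV. Qed.

Definition coset_rel (x y : G) : bool := x^-1 * y \in N.

Fact coset_rel_refl : reflexive coset_rel.
Proof. by move=> x; rewrite /coset_rel mulVg. Qed.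
Fact coset_rel_sym : symmetric coset_rel.
Proof.
by move=> x y; apply/idP/idP => /NV; rewrite /coset_rel invgM invgK.
Qed.
Fact coset_rel_trans : transitive coset_rel.
Proof. by move=> y x z Hxy /(NM Hxy); rewrite -mulgA mulVKg. Qed.

Canonical coset_equiv :=
  EquivRel coset_rel coset_rel_refl coset_rel_sym coset_rel_trans.

Definition quotient_group : Type := {eq_quot coset_equiv}.
HB.instance Definition _ := Choice.copy quotient_group {eq_quot coset_equiv}.
HB.instance Definition _ := EqQuotient.copy quotient_group {eq_quot coset_equiv}.

Definition quot_one : quotient_group := \pi_quotient_group 1.
Definition quot_mul (a b : quotient_group) : quotient_group :=
  \pi_quotient_group (repr a * repr b).
Definition quot_inv (a : quotient_group) : quotient_group := \pi_quotient_group (repr a)^-1.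

Let pi_eq x y : (\pi_quotient_group x = \pi_quotient_group y) <-> coset_rel x y.
Proof. by split => [/eqmodP //|?]; apply/eqmodP. Qed.

Let repr_rel x : coset_rel (repr (\pi_quotient_group x)) x.
Proof. by apply/pi_eq; rewrite reprK. Qed.

Lemma quot_mulE x y :
  quot_mul (\pi_quotient_group x) (\pi_quotient_group y) = \pi_quotient_group (x * y).
Proof.
apply/pi_eq; rewrite /coset_rel.
set a := repr _; set b := repr _.
have Na : a^-1 * x \in N by apply: repr_rel.
have Nb : b^-1 * y \in N by apply: repr_rel.
have -> : (a * b)^-1 * (x * y) = (a^-1 * x) ^ b * (b^-1 * y).
  by rewrite /conjg invgM !mulgA mulgK.
by rewrite NM // normal_conj.
Qed.

Lemma quot_invE x : quot_inv (\pi_quotient_group x) = \pi_quotient_group (x^-1).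
Proof.
apply/pi_eq; rewrite /coset_rel invgK.
set a := repr _; have Na : a^-1 * x \in N by apply: repr_rel.
have -> : a * x^-1 = ((a^-1 * x)^-1) ^ a^-1.
  by rewrite /conjg invgK invgM invgK !mulgA mulgK.
by rewrite normal_conj ?NV.
Qed.

Fact quot_mulA : associative quot_mul.
Proof.
move=> a b c; rewrite -[a]reprK -[b]reprK -[c]reprK.
by rewrite (quot_mulE (repr b)) (quot_mulE (repr a) (repr b)) !quot_mulE mulgA.
Qed.
Fact quot_mul1 : left_id quot_one quot_mul.
Proof. by move=> a; rewrite -[a]reprK quot_mulE mul1g. Qed.
Fact quot_mulr1 : right_id quot_one quot_mul.
Proof. by move=> a; rewrite -[a]reprK quot_mulE mulg1. Qed.
Fact quot_mulV : left_inverse quot_one quot_inv quot_mul.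
Proof. by move=> a; rewrite -[a]reprK quot_invE quot_mulE mulVg. Qed.
Fact quot_mulrV : right_inverse quot_one quot_inv quot_mul.
Proof. by move=> a; rewrite -[a]reprK quot_invE quot_mulE mulgV. Qed.

HB.instance Definition _ := isGroup.Build quotient_group
  quot_mulA quot_mul1 quot_mulr1 quot_mulV quot_mulrV.

Definition quot_proj (x : G) : quotient_group := \pi_quotient_group x.

Fact quot_proj_mult : {morph quot_proj : x y / x * y}.
Proof. by move=> x y; rewrite /quot_proj -quot_mulE. Qed.

HB.instance Definition _ :=
  isMultiplicative.Build G quotient_group quot_proj quot_proj_mult.

(* 1 -> N -> G -> G / N -> 1 splits. *)
Definition quotient_splits : Prop :=
  exists s : {multiplicative quotient_group -> G}, cancel s quot_proj.

End Quotient.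

Arguments quot_proj {G} N x.

Section UnitGroup.
Variable F : fieldType.

(* The multiplicative group of F; [{unit F}] only covers finite rings. *)
Definition units : Type := {x : F | x != 0}.
HB.instance Definition _ := SubChoice.copy units {x : F | x != 0}.

Definition units_one : units := exist _ 1 (oner_neq0 F).
Definition units_mul (x y : units) : units :=
  exist _ (val x * val y) (mulf_neq0 (valP x) (valP y)).
Definition units_inv (x : units) : units :=
  exist _ (val x)^-1 (invr_neq0 (valP x)).

Fact units_mulA : associative units_mul.
Proof. by move=> x y z; apply/val_inj; rewrite /= mulrA. Qed.
Fact units_mul1 : left_id units_one units_mul.
Proof. by move=> x; apply/val_inj; rewrite /= mul1r. Qed.
Fact units_mulr1 : right_id units_one units_mul.
Proof. by move=> x; apply/val_inj; rewrite /= mulr1. Qed.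
Fact units_mulV : left_inverse units_one units_inv units_mul.
Proof. by move=> x; apply/val_inj; rewrite /= mulVf //; exact: (valP x). Qed.
Fact units_mulrV : right_inverse units_one units_inv units_mul.
Proof. by move=> x; apply/val_inj; rewrite /= mulfV //; exact: (valP x). Qed.

HB.instance Definition _ := isGroup.Build units
  units_mulA units_mul1 units_mulr1 units_mulV units_mulrV.

Lemma units_mulC (x y : units) : (x * y = y * x)%g.
Proof. by apply/val_inj; rewrite /= mulrC. Qed.

Lemma units_cubeF (x y : units) : ((x / y) ^+ 3 = x ^+ 3 / y ^+ 3)%g.
Proof. exact: (expgnFl _ (units_mulC x y)). Qed.

Fact mu3_closed : group_closed [pred x : units | (x ^+ 3 == 1)%g].
Proof.
split=> [|x y]; rewrite !inE ?expg1n // units_cubeF => /eqP-> /eqP->.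
by rewrite mulgV.
Qed.
Definition mu3 : subgroup units := Subgroup mu3_closed.

Fact cubes_closed :
  group_closed [pred x : units | `[< exists y : units, x = (y ^+ 3)%g >]].
Proof.
split=> [|x y]; rewrite !inE; first by exists 1%g; rewrite expg1n.
by move=> [a ->] [b ->]; exists (a / b)%g; rewrite units_cubeF.
Qed.

Fact cubes_conj (x y : units) :
  x \in Subgroup cubes_closed -> (x ^ y)%g \in Subgroup cubes_closed.
Proof. by move=> Cx; rewrite /conjg units_mulC mulgK. Qed.

Definition cubes : normal_subgroup units := NormalSubgroup cubes_conj.

Definition cube_classes : groupType := quotient_group cubes.

Definition cube_class (x : units) : cube_classes := quot_proj cubes x.

End UnitGroup.

Fact SL23_closed : group_closed [pred u : {'GL_2['Z_3]} | \det (val u) == 1].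
Proof.
split=> [|u v]; rewrite !inE; first by rewrite det1.
by move=> /eqP du /eqP dv; rewrite det_mulmx det_inv du dv mul1r invr1.
Qed.
Definition SL23 : subgroup {'GL_2['Z_3]} := Subgroup SL23_closed.

Definition polar (F : fieldType) (V : lmodType F) (n : V -> F) (u v : V) : F :=
  n (u + v) - n u - n v.

Definition quadratic_form (F : fieldType) (V : lmodType F) (n : V -> F) : Prop :=
  (forall (a : F) v, n (a *: v) = a ^+ 2 * n v)
  /\ inhabited (bilinear_for *%R *%R (polar n)).

Record normed_alg (F : fieldType) := NormedAlg {
  alg_carrier :> vectType F;
  amul : {bilinear alg_carrier -> alg_carrier -> alg_carrier};
  anorm : alg_carrier -> F;
  anorm_quadratic : quadratic_form anorm
}.

Arguments amul {F n} : rename.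
Arguments anorm {F n} u : rename.

Section Structure.
Variables (F : fieldType) (A B : normed_alg F).

Definition alg_iso (f : 'Hom(A, B)) : Prop :=
  bijective f /\ forall u v : A, f (amul u v) = amul (f u) (f v).

Definition normed_alg_iso : Prop :=
  exists f : 'Hom(A, B), alg_iso f /\ forall u : A, anorm (f u) = anorm u.

End Structure.

(* The algebra with basis indexed by I, structure constants c, and whose norm
   takes the values q i on the basis vectors and has polar form b i j between
   the i-th and the j-th one, for i != j (only the pairs i < j, in the
   enumeration of I, are read off, so b is meant to be symmetric). *)
Section StructureConstants.
Variables (F : fieldType) (I : finType).
Variables (c : I -> I -> I -> F) (q : I -> F) (b : I -> I -> F).
Local Notation V := {ffun I -> F^o}.

Definition sc_basis (i : I) : V := [ffun k => (k == i)%:R].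

Definition sc_prod (x y : V) : V :=
  [ffun k => \sum_i \sum_j c i j k * (x i * y j)].

Definition sc_norm (x : V) : F :=
  \sum_i q i * x i ^+ 2
  + \sum_i \sum_(j | (enum_rank i < enum_rank j)%N) b i j * (x i * x j).

Fact sc_prod_bilinear : bilinear_for *:%R *:%R sc_prod.
Proof.
split=> u a x y; apply/ffunP=> k; rewrite !ffunE scaler_sumr -big_split /=;
  apply: eq_bigr => i _; rewrite scaler_sumr -big_split /=;
  apply: eq_bigr => j _; rewrite !ffunE /GRing.scale /=; ring.
Qed.
HB.instance Definition _ := bilinear_isBilinear.Build F V V V *:%R *:%R sc_prod
  sc_prod_bilinear.

Lemma sc_polarE (x y : V) :
  polar sc_norm x y = \sum_i 2%:R * q i * (x i * y i)
  + \sum_i \sum_(j | (enum_rank i < enum_rank j)%N)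
      b i j * (x i * y j + y i * x j).
Proof.
have e1 : \sum_i q i * (x + y) i ^+ 2 = \sum_i q i * x i ^+ 2
    + \sum_i q i * y i ^+ 2 + \sum_i 2%:R * q i * (x i * y i).
  rewrite -!big_split; apply: eq_bigr => i _ /=; rewrite !ffunE; ring.
have e2 : \sum_i \sum_(j | (enum_rank i < enum_rank j)%N)
      b i j * ((x + y) i * (x + y) j)
    = \sum_i \sum_(j | (enum_rank i < enum_rank j)%N) b i j * (x i * x j)
    + \sum_i \sum_(j | (enum_rank i < enum_rank j)%N) b i j * (y i * y j)
    + \sum_i \sum_(j | (enum_rank i < enum_rank j)%N)
        b i j * (x i * y j + y i * x j).
  rewrite -!big_split; apply: eq_bigr => i _ /=.
  rewrite -!big_split; apply: eq_bigr => j _ /=; rewrite !ffunE; ring.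
by rewrite /polar /sc_norm e1 e2; ring.
Qed.

Fact sc_norm_quadratic : quadratic_form sc_norm.
Proof.
split=> [a v|].
  rewrite /sc_norm mulrDr !mulr_sumr; congr (_ + _); apply: eq_bigr => i _.
    rewrite !ffunE /GRing.scale /=; ring.
  rewrite mulr_sumr; apply: eq_bigr => j _; rewrite !ffunE /GRing.scale /=; ring.
constructor; split=> u a x y; rewrite /= !sc_polarE mulrDr addrACA;
  congr (_ + _); rewrite mulr_sumr -big_split /=; apply: eq_bigr => i _.
- rewrite !ffunE /GRing.scale /=; ring.
- rewrite mulr_sumr -big_split /=; apply: eq_bigr => j _.
  rewrite !ffunE /GRing.scale /=; ring.
- rewrite !ffunE /GRing.scale /=; ring.
- rewrite mulr_sumr -big_split /=; apply: eq_bigr => j _.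
  rewrite !ffunE /GRing.scale /=; ring.
Qed.

Definition sc_alg : normed_alg F := NormedAlg sc_prod sc_norm_quadratic.

End StructureConstants.

Lemma sc_prod_basis (F : fieldType) (I : finType) (c : I -> I -> I -> F) i j :
  sc_prod c (sc_basis F i) (sc_basis F j) = \sum_k c i j k *: sc_basis F k.
Proof.
apply/ffunP=> k; rewrite sum_ffunE !ffunE (bigD1 i) //= (bigD1 j) //=.
rewrite [in RHS](bigD1 k) //= !ffunE !eqxx !big1 => [|l nl|l nl|l nl].
- by rewrite /GRing.scale /= !mulr1 !addr0.
- by rewrite !ffunE eq_sym (negbTE nl) scaler0.
- by rewrite big1 // => m _; rewrite !ffunE (negbTE nl) mul0r mulr0.
- by rewrite !ffunE (negbTE nl) !mulr0.
Qed.

Lemma sc_norm_basis (F : fieldType) (I : finType) (q : I -> F) b i :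
  sc_norm q b (sc_basis F i) = q i.
Proof.
rewrite /sc_norm (bigD1 i) //= !ffunE eqxx expr1n mulr1.
rewrite big1 ?addr0 => [|k nk]; last by rewrite !ffunE (negbTE nk) expr0n mulr0.
rewrite big1 ?addr0 // => k _; rewrite big1 // => l kl.
rewrite !ffunE; case: eqP => [ki|_]; last by rewrite mul0r mulr0.
case: eqP => [li|_]; last by rewrite mulr0 mulr0.
by rewrite ki li ltnn in kl.
Qed.

Lemma sc_polar_basis (F : fieldType) (I : finType) (q : I -> F) b i j :
  (forall k l, b k l = b l k) -> i != j ->
  polar (sc_norm q b) (sc_basis F i) (sc_basis F j) = b i j.
Proof.
move=> bC nij; rewrite sc_polarE big1 ?add0r => [|k _]; last first.
  rewrite !ffunE; case: eqP => [->|_]; last by rewrite mul0r mulr0.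
  by rewrite (negbTE nij) !mulr0.
wlog lt_ij : i j nij / (enum_rank i < enum_rank j)%N => [wlg|].
  case: (ltngtP (enum_rank i) (enum_rank j)) => [/wlg-> //|lt_ji|].
    rewrite bC -wlg ?[j == i]eq_sym //; apply: eq_bigr => k _.
    by apply: eq_bigr => l _; congr (_ * _); rewrite addrC.
  by move/val_inj/enum_rank_inj=> eij; rewrite eij eqxx in nij.
rewrite (bigD1 i) //= (bigD1 j) //= !ffunE !eqxx (eq_sym j i) (negbTE nij).
rewrite mulr1 mul0r addr0 mulr1 !big1 ?addr0 // => k => [nki|/andP[_ nkj]].
  apply: big1 => l kl; rewrite !ffunE (negbTE nki) mul0r add0r.
  case: eqP => [kj|_]; last by rewrite mul0r mulr0.
  case: eqP => [li|_]; last by rewrite !mulr0.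
  by move: kl; rewrite kj li ltnNge (ltnW lt_ij).
by rewrite !ffunE (negbTE nkj) mulr0 mul0r addr0 mulr0.
Qed.

Definition Z3sq_nz : Type := {p : 'Z_3 * 'Z_3 | p != 0}.
HB.instance Definition _ := Finite.copy Z3sq_nz {p : 'Z_3 * 'Z_3 | p != 0}.

Section Okubo.
Variable F : fieldType.

(* z_p * z_q = okubo_sign p q z_(p + q) *)
Definition okubo_sign (p q : 'Z_3 * 'Z_3) : F :=
  let Delta := p.1 * q.2 - p.2 * q.1 in
  if (Delta == 2%:R) || (p + q == 0) then 0 else
  if Delta == 1 then -1 else 1.

Definition split_okubo : normed_alg F :=
  @sc_alg F Z3sq_nz
    (fun p q r => if val p + val q == val r then okubo_sign (val p) (val q)
                  else 0)
    (fun _ => 0)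
    (fun p q => (val p + val q == 0)%:R).

Definition carry (alpha beta : F) (p q : 'Z_3 * 'Z_3) : F :=
  alpha ^+ ((p.1 + q.1) %/ 3)%N * beta ^+ ((p.2 + q.2) %/ 3)%N.

(* The algebra O_{alpha,beta}, in the basis
   alpha^{i/3} beta^{j/3} z_{i,j}; see [okubo_ab_embedding]. *)
Definition okubo_ab (alpha beta : units F) : normed_alg F :=
  @sc_alg F Z3sq_nz
    (fun p q r => if val p + val q == val r
       then okubo_sign (val p) (val q)
            * carry (val alpha) (val beta) (val p) (val q)
       else 0)
    (fun _ => 0)
    (fun p q => if val p + val q == 0
       then carry (val alpha) (val beta) (val p) (val q) else 0).

(* Gamma_{alpha,beta}; the component of degree 0 is <[0]> = 0. *)
Definition Gamma_ab (alpha beta : units F) (p : 'Z_3 * 'Z_3) :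
    {vspace okubo_ab alpha beta} :=
  <[ [ffun s : Z3sq_nz => (val s == p)%:R] : {ffun Z3sq_nz -> F^o} ]>%VS.

End Okubo.

Lemma okubo_ab11 (F : fieldType) : okubo_ab (1%g : units F) 1%g = split_okubo F.
Proof.
rewrite /okubo_ab /split_okubo; congr (sc_alg _ _ _).
  by do 3![apply/funext=> ?]; rewrite /carry !expr1n mul1r mulr1.
by do 2![apply/funext=> ?]; rewrite /carry !expr1n mul1r; case: ifP.
Qed.

Lemma carryE (F : fieldType) (a b : F) (p q r : 'Z_3 * 'Z_3) : p + q = r ->
  (a ^+ p.1 * b ^+ p.2) * (a ^+ q.1 * b ^+ q.2)
  = (a ^+ r.1 * b ^+ r.2) * carry (a ^+ 3) (b ^+ 3) p q.
Proof.
move=> <-; rewrite /carry mulrACA -!exprD.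
rewrite [in LHS](divn_eq (p.1 + q.1) 3) [in LHS](divn_eq (p.2 + q.2) 3).
by rewrite !exprD !(mulnC _ 3) !exprM; ring.
Qed.

(* Given cubic roots a, b of alpha, beta in an extension K of F, okubo_ab is the
   F-subspace of the split Okubo algebra over K spanned by the a^i b^j z_{i,j},
   with the restricted product and anorm. *)
Lemma okubo_ab_embedding (F K : fieldType) (iota : {rmorphism F -> K})
    (alpha beta : units F) (a b : K) :
  a ^+ 3 = iota (val alpha) -> b ^+ 3 = iota (val beta) ->
  let f (x : okubo_ab alpha beta) : split_okubo K :=
    \sum_(s : Z3sq_nz) (iota ((x : {ffun Z3sq_nz -> F^o}) s)
       * (a ^+ (val s).1 * b ^+ (val s).2)) *: (sc_basis K s : split_okubo K) in
  [/\ injective f,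
      forall x y, f (amul x y) = amul (f x) (f y)
    & forall x, anorm (f x) = iota (anorm x)].
Proof.
move=> a3 b3 f.
have a0 : a != 0.
  by have := valP alpha; rewrite -(fmorph_eq0 iota) -a3 expf_eq0.
have b0 : b != 0.
  by have := valP beta; rewrite -(fmorph_eq0 iota) -b3 expf_eq0.
pose w (s : Z3sq_nz) := a ^+ (val s).1 * b ^+ (val s).2.
have w0 s : w s != 0 by rewrite mulf_neq0 // expf_neq0.
have wE p q r : val p + val q = val r ->
    w p * w q = w r * iota (carry (val alpha) (val beta) (val p) (val q)).
  move=> e; rewrite /w (carryE _ _ e) a3 b3.
  by rewrite /carry rmorphM !rmorphXn.
have fE x s : (f x : {ffun Z3sq_nz -> K^o}) s
    = iota ((x : {ffun Z3sq_nz -> F^o}) s) * w s.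
  rewrite /f sum_ffunE (bigD1 s) //= !ffunE eqxx big1 ?addr0 => [|t nt].
    by rewrite /GRing.scale /= mulr1.
  by rewrite !ffunE eq_sym (negbTE nt) scaler0.
split=> [x y e|x y|x].
- apply/ffunP=> s; apply: (fmorph_inj iota); apply: (mulIf (w0 s)).
  by rewrite -!fE e.
- apply/ffunP=> r; rewrite fE !ffunE rmorph_sum mulr_suml.
  apply: eq_bigr => p _; rewrite rmorph_sum mulr_suml; apply: eq_bigr => q _.
  rewrite !fE; case: eqP => [e|_]; last by rewrite !mul0r rmorph0 mul0r.
  have := wE _ _ _ e; set k := carry _ _ _ _ => {}e; clearbody k.
  rewrite !rmorphM.
  have -> : iota (okubo_sign F (val p) (val q)) = okubo_sign K (val p) (val q).
    by rewrite /okubo_sign; do 2?case: ifP => _; rewrite ?rmorph0 ?rmorphN1 ?rmorph1.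
  symmetry; rewrite [X in _ * X = _]mulrACA e [w r * _]mulrC.
  rewrite [X in _ * X = _]mulrCA !mulrA.
  by [].
- rewrite /= /sc_norm rmorphD !rmorph_sum; congr (_ + _); apply: eq_bigr => p _.
    by rewrite !mul0r rmorph0.
  rewrite rmorph_sum; apply: eq_bigr => q _; rewrite !fE.
  case: eqP => [e|_]; last by rewrite !mul0r rmorph0.
  rewrite !rmorphM mul1r mulrACA [in RHS]mulrC; congr (_ * _).
  rewrite /w (carryE _ _ e) a3 b3 /= !expr0 !mul1r.
  by rewrite /carry !rmorphXn.
Qed.

(* Extension of scalars along iota, in coordinates on a basis e of A:
   A (x) K has basis e_i (x) 1, the structure constants and the values of the
   norm and of its polar form on this basis being the images of those of A. *)
Definition scalar_ext (F K : fieldType) (iota : {rmorphism F -> K})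
    (A : normed_alg F) : normed_alg K :=
  let e := vbasis {:A} in
  @sc_alg K 'I_(\dim {:A})
    (fun i j k => iota (coord e k (amul e`_i e`_j)))
    (fun i => iota (anorm e`_i))
    (fun i j => iota (polar anorm e`_i e`_j)).

Lemma quadratic_form_sum (F : fieldType) (V : lmodType F) (n : V -> F) m
    (v : 'I_m -> V) : quadratic_form n ->
  n (\sum_i v i) = \sum_i n (v i)
    + \sum_i \sum_(j | (enum_rank i < enum_rank j)%N) polar n (v i) (v j).
Proof.
move=> [nZ [[nL nR]]].
have rankE (k : nat) (i j : 'I_k) :
    (enum_rank i < enum_rank j)%N = (i < j)%N by rewrite !enum_rank_ord.
have n0 : n 0 = 0 by rewrite -[0 in LHS](scale0r (0 : V)) nZ expr0n mul0r.
have p0 u : polar n 0 u = 0 by rewrite /polar add0r n0 subr0 subrr.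
elim: m v => [|m IH] v.
  by rewrite !big_ord0 addr0.
pose v' i := v (widen_ord (leqnSn m) i); pose S := \sum_i v' i.
have pS u : polar n S u = \sum_i polar n (v' i) u.
  rewrite /S; elim/big_rec2: _ => [|i y1 y2 _ <-]; first exact: p0.
  by have /= := nL u 1 (v' i) y2; rewrite scale1r mul1r.
have nS : n (S + v ord_max) = n S + n (v ord_max) + polar n S (v ord_max).
  by rewrite /polar; ring.
rewrite big_ord_recr /= -/S nS (IH v') pS [\sum_(i < m.+1) n _]big_ord_recr /=.
rewrite [\sum_(i < m.+1) \sum_(j | _) _]big_ord_recr /= [X in _ + (_ + X)]big1.
  rewrite addr0 -!addrA; congr (_ + _).
  rewrite addrCA; congr (_ + _).
  rewrite -big_split /=; apply: eq_bigr => i _.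
  rewrite [RHS]big_mkcond /= big_ord_recr /= rankE /= ltn_ord; congr (_ + _).
  rewrite big_mkcond /=; apply: eq_bigr => j _; by rewrite !rankE.
by move=> j; rewrite rankE ltnNge -ltnS ltn_ord.
Qed.

(* The canonical map v |-> v (x) 1 from A to its scalar extension preserves the
   product and the norm. *)
Lemma scalar_ext_embedding (F K : fieldType) (iota : {rmorphism F -> K})
    (A : normed_alg F) :
  let f (v : A) : scalar_ext iota A :=
    \sum_i iota (coord (vbasis {:A}) i v) *: (sc_basis K i : scalar_ext iota A)
  in
  (forall u v, f (amul u v) = amul (f u) (f v))
  /\ (forall v, anorm (f v) = iota (anorm v)).
Proof.
move=> f; set e := vbasis {:A}.
have fE (v : A) i : (f v : {ffun 'I_(\dim {:A}) -> K^o}) i = iota (coord e i v).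
  rewrite /f sum_ffunE (bigD1 i) //= !ffunE eqxx big1 ?addr0 => [|t nt].
    by rewrite /GRing.scale /= mulr1.
  by rewrite !ffunE eq_sym (negbTE nt) scaler0.
have eE (v : A) : v = \sum_i coord e i v *: e`_i.
  by apply: coord_vbasis; rewrite memvf.
split=> [u v|v].
- apply/ffunP=> k; rewrite fE ffunE {1}(eE u) {1}(eE v).
  rewrite linear_sumlz linear_sum rmorph_sum; apply: eq_bigr => i _.
  rewrite linear_sumr linear_sum rmorph_sum; apply: eq_bigr => j _.
  rewrite !fE linearZl_LR linearZr_LR !linearZ /=.
  by rewrite /GRing.scale /= !rmorphM [in RHS]mulrC mulrA.
- rewrite {2}(eE v) (quadratic_form_sum (fun i => coord e i v *: e`_i)
    (anorm_quadratic A)).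
  have [nZ [[nL nR]]] := anorm_quadratic A.
  have n0 : @anorm F A 0 = 0.
    by rewrite -[0 in LHS](scale0r (0 : A)) nZ expr0n mul0r.
  have p0l u : polar (@anorm F A) 0 u = 0 by rewrite /polar add0r n0 subr0 subrr.
  have p0r u : polar (@anorm F A) u 0 = 0 by rewrite /polar addr0 n0 subr0 subrr.
  have pZ (a b : F) x y :
      polar (@anorm F A) (a *: x) (b *: y) = a * b * polar anorm x y.
    have /= := nL (b *: y) a x 0; rewrite addr0 p0l addr0 => ->.
    have /= := nR x b y 0; rewrite addr0 p0r addr0 => ->.
    by rewrite mulrA.
  rewrite /= /sc_norm rmorphD !rmorph_sum; congr (_ + _); apply: eq_bigr => i _.
    by rewrite fE nZ rmorphM rmorphXn mulrC.
  rewrite rmorph_sum; apply: eq_bigr => j _.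
  by rewrite !fE pZ !rmorphM mulrC.
Qed.

Definition algebraic_closure (F : fieldType) (K : closedFieldType)
    (iota : {rmorphism F -> K}) : Prop :=
  forall x : K, algebraicOver iota x.

Definition is_okubo (F : fieldType) (A : normed_alg F) : Prop :=
  exists (K : closedFieldType) (iota : {rmorphism F -> K}),
    algebraic_closure iota /\ normed_alg_iso (scalar_ext iota A) (split_okubo K).

Definition is_grading (F : fieldType) (A : normed_alg F) (G : zmodType)
    (Gamma : G -> {vspace A}) : Prop :=
  [/\ forall v : A, exists (s : seq G) (u : G -> A),
        (forall g, u g \in Gamma g) /\ v = \sum_(g <- s) u g,
      forall (s : seq G) (u : G -> A), uniq s ->
        (forall g, u g \in Gamma g) -> \sum_(g <- s) u g = 0 ->
        forall g, g \in s -> u g = 0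
    & forall g h u v, u \in Gamma g -> v \in Gamma h ->
        amul u v \in Gamma (g + h)].

Definition special_grading (F : fieldType) (A : normed_alg F) (G : zmodType)
    (Gamma : G -> {vspace A}) : Prop := Gamma 0 = 0%VS.

Definition equivalent_gradings (F : fieldType) (A B : normed_alg F)
    (G H : zmodType) (Gamma : G -> {vspace A}) (Gamma' : H -> {vspace B}) :
    Prop :=
  exists f : 'Hom(A, B), alg_iso f /\
    forall g, Gamma g != 0%VS -> exists h, (f @: Gamma g)%VS = Gamma' h.

Lemma Gamma_ab_grading (F : fieldType) (alpha beta : units F) :
  is_grading (Gamma_ab alpha beta) /\ special_grading (Gamma_ab alpha beta).
Proof.
have z0 s (g : 'Z_3 * 'Z_3) (u : {ffun Z3sq_nz -> F^o}) :
    u \in Gamma_ab alpha beta g -> val s != g -> u s = 0.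
  by move=> /vlineP[k ->] /negbTE ns; rewrite !ffunE ns scaler0.
have zP (g : 'Z_3 * 'Z_3) (u : {ffun Z3sq_nz -> F^o}) :
    (forall s, val s != g -> u s = 0) -> u \in Gamma_ab alpha beta g.
  move=> u0; apply/vlineP.
  have [s|n] := pickP (fun s : Z3sq_nz => val s == g).
    move=> /eqP e; exists (u s); apply/ffunP=> t; rewrite !ffunE.
    have [te|/u0->] := eqVneq (val t) g; last by rewrite scaler0.
    have -> : t = s by apply/val_inj; rewrite te e.
    by rewrite /GRing.scale /= mulr1.
  exists 0; apply/ffunP=> t; rewrite scale0r !ffunE u0 //.
  by rewrite n.
split; last first.
  apply/eqP; rewrite -subv0; apply/subvP=> v v0; rewrite memv0; apply/eqP.
  by apply/ffunP=> s; rewrite ffunE (z0 s 0) ?(valP s).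
split=> [v|s u us uG su0 g gs|g h u v ug vh].
- pose w : {ffun Z3sq_nz -> F^o} := v.
  exists (index_enum ('Z_3 * 'Z_3)%type).
  exists (fun g => [ffun s => if val s == g then w s else 0] : {ffun Z3sq_nz -> F^o}).
  split=> [g|]; first by apply: zP => s /negbTE ns; rewrite ffunE ns.
  apply/ffunP=> s; rewrite sum_ffunE (bigD1 (val s)) //= ffunE eqxx.
  rewrite big1 ?addr0 // => g ng; rewrite ffunE eq_sym (negbTE ng) //.
- apply/ffunP=> t; rewrite ffunE.
  have [e|] := eqVneq (val t) g; last exact: z0.
  have := congr1 (fun f : {ffun Z3sq_nz -> F^o} => f t) su0.
  rewrite sum_ffunE ffunE (bigD1_seq g) //= big1 ?addr0 // => h nh.
  by apply: (z0 t h) => //; rewrite e eq_sym.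
- apply: zP => k nk; rewrite ffunE big1 // => i _; rewrite big1 // => j _.
  case: eqP => [e|_]; last by rewrite mul0r.
  have [ig|/(z0 _ _ _ ug)->] := eqVneq (val i) g; last by rewrite mul0r mulr0.
  have [jh|/(z0 _ _ _ vh)->] := eqVneq (val j) h; last by rewrite !mulr0.
  by rewrite -e ig jh eqxx in nk.
Qed.

Section LinearGroup.
Variables (F : fieldType) (V : vectType F).

Definition GLV : Type := {f : 'End(V) | lker f == 0%VS}.
HB.instance Definition _ := SubChoice.copy GLV {f : 'End(V) | lker f == 0%VS}.

Fact GLV_one_subproof : lker (\1%VF : 'End(V)) == 0%VS.
Proof. by apply/lker0P=> x y; rewrite !lfunE. Qed.
Fact GLV_mul_subproof (f g : GLV) : lker (val f \o val g)%VF == 0%VS.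
Proof.
apply/lker0P=> x y; rewrite !comp_lfunE.
by move=> /(lker0P (valP f)) /(lker0P (valP g)).
Qed.
Fact GLV_inv_subproof (f : GLV) : lker (val f)^-1%VF == 0%VS.
Proof.
have fK := lker0_lfunVK (valP f).
by apply/lker0P=> x y e; rewrite -[x]fK e fK.
Qed.

Definition GLV_one : GLV := exist _ \1%VF GLV_one_subproof.
Definition GLV_mul (f g : GLV) : GLV :=
  exist _ (val f \o val g)%VF (GLV_mul_subproof f g).
Definition GLV_inv (f : GLV) : GLV := exist _ (val f)^-1%VF (GLV_inv_subproof f).

Fact GLV_mulA : associative GLV_mul.
Proof. by move=> f g h; apply/val_inj; rewrite /= comp_lfunA. Qed.
Fact GLV_mul1 : left_id GLV_one GLV_mul.
Proof. by move=> f; apply/val_inj; rewrite /= comp_lfun1l. Qed.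
Fact GLV_mulr1 : right_id GLV_one GLV_mul.
Proof. by move=> f; apply/val_inj; rewrite /= comp_lfun1r. Qed.
Fact GLV_mulV : left_inverse GLV_one GLV_inv GLV_mul.
Proof. by move=> f; apply/val_inj; rewrite /= lker0_compVf ?(valP f). Qed.
Fact GLV_mulrV : right_inverse GLV_one GLV_inv GLV_mul.
Proof. by move=> f; apply/val_inj; rewrite /= lker0_compfV ?(valP f). Qed.

HB.instance Definition _ := isGroup.Build GLV
  GLV_mulA GLV_mul1 GLV_mulr1 GLV_mulV GLV_mulrV.

End LinearGroup.

Section GradingGroups.
Variables (F : fieldType) (A : normed_alg F) (G : zmodType).
Variable Gamma : G -> {vspace A}.

Definition in_Aut (f : GLV A) : Prop :=
  [/\ forall u v : A, val f (amul u v) = amul (val f u) (val f v),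
      forall g, Gamma g != 0%VS -> exists h, (val f @: Gamma g)%VS = Gamma h
    & forall h, Gamma h != 0%VS -> exists g, (val f @: Gamma g)%VS = Gamma h].

Fact GLV_VK (f : GLV A) (x : A) : val f (val (f^-1)%g x) = x.
Proof. exact: (lker0_lfunVK (valP f)). Qed.
Fact GLV_K (f : GLV A) (x : A) : val (f^-1)%g (val f x) = x.
Proof. exact: (lker0_lfunK (valP f)). Qed.

Fact GLV_eq0 (f : GLV A) (U : {vspace A}) :
  ((val f @: U)%VS == 0%VS) = (U == 0%VS).
Proof.
by rewrite -!dimv_eq0 limg_dim_eq // (eqP (valP f)) capv0.
Qed.

Fact GLV_imgVK (f : GLV A) (U W : {vspace A}) :
  (val f @: U)%VS = W -> (val (f^-1)%g @: W)%VS = U.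
Proof. by move=> <-; rewrite -limg_comp lker0_compVf ?lim1g ?(valP f). Qed.

Fact in_Aut1 : in_Aut 1%g.
Proof.
split=> [u v|g _|g _]; first by rewrite !lfunE.
  by exists g; rewrite lim1g.
by exists g; rewrite lim1g.
Qed.

Fact in_AutV f : in_Aut f -> in_Aut f^-1%g.
Proof.
move=> [fM f1 f2]; split=> [u v|g /f2[h e]|g /f1[h e]].
- by rewrite -{1}(GLV_VK f u) -{1}(GLV_VK f v) -fM GLV_K.
- by exists h; apply: GLV_imgVK.
- by exists h; apply: GLV_imgVK.
Qed.

Fact in_AutM f g : in_Aut f -> in_Aut g -> in_Aut (f * g)%g.
Proof.
move=> [fM f1 f2] [gM g1 g2]; split=> [u v|x nx|x nx].
- by rewrite /= !comp_lfunE gM fM.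
- have [y ey] := g1 x nx.
  have [|z ez] := f1 y; first by rewrite -ey GLV_eq0.
  by exists z; rewrite /= limg_comp ey.
- have [y ey] := f2 x nx.
  have [|z ez] := g2 y; first by rewrite -(GLV_eq0 f) ey.
  by exists z; rewrite /= limg_comp ez.
Qed.

Fact Aut_closed : group_closed [pred f : GLV A | `[< in_Aut f >]].
Proof.
split=> [|f g]; rewrite !inE; first exact: in_Aut1.
by move=> Af Ag; apply/in_AutM/in_AutV.
Qed.
Definition Aut_subgroup : subgroup (GLV A) := Subgroup Aut_closed.

Definition Aut_grading : groupType := group_of Aut_subgroup.

Definition in_Stab (f : Aut_grading) : Prop :=
  forall g, (val (val f) @: Gamma g)%VS = Gamma g.

Fact in_StabV f : in_Stab f -> in_Stab f^-1%g.
Proof. by move=> Sf g; apply: (@GLV_imgVK (val f)). Qed.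
Fact in_StabM f g : in_Stab f -> in_Stab g -> in_Stab (f * g)%g.
Proof. by move=> Sf Sg x; rewrite /= limg_comp Sg Sf. Qed.

Fact Stab_closed : group_closed [pred f : Aut_grading | `[< in_Stab f >]].
Proof.
split=> [|f g]; rewrite !inE; first by move=> g; rewrite /= lim1g.
by move=> Af Ag; apply/in_StabM/in_StabV.
Qed.

Fact Stab_conj (f g : Aut_grading) :
  f \in Subgroup Stab_closed -> (f ^ g)%g \in Subgroup Stab_closed.
Proof.
rewrite !inE => Sf x.
rewrite /= !limg_comp.
have [/eqP x0|nx] := boolP (Gamma x == 0%VS); first by rewrite x0 !limg0.
have [_ gx _] := asboolP _ (valP g).
have [y ey] := gx x nx.
by rewrite ey Sf; apply: GLV_imgVK.
Qed.

Definition Stab_grading : normal_subgroup Aut_grading := NormalSubgroup Stab_conj.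

Definition Weyl_group : groupType := quotient_group Stab_grading.

Definition generated_by_support : set G :=
  [set g | forall S : {pred G}, zmod_closed S ->
     (forall h, Gamma h != 0%VS -> h \in S) -> g \in S].

(* [vpick U] is a nonzero vector of U if U != 0.  Outside of generated_by_support,
   and if the argument of insubd is 0, the value is irrelevant. *)
Definition Phi (g : G) : cube_classes F :=
  if g == 0 then 1%g else
  let u := vpick (Gamma g) in
  cube_class (insubd (1%g : units F) (polar anorm u (amul u u))).

Definition Phi_image : set (cube_classes F) := (Phi @` generated_by_support)%classic.

End GradingGroups.

Definition Phi_image_appears
    (P : forall F : fieldType, set (cube_classes F) -> Prop) : Prop :=
  exists (F : fieldType) (A : normed_alg F) (G : zmodType)
    (Gamma : G -> {vspace A}),
    [/\ is_okubo A, is_grading Gamma, special_grading Gamma & P F (Phi_image Gamma)].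

(* Main.v *)
(* An Okubo algebra is a symmetric composition algebra, (x * y) * x = n(x) y =
   x * (y * x) with n nondegenerate: this is checked on the basis of the split
   algebra and descends from the algebraic closure.  In a special grading, x and z
   homogeneous of opposite degrees satisfy (x * x) * z = n(x, z) x.  Hence squares
   of nonzero homogeneous elements do not vanish, the degrees in the support have
   order 3, the components are lines, and exactly one of the products x * y, y * x
   vanishes when the degrees of x and y are independent.  If y * x = 0, the
   linearized identities give the whole multiplication table of O_{alpha,beta} on
   the basis generated by x and y, with alpha = n(x, x * x), beta = n(y, y * y).

   An automorphism of the grading permutes the degrees by a matrix M which has
   determinant 1, since the vanishing of products orients (Z/3)^2, and which
   preserves Phi; if M = 1 it is e_{i,j} |-> c^i c'^j e_{i,j} with c^3 = c'^3 = 1.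
   Choosing x and y according to the kernel of Phi, one reaches alpha = beta = 1, or
   alpha = 1, or Phi injective.  In each case the structure constants are invariant
   under the matrices that preserve Phi, and e_p |-> e_(M p) splits the Weyl group.
   The three cases occur over the rationals for (alpha, beta) = (1, 1), (1, 2) and
   (2, 3). *)
From HB Require Import structures.
Require Import Defs.
From mathcomp Require Import all_boot all_algebra all_field.
From mathcomp Require Import boolp classical_sets.
From mathcomp Require Import ring.

Set Implicit Arguments.
Unset Strict Implicit.
Unset Printing Implicit Defensive.

Import GRing.Theory.
Local Open Scope classical_set_scope.
Local Open Scope ring_scope.

(** The obstacle to splitting is that the structure constants of O_{alpha,beta} contain the carries
    of additions modulo 3, which a matrix of determinant 1 need not respect. If M preserves Phi,
    then N(e_(M p)) and N(e_p), with N(x) = n(x, x * x), agree only up to a cube, so in an arbitrary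
    frame an automorphism over M has to rescale the e_(M p), and the scalars chosen for different M
    need not compose. Normalizing alpha to the element 1, and not merely to a cube, makes the
    carries literally invariant; then no scalars are needed, and the same map computes the Weyl
    group and splits it. Isomorphisms and automorphisms of gradings are only required to respect the
    product. The norm and N are recovered from the product, by x * y * x = n(x) y and by (x * x) *
    (x * x) = N(x) x when n(x) = 0. The study of frames is uniform in the characteristic: norms of
    homogeneous vectors vanish for reasons of degree, since in characteristic 2 the polar form does
    not determine the norm. *)

Notation Z3sq := ('Z_3 * 'Z_3)%type.

(* [forall p : Z3sq] does not compute, an explicit list does. *)
Definition Z3sq_list : seq Z3sq :=
  [seq (i, j) | i <- [:: 0; 1; 2%:R], j <- [:: 0; 1; 2%:R]].

Lemma Z3sq_all (P : pred Z3sq) : all P Z3sq_list -> forall p, P p.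
Proof.
move=> /allP PZ p; apply: PZ.
by case: p => [[[|[|[|i]]] Hi] [[|[|[|j]]] Hj]].
Qed.

Lemma Z3sq_all2 (P : Z3sq -> pred Z3sq) :
  all (fun p => all (P p) Z3sq_list) Z3sq_list -> forall p q, P p q.
Proof. by move=> /Z3sq_all PZ p; apply: Z3sq_all. Qed.

Lemma Z3sq_all3 (P : Z3sq -> Z3sq -> pred Z3sq) :
  all (fun p => all (fun q => all (P p q) Z3sq_list) Z3sq_list) Z3sq_list ->
  forall p q r, P p q r.
Proof. by move=> /Z3sq_all2 PZ p q; apply: Z3sq_all. Qed.

(** * Sign identities of the split Okubo algebra *)

Definition znz (p : Z3sq) (np : p != 0) : Z3sq_nz :=
  exist (fun q : Z3sq => q != 0) p np.

Definition zdet (p q : Z3sq) : 'Z_3 := p.1 * q.2 - p.2 * q.1.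

(** An integer copy of [okubo_sign]: sign identities are decided by computation over [int], and
    [okubo_signE] carries them to every field. *)
Definition okubo_signz (p q : Z3sq) : int :=
  if (zdet p q == 2%:R) || (p + q == 0) then 0 else
  if zdet p q == 1 then -1 else 1.

Lemma okubo_signE (F : fieldType) p q :
  okubo_sign F p q = (okubo_signz p q)%:~R.
Proof.
by rewrite /okubo_sign /okubo_signz; case: ifP => //; case: ifP.
Qed.

(** The identity (x * y) * z + (z * y) * x = n(x, z) y on basis vectors of degrees p, q, r. When p +
    q = 0 the sign of p and q is already 0, so no vector of degree 0 enters. *)
Lemma okubo_signz_comp p q r : p != 0 -> q != 0 -> r != 0 ->
  okubo_signz p q * okubo_signz (p + q) r
    + okubo_signz r q * okubo_signz (r + q) p = (p + r == 0)%:R.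
Proof.
suff H : [==> p != 0, q != 0, r != 0 =>
  okubo_signz p q * okubo_signz (p + q) r
    + okubo_signz r q * okubo_signz (r + q) p == (p + r == 0)%:R].
  by move=> np nq nr; apply/eqP; rewrite np nq nr in H.
by move: p q r; apply: Z3sq_all3; vm_compute.
Qed.

Lemma okubo_signz_compl p q r : p != 0 -> q != 0 -> r != 0 ->
  okubo_signz p (q + r) * okubo_signz q r
    + okubo_signz r (q + p) * okubo_signz q p = (p + r == 0)%:R.
Proof.
suff H : [==> p != 0, q != 0, r != 0 =>
  okubo_signz p (q + r) * okubo_signz q r
    + okubo_signz r (q + p) * okubo_signz q p == (p + r == 0)%:R].
  by move=> np nq nr; apply/eqP; rewrite np nq nr in H.
by move: p q r; apply: Z3sq_all3; vm_compute.
Qed.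

(* A constant, so that the module structure in [polar] is always the one of
   [alg_carrier A], also when A is given by structure constants. *)
Definition apolar (F : fieldType) (A : normed_alg F) (x y : A) : F :=
  polar (@anorm F A) x y.

(** * Symmetric composition identities and their verification on a spanning family *)

Section NormedAlg.
Variables (F : fieldType) (A : normed_alg F).
Implicit Types (x y z : A) (c : F).

Lemma amulDl x y z : amul (x + y) z = amul x z + amul y z.
Proof. exact: linearDl. Qed.
Lemma amulDr x y z : amul z (x + y) = amul z x + amul z y.
Proof. exact: linearD. Qed.
Lemma amulZl c x y : amul (c *: x) y = c *: amul x y.
Proof. exact: linearZl_LR. Qed.
Lemma amulZr c x y : amul x (c *: y) = c *: amul x y.
Proof. exact: linearZ. Qed.
Lemma amul0l x : amul 0 x = 0.
Proof. exact: linear0l. Qed.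
Lemma amul0r x : amul x 0 = 0.
Proof. exact: linear0. Qed.
Lemma amulNl x y : amul (- x) y = - amul x y.
Proof. exact: linearNl. Qed.
Lemma amulNr x y : amul x (- y) = - amul x y.
Proof. exact: linearN. Qed.
Notation pol := (@apolar F A).

Lemma anormZ c x : anorm (c *: x) = c ^+ 2 * anorm x.
Proof. by case: (anorm_quadratic A) => nZ _; apply: nZ. Qed.
Lemma anorm0 : @anorm F A 0 = 0.
Proof. by rewrite -(scale0r (0 : A)) anormZ expr0n mul0r. Qed.
Lemma anormD x y : anorm (x + y) = anorm x + anorm y + pol x y.
Proof. by rewrite /apolar /polar -[_ - _ - _]addrA -opprD [RHS]addrC subrK. Qed.
Lemma polar0l x : pol 0 x = 0.
Proof. by rewrite /apolar /polar add0r anorm0 subr0 subrr. Qed.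
Lemma polar0r x : pol x 0 = 0.
Proof. by rewrite /apolar /polar addr0 anorm0 subr0 subrr. Qed.
Lemma polarC x y : pol x y = pol y x.
Proof. by rewrite /apolar /polar [x + y]addrC addrAC. Qed.
Lemma polarDl x y z : pol (x + y) z = pol x z + pol y z.
Proof.
have [_ [[nL _]]] := anorm_quadratic A.
by have /= := nL z 1 x y; rewrite scale1r mul1r.
Qed.
Lemma polarDr x y z : pol z (x + y) = pol z x + pol z y.
Proof. by rewrite ![pol z _]polarC polarDl. Qed.
Lemma polarZl c x y : pol (c *: x) y = c * pol x y.
Proof.
have [_ [[nL _]]] := anorm_quadratic A.
by have /= := nL y c x 0; rewrite addr0 -!/(apolar _ _) polar0l addr0.
Qed.
Lemma polarZr c x y : pol x (c *: y) = c * pol x y.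
Proof. by rewrite ![pol x _]polarC polarZl. Qed.
Lemma polar_sumr (I : Type) (s : seq I) (E : I -> A) x :
  pol x (\sum_(i <- s) E i) = \sum_(i <- s) pol x (E i).
Proof. by elim/big_rec2: _ => [|i y z _ <-]; rewrite ?polar0r ?polarDr. Qed.

Definition symmetric_composition :=
  [/\ forall x y, amul (amul x y) x = anorm x *: y,
      forall x y, amul x (amul y x) = anorm x *: y
    & forall x, (forall y, pol x y = 0) -> x = 0].

(** Spanning as an induction principle: multilinear identities extend one argument at a time without
    expanding sums. The index type is arbitrary, so the family may also be the image of a semilinear
    map, as in the descent from the closure. *)
Definition linear_spanning (I : Type) (e : I -> A) : Prop :=
  forall P : A -> Prop, P 0 -> (forall x y, P x -> P y -> P (x + y)) ->
    (forall k x, P x -> P (k *: x)) -> (forall i, P (e i)) -> forall x, P x.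

Definition linearized_comp x y z : Prop :=
  amul (amul x y) z + amul (amul z y) x = pol x z *: y
  /\ amul x (amul y z) + amul z (amul y x) = pol x z *: y.

Lemma linearized_comp_spanning (I : Type) (e : I -> A) : linear_spanning e ->
  (forall i j k, linearized_comp (e i) (e j) (e k)) ->
  forall x y z, linearized_comp x y z.
Proof.
rewrite /linearized_comp => eP H x y z.
move: x; apply: (eP _) => [|x x' [h1 h2] [h1' h2']|k x [h1 h2]|s].
- by rewrite polar0l !(amul0l, amul0r) scale0r addr0.
- rewrite polarDl !(amulDl, amulDr) scalerDl addrACA h1 h1'.
  by split=> //; rewrite addrACA h2 h2'.
- by rewrite polarZl !(amulZl,amulZr) -scalerA -!scalerDr h1 h2.
move: y; apply: (eP _) => [|x x' [h1 h2] [h1' h2']|k x [h1 h2]|t].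
- by rewrite !(amul0l, amul0r) scaler0 addr0.
- rewrite !(amulDl, amulDr) scalerDr addrACA h1 h1'.
  by split=> //; rewrite addrACA h2 h2'.
- by rewrite !(amulZl,amulZr) -!scalerDr h1 h2 !scalerA mulrC.
move: z; apply: (eP _) => [|x x' [h1 h2] [h1' h2']|k x [h1 h2]|r //].
- by rewrite polar0r !(amul0l, amul0r) scale0r addr0.
- rewrite polarDr !(amulDl, amulDr) scalerDl addrACA h1 h1'.
  by split=> //; rewrite addrACA h2 h2'.
- by rewrite polarZr !(amulZl,amulZr) -scalerA -!scalerDr h1 h2.
Qed.

(** The linearized identities measure the failure of additivity of both sides of the quadratic ones,
    so these need checking only on the family. That check is a separate hypothesis because in
    characteristic 2 the linearized identities do not imply it. *)
Lemma composition_spanning (I : Type) (e : I -> A) : linear_spanning e ->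
  (forall x y z, linearized_comp x y z) -> (forall i, anorm (e i) = 0) ->
  (forall i j, amul (amul (e i) (e j)) (e i) = 0) ->
  (forall i j, amul (e i) (amul (e j) (e i)) = 0) ->
  (forall x y, amul (amul x y) x = anorm x *: y)
  /\ (forall x y, amul x (amul y x) = anorm x *: y).
Proof.
move=> eP lin n0 m1 m2; split=> x y.
- move: x; apply: (eP _) => [|x x' h h'|k x h|i].
  + by rewrite amul0r anorm0 scale0r.
  + rewrite anormD [RHS]scalerDl scalerDl -(lin x y x').1 -h -h' !(amulDl, amulDr).
    by rewrite [X in _ + X = _]addrC addrACA [X in _ + X = _]addrC.
  + by rewrite anormZ !(amulZl,amulZr) h !scalerA.
  + rewrite n0 scale0r; move: y; apply: (eP _) => [|y y' h h'|k y h|//].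
    * by rewrite amul0r amul0l.
    * by rewrite !(amulDl, amulDr) h h' addr0.
    * by rewrite !(amulZl,amulZr) h scaler0.
- move: x; apply: (eP _) => [|x x' h h'|k x h|i].
  + by rewrite amul0l anorm0 scale0r.
  + rewrite anormD [RHS]scalerDl scalerDl -(lin x y x').2 -h -h' !(amulDl, amulDr).
by rewrite [X in _ + X = _]addrC addrACA.
  + by rewrite anormZ !(amulZl,amulZr) h !scalerA.
  + rewrite n0 scale0r; move: y; apply: (eP _) => [|y y' h h'|k y h|//].
    * by rewrite amul0l amul0r.
    * by rewrite !(amulDl, amulDr) h h' addr0.
    * by rewrite !(amulZl,amulZr) h scaler0.
Qed.

End NormedAlg.

Section Sc.
Variables (F : fieldType) (I : finType).
Variables (c : I -> I -> I -> F) (q : I -> F) (b : I -> I -> F).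
Local Notation A := (sc_alg c q b).
Local Notation V := {ffun I -> F^o}.
Local Notation e i := (sc_basis F i : A).

Lemma sc_basisE (x : V) : x = \sum_i x i *: sc_basis F i.
Proof.
apply/ffunP=> i; rewrite sum_ffunE (bigD1 i) //= !ffunE eqxx big1 ?addr0.
  by rewrite /GRing.scale /= mulr1.
by move=> j nj; rewrite !ffunE eq_sym (negbTE nj) scaler0.
Qed.

Lemma sc_basis_ind (P : A -> Prop) :
  P 0 -> (forall x y, P x -> P y -> P (x + y)) ->
  (forall k x, P x -> P (k *: x)) -> (forall i, P (e i)) -> forall x, P x.
Proof.
move=> P0 PD PZ Pe x; rewrite [x]sc_basisE.
by apply: (big_ind P) => // i _; apply: PZ.
Qed.
End Sc.

(** * The split Okubo algebra is a symmetric composition algebra *)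

Section Split.
Variable F : fieldType.
Local Notation O := (split_okubo F).

Definition okubo_z (p : Z3sq) : O :=
  ([ffun s : Z3sq_nz => (val s == p)%:R] : {ffun Z3sq_nz -> F^o}).

Lemma okubo_z_basis (s : Z3sq_nz) : sc_basis F s = okubo_z (val s).
Proof. by apply/ffunP=> t; rewrite !ffunE -(inj_eq val_inj). Qed.

Lemma okubo_zM (s t : Z3sq_nz) : amul (okubo_z (val s)) (okubo_z (val t)) =
  (okubo_signz (val s) (val t))%:~R *: okubo_z (val s + val t).
Proof.
rewrite -!okubo_z_basis /= sc_prod_basis; apply/ffunP=> r.
rewrite sum_ffunE !ffunE (bigD1 r) //= !ffunE eqxx big1 ?addr0.
  rewrite okubo_signE eq_sym.
  by case: eqP; rewrite /GRing.scale /= ?mulr1 ?mul0r ?mulr0.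
move=> u nu; rewrite !ffunE [r == u]eq_sym (negbTE nu) scaler0 //.
Qed.
End Split.

Section SplitComposition.
Variable F : fieldType.
Local Notation O := (split_okubo F).

Lemma okubo_zMM (s t r : Z3sq_nz) :
  amul (amul (okubo_z F (val s)) (okubo_z F (val t))) (okubo_z F (val r)) =
  (okubo_signz (val s) (val t) * okubo_signz (val s + val t) (val r))%:~R
    *: okubo_z F (val s + val t + val r).
Proof.
rewrite okubo_zM amulZl; have [e|ne] := eqVneq (val s + val t) 0.
  by rewrite [okubo_signz (val s) (val t)]/okubo_signz e eqxx orbT mul0r !scale0r.
by rewrite (okubo_zM F (znz ne) r) /= scalerA -rmorphM.
Qed.

Lemma okubo_zMMr (s t r : Z3sq_nz) :
  amul (okubo_z F (val s)) (amul (okubo_z F (val t)) (okubo_z F (val r))) =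
  (okubo_signz (val s) (val t + val r) * okubo_signz (val t) (val r))%:~R
    *: okubo_z F (val s + val t + val r).
Proof.
rewrite okubo_zM amulZr; have [e|ne] := eqVneq (val t + val r) 0.
  by rewrite [okubo_signz (val t) _]/okubo_signz e eqxx orbT mulr0 !scale0r.
by rewrite (okubo_zM F s (znz ne)) /= scalerA -rmorphM mulrC addrA.
Qed.

Lemma okubo_z_polar (s t : Z3sq_nz) :
  apolar (okubo_z F (val s)) (okubo_z F (val t)) =
  (val s + val t == 0)%:R.
Proof.
(* [sc_polar_basis] covers distinct indices only. On the diagonal the polar form is twice the norm,
   hence 0, in accordance with 2s != 0 in (Z/3)^2. *)
have [<-|nst] := eqVneq s t; last first.
  rewrite -!okubo_z_basis /apolar /= sc_polar_basis // => k l.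
  by rewrite addrC.
rewrite /apolar /= sc_polarE big1 ?add0r => [|i _]; last by rewrite mulr0 mul0r.
rewrite big1 => [|i _].
  suff /negbTE-> : val s + val s != 0 by [].
  have /implyP := Z3sq_all (P := fun p => (p != 0) ==> (p + p != 0)) isT (val s).
  by apply; apply: (valP s).
apply: big1 => j ij; rewrite !ffunE !(inj_eq val_inj).
case: (i =P s) => [ei|_]; last by rewrite !mul0r addr0 mulr0.
case: (j =P s) => [ej|_]; last by rewrite !mulr0 addr0 mulr0.
by rewrite ei ej ltnn in ij.
Qed.

Lemma okubo_z_spanning :
  linear_spanning (fun s : Z3sq_nz => okubo_z F (val s)).
Proof.
by move=> P *; apply: sc_basis_ind => // s; rewrite okubo_z_basis.
Qed.

Lemma split_okubo_symmetric : symmetric_composition O.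
Proof.
(* The products z_s * z_t * z_s, bracketed either way, vanish: this is the quadratic information
   that polarization loses in characteristic 2. *)
have sq (s t : Z3sq_nz) :
    okubo_signz (val s) (val t) * okubo_signz (val s + val t) (val s) = 0
    /\ okubo_signz (val s) (val t + val s) * okubo_signz (val t) (val s) = 0.
  have := valP s; have := valP t; move: (val s) (val t) => p q /= nq np.
  suff : [==> p != 0, q != 0 =>
     (okubo_signz p q * okubo_signz (p + q) p == 0)
     && (okubo_signz p (q + p) * okubo_signz q p == 0)].
    by rewrite np nq /= => /andP[/eqP h1 /eqP].
  by move: p q {np nq}; apply: Z3sq_all2; vm_compute.
have [] := composition_spanning okubo_z_spanning.
- apply: (linearized_comp_spanning okubo_z_spanning) => s t r.
  rewrite /linearized_comp !okubo_zMM !okubo_zMMr okubo_z_polar.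
  have -> : val r + val t + val s = val s + val t + val r.
    by rewrite addrC [val r + _]addrC addrA.
  rewrite -!scalerDl -!rmorphD /=.
  rewrite okubo_signz_comp ?okubo_signz_compl ?(valP s) ?(valP t) ?(valP r) //.
  case: eqP => e; last by rewrite !scale0r.
  by rewrite addrAC e add0r.
- by move=> s; rewrite -okubo_z_basis; exact: sc_norm_basis.
- by move=> s t; rewrite okubo_zMM (sq s t).1 scale0r.
- by move=> s t; rewrite okubo_zMMr (sq s t).2 scale0r.
move=> h1 h2; split=> // x x0; apply/ffunP=> s; rewrite ffunE.
(* For nondegeneracy, pairing with z_{-s} extracts the coordinate of index s. *)
have ns : - val s != 0 by rewrite oppr_eq0 (valP s).
have := x0 (okubo_z F (- val s)); rewrite polarC {1}[x]sc_basisE polar_sumr.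
rewrite (bigD1 s) //= polarZr okubo_z_basis.
rewrite (okubo_z_polar (znz ns)) /= addNr eqxx mulr1 big1 ?addr0 //.
move=> t nt; rewrite polarZr okubo_z_basis (okubo_z_polar (znz ns)) /=.
by move: nt; rewrite -(inj_eq val_inj) addrC subr_eq0 => /negbTE->; rewrite mulr0.
Qed.
End SplitComposition.

(** * Descent from the algebraic closure *)

Section Transfer.
Variables (F K : fieldType) (iota : {rmorphism F -> K}).
Variables (A : normed_alg F) (B : normed_alg K) (f : A -> B).
Hypothesis fD : forall x y, f (x + y) = f x + f y.
Hypothesis fZ : forall c x, f (c *: x) = iota c *: f x.
Hypothesis fM : forall x y, f (amul x y) = amul (f x) (f y).
Hypothesis fn : forall x, anorm (f x) = iota (anorm x).
Hypothesis f_inj : injective f.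
Hypothesis f_span : linear_spanning f.

(** The map f is semilinear, to cover both v -> v (x) 1 and, with [iota] the identity, an
    isomorphism. Its image spans B over K, so a vector orthogonal to A has an image orthogonal to
    B. *)
Lemma symmetric_composition_transfer :
  symmetric_composition B -> symmetric_composition A.
Proof.
case=> h1 h2 h3; split=> [x y|x y|x x0].
- by apply: f_inj; rewrite !fM fZ h1 fn.
- by apply: f_inj; rewrite !fM fZ h2 fn.
apply: f_inj; have -> : f 0 = 0 by rewrite -(scale0r (0 : A)) fZ rmorph0 scale0r.
apply: h3; apply: f_span => [|y z h h'|k y h|y].
- exact: polar0r.
- by rewrite [LHS]polarDr [X in X + _]h [X in _ + X]h' addr0.
- by rewrite [LHS]polarZr [X in _ * X]h mulr0.
- by rewrite /apolar /polar -fD !fn -!rmorphB [X in iota X]x0 rmorph0.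
Qed.
End Transfer.

Lemma card_Z3sq_nz : #|{: Z3sq_nz}| = 8.
Proof.
have -> : 8 = #|{: Z3sq}|.-1 by rewrite card_prod !card_ord.
by rewrite card_sig -(cardC1 (0 : Z3sq)); apply: eq_card => p; rewrite !inE.
Qed.

Lemma dim_sc (F : fieldType) (I : finType) : \dim {: {ffun I -> F^o}} = #|I|.
Proof. by rewrite dimvf /dim /= muln1. Qed.

Lemma alg_iso_dim (F : fieldType) (A B : normed_alg F) (f : 'Hom(A, B)) :
  bijective f -> \dim {:A} = \dim {:B}.
Proof.
move=> [g fK gK].
have <- : (f @: fullv)%VS = fullv.
  by apply/eqP; rewrite eqEsubv subvf /=; apply/subvP=> y _;
    rewrite -[y]gK memv_img ?memvf.
by rewrite limg_dim_eq //; apply/eqP; rewrite -subv0; apply/subvP=> x;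
   rewrite memv_cap memv_ker memv0 -(inj_eq (can_inj fK)) linear0 => /andP[].
Qed.

(** The study of a special grading draws on [is_okubo] through these two properties alone; the
    multiplication table is then recovered from the grading. *)
Lemma okubo_symmetric (F : fieldType) (A : normed_alg F) :
  is_okubo A -> symmetric_composition A /\ \dim {:A} = 8.
Proof.
move=> [K [iota [_ [phi [[phib phiM] phin]]]]].
have dA : \dim {:A} = 8.
  have := alg_iso_dim phib; rewrite /= !dim_sc card_ord => ->.
  exact: card_Z3sq_nz.
split=> //.
pose f (v : A) : scalar_ext iota A :=
  \sum_i iota (coord (vbasis {:A}) i v) *: (sc_basis K i : scalar_ext iota A).
have [fM fn] : (forall u v, f (amul u v) = amul (f u) (f v))
  /\ (forall v, anorm (f v) = iota (anorm v)) by exact: scalar_ext_embedding.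
have fE v i : (f v : {ffun 'I_(\dim {:A}) -> K^o}) i
    = iota (coord (vbasis {:A}) i v).
  rewrite /f sum_ffunE (bigD1 i) //= !ffunE eqxx big1 ?addr0 => [|t nt].
    by rewrite /GRing.scale /= mulr1.
  by rewrite !ffunE eq_sym (negbTE nt) scaler0.
have fD u v : f (u + v) = f u + f v.
  by apply/ffunP=> i; rewrite ffunE !fE linearD rmorphD.
have fZ c v : f (c *: v) = iota c *: f v.
  by apply/ffunP=> i; rewrite ffunE !fE linearZ rmorphM.
have f_inj : injective f.
  move=> u v euv; rewrite (coord_vbasis (memvf u)) (coord_vbasis (memvf v)).
  apply: eq_bigr => i _; congr (_ *: _); apply: (fmorph_inj iota).
  by rewrite -!fE euv.
have fe (i : 'I_(\dim {:A})) : f (vbasis {:A})`_i = sc_basis K i.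
  apply/ffunP=> j; rewrite fE ffunE coord_free ?(basis_free (vbasisP _)) //.
  by rewrite eq_sym; case: eqP; rewrite ?rmorph1 ?rmorph0.
apply: (symmetric_composition_transfer fD fZ fM fn f_inj) => [P P0 PD PZ Pf|].
  by apply: sc_basis_ind => // i; rewrite -fe.
have [h1 h2 h3] := split_okubo_symmetric K.
apply: (@symmetric_composition_transfer K K idfun _ _ phi _ _ phiM phin (bij_inj
  phib)) => //.
- exact: linearD.
- by move=> c x; rewrite linearZ.
- move=> P P0 PD PZ Pphi x; have [g _ gK] := phib; rewrite -[x]gK.
  exact: Pphi.
Qed.

(** * Special gradings *)

Section Special.
Variables (F : fieldType) (A : normed_alg F) (symA : symmetric_composition A).
Variables (G : zmodType) (Gamma : G -> {vspace A}).
Hypotheses (gradG : is_grading Gamma) (specG : special_grading Gamma).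
Implicit Types (x y z : A) (g h k : G).
Local Notation "x ** y" := (amul x y) (at level 40, left associativity).
Local Notation pol := (@apolar F A).

Definition cubic_form x : F := pol x (x ** x).
Local Notation N := cubic_form.

Let aK x y : x ** y ** x = anorm x *: y. Proof. by case: symA. Qed.
Let aKr x y : x ** (y ** x) = anorm x *: y. Proof. by case: symA. Qed.

Lemma linear_comp x y z : x ** y ** z + z ** y ** x = pol x z *: y.
Proof.
apply: (addrI (anorm x *: y + anorm z *: y)).
rewrite -scalerDl -[RHS]scalerDl -anormD -aK !(amulDl, amulDr) scalerDl -!aK.
by rewrite [X in _ + X = _]addrC addrACA [X in _ + X = _]addrC.
Qed.

Lemma linear_compr x y z : x ** (y ** z) + z ** (y ** x) = pol x z *: y.
Proof.
apply: (addrI (anorm x *: y + anorm z *: y)).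
rewrite -scalerDl -[RHS]scalerDl -anormD -aKr !(amulDl, amulDr) scalerDl -!aKr.
by rewrite -!addrA [X in _ + X = _]addrC -addrA.
Qed.

(** Expresses [N x] through the product alone, which is why maps that only respect the product also
    respect N on homogeneous vectors. *)
Lemma square_square x : anorm x = 0 -> x ** x ** (x ** x) = N x *: x.
Proof. by move=> n0; have := linear_comp x x (x ** x);
  rewrite aK n0 scale0r amul0l addr0. Qed.

Let gM g h x y : x \in Gamma g -> y \in Gamma h -> x ** y \in Gamma (g + h).
Proof. by case: gradG => _ _; apply. Qed.

Lemma homogeneous_eq g h x : x \in Gamma g -> x \in Gamma h -> x != 0 -> g = h.
Proof.
move=> xg xh; apply: contra_neqP => /eqP ngh.
case: gradG => _ /(_ [:: g; h] (fun k =>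
  if k == g then x else if k == h then - x else 0)) indep _.
have := indep _ _ _ g; rewrite eqxx; apply.
- by rewrite /= inE ngh.
- move=> k; case: eqP => [->//|_]; case: eqP => [->|_]; last exact: mem0v.
  by rewrite rpredN.
- by rewrite !big_cons big_nil eqxx eq_sym (negbTE ngh) eqxx addr0 subrr.
- by rewrite inE eqxx.
Qed.

Lemma degree0 x : x \in Gamma 0 -> x = 0.
Proof. by rewrite specG memv0 => /eqP. Qed.

Lemma homogeneous_ind (P : A -> Prop) : P 0 ->
  (forall x y, P x -> P y -> P (x + y)) ->
  (forall g x, x \in Gamma g -> P x) -> forall x, P x.
Proof.
move=> P0 PD Ph x; case: gradG => /(_ x)[s [u [uG ->]]] _ _.
by apply: big_ind => // g _; apply: Ph (uG g).
Qed.

(** In (x * x) * z + (z * x) * x = n(x, z) x the left side has degree 2g + k and the right side has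
    degree g. *)
Lemma polar_degree g k x z : x \in Gamma g -> z \in Gamma k ->
  pol x z != 0 -> g + k = 0.
Proof.
move=> xg zk pxz.
have nx : x != 0 by apply: contraNneq pxz => ->; rewrite polar0l.
apply: (addrI g); rewrite addr0; apply: (@homogeneous_eq _ _ (pol x z *: x)).
- rewrite -linear_comp addrA rpredD //; first by rewrite !gM.
  by rewrite -addrA addrC [g + k]addrC !gM.
- by rewrite rpredZ.
- by rewrite scaler_eq0 negb_or pxz.
Qed.

Lemma polar_degree0 g k x z : x \in Gamma g -> z \in Gamma k ->
  g + k != 0 -> pol x z = 0.
Proof. by move=> xg zk; apply: contra_neqP => /eqP/(polar_degree xg zk). Qed.

(** The polar form would only control 2 n(x). If n(x) != 0, then x * (x * x) = n(x) x forces 2g = 0,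
    so x * x has degree 0 and vanishes, against (x * x) * x = n(x) x. *)
Lemma homogeneous_norm g x : x \in Gamma g -> anorm x = 0.
Proof.
move=> xg; have [->|nx] := eqVneq x 0; first exact: anorm0.
apply/eqP/negP => /negP nn.
have nxx : anorm x *: x != 0 by rewrite scaler_eq0 negb_or nn.
have g0 : g + g = 0.
  apply: (addrI g); rewrite addr0; apply: (@homogeneous_eq _ _ (anorm x *: x)) => //.
    by rewrite -aKr !gM.
  by rewrite rpredZ.
have xx : x ** x = 0 by apply: degree0; rewrite -g0 gM.
by case/eqP: nxx; rewrite -aK xx amul0l.
Qed.

(** Nondegeneracy gives a homogeneous vector not orthogonal to x, and [polar_degree] forces its
    degree. *)
Lemma homogeneous_dual g x : x \in Gamma g -> x != 0 ->
  exists2 z, z \in Gamma (- g) & pol x z = 1.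
Proof.
move=> xg nx.
have [[h [z [zh nz]]]|no] := pselect (exists h z, z \in Gamma h /\ pol x z != 0).
  have /eqP := polar_degree xg zh nz; rewrite addr_eq0 eq_sym eqr_oppLR => /eqP eh.
  exists ((pol x z)^-1 *: z); first by rewrite -eh rpredZ.
  by rewrite polarZr mulVf.
case/eqP: nx; case: symA => _ _; apply => y.
move: y; apply: homogeneous_ind => [|y z hy hz|h y yh]; first exact: polar0r.
  by rewrite polarDr hy hz addr0.
by apply: contra_notP no => /eqP np; exists h, y.
Qed.

(** If 2g = 0, a dual vector z of x also has degree g; then x, z and x + z all have norm 0 although
    n(x, z) = 1. *)
Lemma degree_double g x : x \in Gamma g -> x != 0 -> g + g != 0.
Proof.
move=> xg nx; apply/negP; rewrite addr_eq0 => /eqP eg.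
have [z] := homogeneous_dual xg nx; rewrite -eg => zg pxz.
have := anormD x z; rewrite !(@homogeneous_norm g) ?rpredD // pxz !add0r.
by move/eqP; rewrite eq_sym oner_eq0.
Qed.

Lemma square_dual g x z : x \in Gamma g -> z \in Gamma (- g) ->
  x ** x ** z = pol x z *: x.
Proof.
move=> xg zg; rewrite -linear_comp [z ** x]degree0 ?amul0l ?addr0 //.
by rewrite -(addNr g) gM.
Qed.

Lemma square_neq0 g x : x \in Gamma g -> x != 0 -> x ** x != 0.
Proof.
move=> xg nx; have [z zg pxz] := homogeneous_dual xg nx.
apply: contraNneq nx => xx.
by have := square_dual xg zg; rewrite xx amul0l pxz scale1r => <-.
Qed.

Lemma cubic_form_neq0 g x : x \in Gamma g -> x != 0 -> N x != 0.
Proof.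
move=> xg nx; have xx := square_neq0 xg nx.
have := square_neq0 (gM xg xg) xx; rewrite square_square ?(homogeneous_norm xg) //.
by rewrite scaler_eq0 negb_or => /andP[].
Qed.

Lemma degree_triple g x : x \in Gamma g -> x != 0 -> g + (g + g) = 0.
Proof.
by move=> xg nx; apply: (polar_degree xg (gM xg xg)); apply: (cubic_form_neq0 xg nx).
Qed.

(* If x' is not a multiple of x, we may assume n(x', x * x) = 0; then
   (x + x * x) * (x' + x' * x') = 0 although n(x + x * x) = n(x, x * x) != 0. *)
Lemma homogeneous_line g x x' : x \in Gamma g -> x != 0 -> x' \in Gamma g ->
  exists c, x' = c *: x.
Proof.
move=> xg nx x'g; set u := x ** x.
have ug : u \in Gamma (- g).
  by rewrite [- g](_ : _ = g + g) ?gM //; apply/eqP;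
    rewrite eq_sym -addr_eq0 -addrA (degree_triple xg).
have xgr (a b : A) : a \in Gamma g -> b \in Gamma (- g) -> a ** b = 0 /\ b ** a = 0.
  by move=> ag bg; split; apply: degree0; [rewrite -(addrN g)|rewrite -(addNr g)];
    apply: gM.
have pxu : pol x u != 0 := cubic_form_neq0 xg nx.
have uu : u ** u = N x *: x by rewrite square_square ?(homogeneous_norm xg).
exists (pol x' u / pol x u); apply/eqP; rewrite -subr_eq0; apply/negP=> /negP.
set y := _ - _ => ny.
have yg : y \in Gamma g by rewrite rpredB ?rpredZ.
have pyu : pol y u = 0.
  by rewrite /y polarDl -scaleNr polarZl mulNr divfK ?subrr.
clearbody y.
have xy : x ** y = 0.
  apply/eqP; have := linear_comp y u u.
  rewrite pyu scale0r (xgr _ _ yg ug).1 amul0l add0r uu amulZl => /eqP.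
  by rewrite scaler_eq0 (negbTE pxu).
have yx : y ** x = 0.
  apply/eqP; have := linear_compr y u u.
  rewrite pyu scale0r (xgr _ _ yg ug).2 amul0r addr0 uu amulZr => /eqP.
  by rewrite scaler_eq0 (negbTE pxu).
set v := y ** y; have vg : v \in Gamma (- g).
  by rewrite [- g](_ : _ = g + g) ?gM //; apply/eqP;
    rewrite eq_sym -addr_eq0 -addrA (degree_triple xg).
have nv : v != 0 := square_neq0 yg ny.
have vv : v ** v = N y *: y by rewrite square_square ?(homogeneous_norm yg).
have pxv : pol x v = 0.
  have := linear_comp x v v; rewrite vv (xgr _ _ xg vg).1 amul0l add0r amulZl.
  by rewrite yx scaler0 => /eqP; rewrite eq_sym scaler_eq0 (negbTE nv) orbF => /eqP.
have uv : u ** v = 0.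
  by have := square_dual xg vg; rewrite pxv scale0r.
have xuyv : (x + u) ** (y + v) = 0.
  by rewrite amulDl 2!amulDr xy uv (xgr _ _ xg vg).1 (xgr _ _ yg ug).2 !addr0.
have := aK (x + u) (y + v); rewrite xuyv amul0l anormD (homogeneous_norm xg).
rewrite (homogeneous_norm ug) !add0r => /eqP;
  rewrite eq_sym scaler_eq0 (negbTE pxu) /=.
rewrite addr_eq0 => /eqP eyv; have := homogeneous_eq yg _ ny.
move/(_ (- g)); rewrite {1}eyv rpredN => /(_ vg) eg.
by have := degree_double xg nx; rewrite {1}eg addNr eqxx.
Qed.

(** If g + h != 0, then n(x, y) = 0 and y * x = 0 give (x * x) * y = 0, whence N(x) y = (x * y) * (x
    * x) + ((x * x) * y) * x = 0, a contradiction. *)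
Lemma amul_neq0_or g h x y : x \in Gamma g -> y \in Gamma h -> x != 0 ->
  y != 0 -> x ** y = 0 -> y ** x = 0 -> h = g \/ h = - g.
Proof.
move=> xg yh nx ny xy yx.
have [e|ne] := eqVneq (g + h) 0; first by right; apply/eqP;
  rewrite eq_sym eqr_oppLR -addr_eq0 e.
left; set u := x ** x; have pxu : pol x u != 0 := cubic_form_neq0 xg nx.
have uy : u ** y = 0.
  have := linear_comp x x y; rewrite yx amul0l addr0 => ->.
  by rewrite (polar_degree0 xg yh) ?scale0r.
have := linear_comp x y u; rewrite xy uy !amul0l addr0 => /eqP.
by rewrite eq_sym scaler_eq0 (negbTE pxu) (negbTE ny).
Qed.

(** If both products were nonzero they would be proportional, since components are lines. With w = x
    * y, both y * w and w * y are then multiples of n(y) x = 0, and [amul_neq0_or] applied to y and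
    w gives g = 0 or g = h. *)
Lemma amul_eq0_or g h x y : x \in Gamma g -> y \in Gamma h -> x != 0 ->
  y != 0 -> h <> g -> h <> - g -> x ** y != 0 -> y ** x = 0.
Proof.
move=> xg yh nx ny hg hNg nxy; apply/eqP/negP=> /negP nyx.
have [c ec] : exists c, y ** x = c *: (x ** y).
  by apply: (homogeneous_line (gM xg yh) nxy); rewrite addrC gM.
have nc : c != 0 by apply: contraNneq nyx => c0; rewrite ec c0 scale0r.
have yw : y ** (x ** y) = 0 by rewrite aKr (homogeneous_norm yh) scale0r.
have wy : x ** y ** y = 0.
  apply/eqP; have /eqP := aK y x; rewrite ec amulZl (homogeneous_norm yh) scale0r.
  by rewrite scaler_eq0 (negbTE nc).
have [/eqP|/eqP] := amul_neq0_or yh (gM xg yh) ny nxy yw wy.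
  by rewrite -subr_eq0 addrK => /eqP g0; move: nx; rewrite [x]degree0 ?eqxx // -g0.
rewrite -subr_eq0 opprK -addrA addr_eq0 => /eqP eg; case: hg.
by rewrite eg; apply/eqP; rewrite -addr_eq0 (degree_triple yh).
Qed.

(** Components are lines, so a support contained in {g, -g} would leave dimension at most 2. *)
Lemma degree_pair : \dim {:A} = 8 -> exists g h,
  [/\ Gamma g != 0%VS, Gamma h != 0%VS, h <> g & h <> - g].
Proof.
move=> dim8; apply: contrapT => no.
have dim1 g : (\dim (Gamma g) <= 1)%N.
  have [g0|ng] := eqVneq (Gamma g) 0%VS; first by rewrite g0 dimv0.
  have [c sub] : exists x, (Gamma g <= <[x]>)%VS.
    exists (vpick (Gamma g)); apply/subvP=> y yg; apply/vlineP.
    by apply: (homogeneous_line (memv_pick _)) yg; rewrite vpick0.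
  by rewrite (leq_trans (dimvS sub)) // dim_vline leq_b1.
have full g : Gamma g != 0%VS -> fullv = (Gamma g + Gamma (- g))%VS.
  move=> ng; apply/eqP; rewrite eqEsubv subvf andbT; apply/subvP=> x _.
  move: x; apply: homogeneous_ind => [|x y|h x xh]; [exact: mem0v|exact: rpredD|].
  have [h0|nh] := eqVneq (Gamma h) 0%VS.
    by move: xh; rewrite h0 memv0 => /eqP->; apply: mem0v.
  have [eh|hg] := pselect (h = g).
    by apply: (subvP (addvSl _ _)); rewrite -eh.
  have [eh|hNg] := pselect (h = - g).
    by apply: (subvP (addvSr _ _)); rewrite -eh.
  by case: no; exists g, h.
have [g ng] : exists g, Gamma g != 0%VS.
  apply: contrapT => all0; suff A0 x : x = 0.
    suff : fullv = 0%VS :> {vspace A} by move=> e; move: dim8; rewrite e dimv0.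
    by apply/eqP; rewrite -subv0; apply/subvP=> x _; rewrite [x]A0 mem0v.
  move: x; apply: homogeneous_ind => [//|x y -> ->|h x xh]; first by rewrite addr0.
  apply/eqP; apply: contra_notT all0 => nx; exists h.
  by apply: contraNneq nx => h0; rewrite -memv0 -h0.
have := leq_trans (dimv_add_leqif (Gamma g) (Gamma (- g))).1 (leq_add (dim1 g)
  (dim1 (- g))).
by rewrite -(full g ng) dim8.
Qed.
End Special.

(** * Frames: the multiplication table of a special grading *)

Section FrameVectors.
Variables (F : fieldType) (A : normed_alg F).
Local Notation "x ** y" := (amul x y) (at level 40, left associativity).

(* The vectors z_{i,j} of O_{alpha,beta} in terms of x = z_{1,0} and y = z_{0,1}. *)
Definition frame_vector_nat (x y : A) (i j : nat) : A :=
  match i, j with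
  | 1, 0 => x | 2, 0 => x ** x | 0, 1 => y | 0, 2 => y ** y
  | 1, 1 => - (x ** y) | 2, 2 => x ** y ** (x ** y)
  | 2, 1 => - (y ** (x ** x)) | 1, 2 => - (y ** y ** x)
  | _, _ => 0
  end.

Definition frame_vector (x y : A) (p : Z3sq) : A :=
  frame_vector_nat x y p.1 p.2.
End FrameVectors.

Lemma Z3sq_rect9 (P : Z3sq -> Prop) :
  P (0, 0) -> P (0, 1) -> P (0, 2%:R) -> P (1, 0) -> P (1, 1) -> P (1, 2%:R) ->
  P (2%:R, 0) -> P (2%:R, 1) -> P (2%:R, 2%:R) -> forall p, P p.
Proof.
move=> P00 P01 P02 P10 P11 P12 P20 P21 P22 p; apply/asboolP; move: p.
apply: Z3sq_all.
by rewrite /= !asboolT.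
Qed.

Lemma mulrn_modn3 (G : zmodType) (g : G) : g + (g + g) = 0 ->
  forall n, g *+ (n %% 3) = g *+ n.
Proof.
by move=> g3 n; rewrite [in RHS](divn_eq n 3) mulrnDr mulnC mulrnA mulrS mulr2n g3
  mul0rn add0r.
Qed.

Definition pair_degree (G : zmodType) (g h : G) (p : Z3sq) : G :=
  g *+ p.1 + h *+ p.2.

Section FrameTable.
Variables (F : fieldType) (A : normed_alg F) (symA : symmetric_composition A).
Variables (G : zmodType) (Gamma : G -> {vspace A}).
Hypotheses (gradG : is_grading Gamma) (specG : special_grading Gamma).
Local Notation "x ** y" := (amul x y) (at level 40, left associativity).
Local Notation pol := (@apolar F A).
Variables (g h : G) (x y : A).
Hypotheses (xg : x \in Gamma g) (yh : y \in Gamma h) (nx : x != 0) (ny : y != 0).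
Hypotheses (hg : h <> g) (hNg : h <> - g) (yx : y ** x = 0).
Local Notation a := (cubic_form x).
Local Notation b := (cubic_form y).
Local Notation e := (frame_vector x y).
Local Notation d := (pair_degree g h).

Let g3 : g + (g + g) = 0. Proof. exact: (degree_triple symA gradG specG xg). Qed.
Let h3 : h + (h + h) = 0. Proof. exact: (degree_triple symA gradG specG yh). Qed.

Lemma pair_degreeD p q : d (p + q) = d p + d q.
Proof.
by rewrite /pair_degree /= !mulrn_modn3 // !mulrnDr addrACA.
Qed.

Lemma pair_degree_eq0 p : d p = 0 -> p = 0.
Proof.
have g0 : g <> 0 by move=> g0; move: nx;
  rewrite (degree0 specG (x := x)) ?eqxx // -g0.
have h0 : h <> 0 by move=> h0; move: ny;
  rewrite (degree0 specG (x := y)) ?eqxx // -h0.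
have gN : - g = g + g by apply/eqP; rewrite eq_sym -addr_eq0 -addrA g3.
have hN : - h = h + h by apply/eqP; rewrite eq_sym -addr_eq0 -addrA h3.
move: p; apply: Z3sq_rect9; rewrite /pair_degree /= ?mulr0n ?mulr1n ?mulr2n ?addr0
  ?add0r //.
- by rewrite -hN => /eqP; rewrite oppr_eq0 => /eqP.
- by move/eqP; rewrite addrC addr_eq0 => /eqP.
- by rewrite -hN => /eqP; rewrite subr_eq0 eq_sym => /eqP.
- by rewrite -gN => /eqP; rewrite oppr_eq0 => /eqP.
- by rewrite -gN addrC => /eqP; rewrite subr_eq0 => /eqP.
- by rewrite -gN -hN -opprD => /eqP; rewrite oppr_eq0 addrC addr_eq0 => /eqP.
Qed.

Lemma pair_degree_inj : injective d.
Proof.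
have d0 : d 0 = 0 by rewrite /pair_degree /= !mulr0n addr0.
have dN p : d (- p) = - d p by apply/eqP; rewrite -addr_eq0 -pair_degreeD addNr d0.
move=> p q e; apply/eqP; rewrite -subr_eq0; apply/eqP/pair_degree_eq0.
by rewrite pair_degreeD dN e subrr.
Qed.

Let gM k l (u v : A) : u \in Gamma k -> v \in Gamma l -> u ** v \in Gamma (k + l).
Proof. by case: gradG => _ _; apply. Qed.

Lemma frame_vector_degree p : e p \in Gamma (d p).
Proof.
move: p; apply: Z3sq_rect9; rewrite /frame_vector /pair_degree /= ?mulr0n ?mulr1n
  ?mulr2n ?addr0 ?add0r ?mem0v //.
- exact: gM.
- by rewrite rpredN gM.
- by rewrite rpredN addrC !gM.
- exact: gM.
- by rewrite rpredN addrC !gM.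
- by rewrite addrACA !gM.
Qed.

Let n0 k (z : A) : z \in Gamma k -> anorm z = 0.
Proof. exact: (homogeneous_norm symA gradG specG). Qed.

Let p0 (p q : Z3sq) : p + q != 0 -> pol (e p) (e q) = 0.
Proof.
move=> npq; apply: (polar_degree0 symA gradG (frame_vector_degree p)
  (frame_vector_degree q)).
rewrite -pair_degreeD; apply: contraNneq npq => /pair_degree_eq0 ->; exact: eqxx.
Qed.

Lemma frame_table (p q : Z3sq) : p != 0 -> q != 0 -> okubo_signz p q != 0 ->
  e p ** e q = (okubo_signz p q)%:~R * carry a b p q *: e (p + q).
Proof.
(* The whole table is derived from y * x = 0 with four moves: [L] and [R] exchange the outer factors
   of a triple product when these are orthogonal, [L1] and [R1] evaluate it when the competing inner
   product vanishes. *)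
have L z1 z2 z3 : pol z1 z3 = 0 -> z1 ** z2 ** z3 = - (z3 ** z2 ** z1).
  by move=> pz; apply/eqP; rewrite -addr_eq0 (linear_comp symA) pz scale0r.
have R z1 z2 z3 : pol z1 z3 = 0 -> z1 ** (z2 ** z3) = - (z3 ** (z2 ** z1)).
  by move=> pz; apply/eqP; rewrite -addr_eq0 (linear_compr symA) pz scale0r.
have L1 z1 z2 z3 : z3 ** z2 = 0 -> z1 ** z2 ** z3 = pol z1 z3 *: z2.
  by move=> zz; rewrite -(linear_comp symA) zz amul0l addr0.
have R1 z1 z2 z3 : z2 ** z1 = 0 -> z1 ** (z2 ** z3) = pol z1 z3 *: z2.
  by move=> zz; rewrite -(linear_compr symA) zz amul0r addr0.
pose u := x ** x; pose v := y ** y; pose w := x ** y.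
pose s := y ** u; pose t := v ** x; pose r := w ** w.
have pE k l (H : (k + l != 0)) : pol (e k) (e l) = 0 := p0 H.
have pN (z z' : A) : pol z (- z') = - pol z z' by rewrite -scaleN1r polarZr mulN1r.
have pNl (z z' : A) : pol (- z) z' = - pol z z' by rewrite polarC pN polarC.
(* Stated up to sign, because x * y, y * (x * x) and (y * y) * x are negatives of frame vectors. *)
have pol0 (z z' : A) k l : e k = z \/ e k = - z -> e l = z' \/ e l = - z' ->
    k + l != 0 -> pol z z' = 0.
  move=> ek el nkl; have := pE k l nkl; apply: contra_eq => np.
  by case: ek => ->; case: el => ->; rewrite ?pN ?pNl ?oppr_eq0.
have pxx : pol x x = 0 by apply: (pol0 _ _ (1, 0) (1, 0)); [left|left|].
have pyy : pol y y = 0 by apply: (pol0 _ _ (0, 1) (0, 1)); [left|left|].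
have puu : pol u u = 0 by apply: (pol0 _ _ (2%:R, 0) (2%:R, 0)); [left|left|].
have pvv : pol v v = 0 by apply: (pol0 _ _ (0, 2%:R) (0, 2%:R)); [left|left|].
have pxy : pol x y = 0 by apply: (pol0 _ _ (1, 0) (0, 1)); [left|left|].
have pxv : pol x v = 0 by apply: (pol0 _ _ (1, 0) (0, 2%:R)); [left|left|].
have puy : pol u y = 0 by apply: (pol0 _ _ (2%:R, 0) (0, 1)); [left|left|].
have puv : pol u v = 0 by apply: (pol0 _ _ (2%:R, 0) (0, 2%:R)); [left|left|].
have pxw : pol x w = 0 by apply: (pol0 _ _ (1, 0) (1, 1)); [left|right|].
have pyw : pol y w = 0 by apply: (pol0 _ _ (0, 1) (1, 1)); [left|right|].
have pys : pol y s = 0 by apply: (pol0 _ _ (0, 1) (2%:R, 1)); [left|right|].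
have pxt : pol x t = 0 by apply: (pol0 _ _ (1, 0) (1, 2%:R)); [left|right|].
have pvt : pol v t = 0 by apply: (pol0 _ _ (0, 2%:R) (1, 2%:R)); [left|right|].
have pus : pol u s = 0 by apply: (pol0 _ _ (2%:R, 0) (2%:R, 1)); [left|right|].
have pxr : pol x r = 0 by apply: (pol0 _ _ (1, 0) (2%:R, 2%:R)); [left|left|].
have pux : pol u x = a by rewrite polarC.
have pvy : pol v y = b by rewrite polarC.
have ux : u ** x = 0 by case: symA => -> _ _; rewrite (n0 xg) scale0r.
have uu : u ** u = a *: x by rewrite (square_square symA) ?(n0 xg).
have vv : v ** v = b *: y by rewrite (square_square symA) ?(n0 yh).
have xw : x ** w = - s by rewrite R // polarC.
have uy : u ** y = 0 by rewrite L // yx amul0l oppr0.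
have xv : x ** v = 0 by rewrite R // yx amul0r oppr0.
have vu : v ** u = 0 by rewrite L 1?polarC // uy amul0l oppr0.
have xs : x ** s = a *: y by rewrite R1.
have ut : u ** t = a *: v by rewrite R1 // pux.
have vw : v ** w = b *: x by rewrite R1 // pvy.
have vt : v ** t = - (b *: w) by rewrite R // 1?polarC // vv amulZr.
have wy : w ** y = - t by rewrite L.
have wu : w ** u = a *: y by rewrite L1.
have sv : s ** v = b *: u by rewrite L1.
have su : s ** u = - (a *: w) by rewrite L 1?polarC // uu amulZl.
have ty : t ** y = b *: x by rewrite L1 // pvy.
have tx : t ** x = - (u ** v) by rewrite L 1?polarC.
have wwt : r = t ** x by rewrite /r {1}/w L // wy amulNl opprK.
have uv : u ** v = - r by rewrite wwt tx opprK.
have ys : y ** s = r by rewrite /r {2}/w R 1?polarC // xw amulNr opprK.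
have ur : u ** r = a *: t.
  by rewrite -[r]opprK -uv amulNr R // uu amulZr opprK.
have yr : y ** r = - (b *: u) by rewrite -ys R // sv.
have rv : r ** v = b *: s by rewrite -[r]opprK -uv amulNl L // vv amulZl opprK.
have rx : r ** x = - (a *: v) by rewrite wwt L 1?polarC // -/u ut.
have wt : w ** t = - (b *: u) by rewrite R 1?polarC // vw amulZr.
have sw : s ** w = - (a *: v) by rewrite L // wu amulZl.
have tt : t ** t = - (b *: s) by rewrite {1}/t L // -wwt rv.
have tr : t ** r = (a * b) *: y.
  by rewrite wwt R 1?polarC // tt amulNr opprK amulZr xs scalerA mulrC.
have ss : s ** s = - (a *: t) by rewrite {2}/s R 1?polarC // ys ur.
have rs : r ** s = (a * b) *: x.
  by rewrite -{1}ys L // ss amulNl opprK amulZl ty scalerA.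
have rr : r ** r = - (a * b *: w).
  by rewrite {2}wwt R 1?polarC // tr amulZr.
(* Of the 81 pairs, those with p = 0, q = 0 or sign 0 are discarded by computation. In the others
   the sign, the carries and the target index are evaluated, and the goal becomes an entry of the
   table above. *)
move: p q; apply: Z3sq_rect9; apply: Z3sq_rect9 => np nq ns;
  try (by exfalso; move: np nq ns; vm_compute);
  match goal with |- context [okubo_signz ?p ?q] =>
    let c := eval vm_compute in (okubo_signz p q) in
    let k := eval vm_compute in ((p.1 + q.1) %/ 3)%N in
    let l := eval vm_compute in ((p.2 + q.2) %/ 3)%N in
    let i := eval vm_compute in (nat_of_ord (p + q).1) in
    let j := eval vm_compute in (nat_of_ord (p + q).2) in
    change (okubo_signz p q) with c; change (carry a b p q) with (a ^+ k * b ^+ l);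
    change (e (p + q)) with (frame_vector_nat x y i j)
  end; rewrite /frame_vector /frame_vector_nat /= -/u -/v -/w -/s -/t -/r.
all: rewrite ?expr0 ?expr1 ?mul1r ?mulr1 ?NegzE ?rmorphN ?mulN1r ?scaleNr ?scale1r.
all: rewrite ?(amulNl, amulNr, scalerN, opprK) //; apply/eqP.
all: by rewrite ?(ys, yr, vv, vw, vt, xw, xs, wy, wt, wu, ty, tx, tt, tr, uv, ut,
  uu, ur, sv, sw, su, ss, rv, rx, rs, rr, opprK).
Qed.

Let a0 : a != 0. Proof. exact: (cubic_form_neq0 symA gradG specG xg nx). Qed.
Let b0 : b != 0. Proof. exact: (cubic_form_neq0 symA gradG specG yh ny). Qed.

Let carry0 p q : carry a b p q != 0.
Proof. by rewrite /carry mulf_neq0 // expf_neq0. Qed.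

Let sign0 p q : okubo_signz p q != 0 -> (okubo_signz p q)%:~R != 0 :> F.
Proof.
by rewrite /okubo_signz; do 2?case: ifP => // _;
  rewrite ?rmorphN /= ?oppr_eq0 oner_eq0.
Qed.

(** The product x * y is nonzero because y * x = 0. Squares of nonzero homogeneous vectors give
    (2,0), (0,2) and (2,2); the vectors of degrees (1,2) and (2,1) are right factors in products
    equal to nonzero multiples of those of degrees (1,1) and (0,1). *)
Lemma frame_vector_neq0 (p : Z3sq) : p != 0 -> e p != 0.
Proof.
have nz k (z : A) : z \in Gamma k -> z != 0 -> z ** z != 0.
  exact: (square_neq0 symA gradG specG).
have nw : x ** y != 0.
  apply/eqP => xy.
  by case: (amul_neq0_or symA gradG specG xg yh nx ny xy yx).
have fac q r : q != 0 -> r != 0 -> okubo_signz q r != 0 -> e (q + r) != 0 -> e r != 0.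
  move=> nq nr nqr; apply: contraNneq => er.
  have /eqP := frame_table nq nr nqr; rewrite er amul0r eq_sym scaler_eq0.
  by rewrite mulf_eq0 (negbTE (sign0 nqr)) (negbTE (carry0 _ _)).
have ny2 : e (0, 1) != 0 by [].
have nw2 : e (1, 1) != 0 by rewrite /frame_vector /= oppr_eq0.
have nx2 : e (1, 0) != 0 by [].
move: p; apply: Z3sq_rect9 => // _.
- exact: nz yh ny.
- by apply: (@fac (0, 2%:R)).
- exact: nz xg nx.
- by apply: (@fac (1, 0)).
- by rewrite /frame_vector /=; apply: (nz _ _ (gM xg yh)).
Qed.

(* If the product in one order is nonzero by the table, the other one vanishes. *)
Lemma frame_mul (p q : Z3sq) : p != 0 -> q != 0 ->
  e p ** e q = (okubo_sign F p q * carry a b p q) *: e (p + q).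
Proof.
move=> np nq; rewrite okubo_signE.
have [s0|] := eqVneq (okubo_signz p q) 0; last exact: frame_table.
rewrite s0 mul0r scale0r.
have [pq|npq] := eqVneq (p + q) 0.
  apply: (degree0 specG); rewrite -[0](_ : d p + d q = 0) ?gM ?frame_vector_degree //.
  by rewrite -pair_degreeD pq /pair_degree /= !mulr0n addr0.
have [nqp dqp dNqp] : [/\ okubo_signz q p != 0, p <> q & p <> - q].
  have : [==> p + q != 0, okubo_signz p q == 0 =>
    (okubo_signz q p != 0) && (p != q) && (p != - q)].
    by move: p q {np nq s0 npq}; apply: Z3sq_all2; vm_compute.
  by rewrite npq s0 eqxx /= => /andP[/andP[? /eqP ?] /eqP ?].
apply: (amul_eq0_or symA gradG specG (frame_vector_degree q) (frame_vector_degree p));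
  rewrite ?frame_vector_neq0 //.
- by move/pair_degree_inj.
- move=> /eqP; rewrite -addr_eq0 -pair_degreeD => /eqP/pair_degree_eq0/eqP.
  by rewrite (negbTE npq).
rewrite frame_table // scaler_eq0 negb_or mulf_neq0 ?sign0 //=.
by rewrite frame_vector_neq0 // addrC.
Qed.

End FrameTable.

Section SumMap.
Variables (F : fieldType) (alpha beta : units F) (V : vectType F) (b : Z3sq -> V).
Local Notation O := (okubo_ab alpha beta).

Definition sum_fun (x : O) : V :=
  \sum_(s : Z3sq_nz) (x : {ffun Z3sq_nz -> F^o}) s *: b (val s).

Fact sum_fun_linear : linear sum_fun.
Proof.
move=> c x y; rewrite /sum_fun scaler_sumr -big_split /=; apply: eq_bigr => s _.
by rewrite !ffunE scalerDl scalerA.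
Qed.
HB.instance Definition _ := GRing.isLinear.Build F O V *:%R sum_fun sum_fun_linear.

Definition sum_map : 'Hom(O, V) := linfun sum_fun.

Lemma sum_mapE (x : O) :
  sum_map x = \sum_(s : Z3sq_nz) (x : {ffun Z3sq_nz -> F^o}) s *: b (val s).
Proof. by rewrite lfunE. Qed.

Lemma sum_map_basis (s : Z3sq_nz) : sum_map (sc_basis F s : O) = b (val s).
Proof.
rewrite sum_mapE (bigD1 s) //= ffunE eqxx scale1r big1 ?addr0 // => t nt.
by rewrite ffunE (negbTE nt) scale0r.
Qed.
End SumMap.

Section Frame.
Variables (F : fieldType) (A : normed_alg F) (G : zmodType).
Variable Gamma : G -> {vspace A}.

(** The interface between the grading and the rest of the proof: Phi, the automorphisms and the
    equivalences are all read off a frame. The convention e 0 = 0 gives e (p + q) a meaning for all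
    p and q and agrees with the vanishing of the component of degree 0. *)
Record okubo_frame (alpha beta : units F) (d : Z3sq -> G) (e : Z3sq -> A) :
    Prop := OkuboFrame {
  frame_degD : forall p q, d (p + q) = d p + d q;
  frame_deg_inj : injective d;
  frame0 : e 0 = 0;
  frame_neq0 : forall p, p != 0 -> e p != 0;
  frameM : forall p q, p != 0 -> q != 0 -> amul (e p) (e q) =
    (okubo_sign F p q * carry (val alpha) (val beta) p q) *: e (p + q);
  frame_line : forall p, Gamma (d p) = <[e p]>%VS;
  frame_supp : forall k, Gamma k != 0%VS -> exists p, k = d p;
  frame_iso : bijective (sum_map alpha beta e)
}.
End Frame.

Section FrameExists.
Variables (F : fieldType) (A : normed_alg F) (symA : symmetric_composition A).
Hypothesis dimA : \dim {:A} = 8.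
Variables (G : zmodType) (Gamma : G -> {vspace A}).
Hypotheses (gradG : is_grading Gamma) (specG : special_grading Gamma).
Variables (g h : G) (x y : A).
Hypotheses (xg : x \in Gamma g) (yh : y \in Gamma h) (nx : x != 0) (ny : y != 0).
Hypotheses (hg : h <> g) (hNg : h <> - g) (yx : amul y x = 0).
Variables (alpha beta : units F).
Hypotheses (Nx : cubic_form x = val alpha) (Ny : cubic_form y = val beta).
Local Notation e := (frame_vector x y).
Local Notation d := (pair_degree g h).

Let dI : injective d.
Proof. exact: (pair_degree_inj symA gradG specG xg yh nx ny hg hNg). Qed.
Let eg p : e p \in Gamma (d p).
Proof. exact: (frame_vector_degree gradG xg yh p). Qed.
Let e_neq0 p : p != 0 -> e p != 0.
Proof. exact: (frame_vector_neq0 symA gradG specG xg yh nx ny hg hNg yx). Qed.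

Let u (c : Z3sq -> F) l := \sum_(p | d p == l) c p *: e p.

Let uG c l : u c l \in Gamma l.
Proof. by apply: rpred_sum => p /eqP <-; rewrite rpredZ. Qed.

Let ud c p : u c (d p) = c p *: e p.
Proof.
by rewrite /u (bigD1 p) //= big1 ?addr0 // => q /andP[/eqP/dI->]; rewrite eqxx.
Qed.

Let sum_u c : \sum_p c p *: e p = \sum_(l <- map d (index_enum Z3sq)) u c l.
Proof. by rewrite big_map; apply: eq_bigr => p _; rewrite ud. Qed.

Let uniq_d : uniq (map d (index_enum Z3sq)).
Proof. by rewrite (map_inj_uniq dI) index_enum_uniq. Qed.

Let frame_free (c : Z3sq -> F) : \sum_p c p *: e p = 0 -> forall p, c p *: e p = 0.
Proof.
rewrite sum_u; case: gradG => _ /(_ _ (u c) uniq_d (uG c)) indep _ /indep {}indep p.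
by rewrite -ud indep // map_f // mem_index_enum.
Qed.

(** With -z placed in the extra degree k, the combination becomes a vanishing sum of homogeneous
    vectors in distinct degrees. This shows below that no degree outside the range of d lies in the
    support. *)
Let frame_indep (c : Z3sq -> F) (k : G) (z : A) : z \in Gamma k ->
  (forall p, k <> d p) -> z = \sum_p c p *: e p -> z = 0.
Proof.
move=> zk kd ez; pose w l := if l == k then - z else u c l.
have uniq_s : uniq (k :: map d (index_enum Z3sq)).
  rewrite /= uniq_d andbT; apply/negP=> /mapP[p _]; exact: kd.
have wG l : w l \in Gamma l.
  by rewrite /w; case: eqP => [->|_]; rewrite ?rpredN.
case: gradG => _ /(_ _ w uniq_s wG) indep _.
apply/eqP; rewrite -oppr_eq0; apply/eqP; have := indep _ k.
rewrite /w eqxx; apply; last by rewrite inE eqxx.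
rewrite big_cons eqxx {1}ez sum_u !big_map -sumrN -big_split big1 // => p _ /=.
by case: eqP => [e|_]; [case: (kd p)|rewrite addNr].
Qed.

Let phi := sum_map alpha beta e.

Let phiE (v : okubo_ab alpha beta) : exists c : Z3sq -> F,
  phi v = \sum_p c p *: e p /\ forall s : Z3sq_nz, c (val s) = (v :
    {ffun Z3sq_nz -> F^o}) s.
Proof.
exists (fun p => if insub p is Some s then (v : {ffun Z3sq_nz -> F^o}) s else 0).
split; last by move=> s; rewrite valK.
rewrite sum_mapE [RHS](bigD1 (0 : Z3sq)) //= [e 0](_ : _ = 0) // scaler0 add0r.
rewrite [RHS](reindex_omap (val : Z3sq_nz -> Z3sq) insub) => [|p np]; last first.
  by rewrite insubT.
by apply: eq_big => [s|s _]; rewrite valK ?(valP s) ?eqxx.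
Qed.

Let d0 : d 0 = 0. Proof. by rewrite /pair_degree /= !mulr0n addr0. Qed.

Let phi_inj : lker phi == 0%VS.
Proof.
rewrite -subv0; apply/subvP=> v; rewrite memv_ker memv0 => /eqP phiv.
have [c [phic cE]] := phiE v.
apply/eqP/ffunP=> s; rewrite ffunE -cE; apply/eqP.
have /eqP := frame_free (etrans (esym phic) phiv) (val s).
by rewrite scaler_eq0 (negbTE (e_neq0 (valP s))) orbF.
Qed.

Let phi_bij : bijective phi.
Proof.
exists (phi^-1)%VF; first exact: lker0_lfunK.
move=> v; apply: limg_lfunVK.
suff -> : limg phi = fullv by rewrite memvf.
apply/eqP; rewrite eqEdim subvf dimA limg_dim_eq ?(eqP phi_inj) ?capv0 //.
by rewrite dim_sc card_Z3sq_nz.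
Qed.

Lemma frame_exists_pair : okubo_frame Gamma alpha beta d e.
Proof.
split=> //.
- exact: (pair_degreeD symA gradG specG xg yh).
- by move=> p q np nq; rewrite -Nx -Ny (frame_mul symA gradG specG xg yh).
- move=> p; have [->|np] := eqVneq p 0.
    by rewrite d0 specG; apply/eqP; rewrite eqEsubv !sub0v.
  apply/eqP; rewrite eqEsubv; apply/andP; split; apply/subvP=> v.
    move=> vp; apply/vlineP; exact: (homogeneous_line symA gradG specG (eg p)
      (e_neq0 np) vp).
  by case/vlineP=> c ->; rewrite rpredZ.
- move=> k nk; apply: contrapT => no; case/eqP: nk.
  apply/eqP; rewrite -subv0; apply/subvP=> z zk; rewrite memv0; apply/eqP.
  have [psi psiK psiK'] := phi_bij.
  have [c [phic _]] := phiE (psi z).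
  apply: (frame_indep zk (c := c)); last by rewrite -phic psiK'.
  by move=> p ek; apply: no; exists p.
Qed.
End FrameExists.

(** * Quotients and cube classes *)

Section QuotientTheory.
Local Open Scope group_scope.
Local Open Scope quotient_scope.

Lemma quot_projP (G : groupType) (N : normal_subgroup G) (x y : G) :
  reflect (quot_proj N x = quot_proj N y) (x^-1 * y \in N).
Proof. by apply: (iffP idP) => [?|/eqmodP//]; apply/eqmodP. Qed.

Lemma quot_proj_surj (G : groupType) (N : normal_subgroup G) (a : quotient_group N) :
  exists x, quot_proj N x = a.
Proof. by exists (repr a); rewrite /quot_proj reprK. Qed.

Lemma quot_projM (G : groupType) (N : normal_subgroup G) (x y : G) :
  quot_proj N (x * y) = quot_proj N x * quot_proj N y.
Proof. exact: quot_proj_mult. Qed.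

(** G / N is identified with K through f, and s composed with this identification is a section of
    the projection; one pair (f, s) thus yields both conclusions. *)
Lemma split_quotient (G K : groupType) (N : normal_subgroup G)
    (f : G -> K) (s : K -> G) :
  {morph f : x y / x * y} -> {morph s : x y / x * y} -> cancel s f ->
  (forall x, (x \in N) = (f x == 1)) ->
  group_iso (quotient_group N) K /\ quotient_splits N.
Proof.
move=> fM sM sK kerf.
have f1 : f 1 = 1 by apply: (mulgI (f 1)); rewrite -fM !mulg1.
have fE x y : (quot_proj N x = quot_proj N y) <-> f x = f y.
  have ker : (x^-1 * y \in N) = (f x == f y).
    by rewrite kerf -(inj_eq (mulgI (f x))) -fM mulVKg mulg1 eq_sym.
  split=> [/quot_projP|e]; first by rewrite ker => /eqP.
  by apply/quot_projP; rewrite ker e.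
pose g (a : quotient_group N) : K := f (repr a).
have gE x : g (quot_proj N x) = f x by apply/fE; rewrite /quot_proj reprK.
have gM : {morph g : a b / a * b}.
  move=> a b; have [x <-] := quot_proj_surj a; have [y <-] := quot_proj_surj b.
  by rewrite -quot_projM !gE fM.
pose g1 : {multiplicative quotient_group N -> K} :=
  HB.pack g (isMultiplicative.Build _ K g gM).
pose t (k : K) : quotient_group N := quot_proj N (s k).
have gK : cancel g t.
  by move=> a; have [x <-] := quot_proj_surj a; rewrite gE; apply/fE; rewrite sK.
have tK : cancel t g by move=> k; rewrite gE sK.
split; first by exists g1; exists t.
have sgM : {morph s \o g : a b / a * b} by move=> a b; rewrite /= gM sM.
pose sg : {multiplicative quotient_group N -> G} :=
  HB.pack (s \o g) (isMultiplicative.Build _ G (s \o g) sgM).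
by exists sg => a; rewrite -[RHS]gK.
Qed.

Lemma group_iso_can (G H : groupType) (f : G -> H) (g : H -> G) :
  {morph f : x y / x * y} -> cancel f g -> cancel g f -> group_iso G H.
Proof.
move=> fM fK gK.
pose f1 : {multiplicative G -> H} := HB.pack f (isMultiplicative.Build G H f fM).
by exists f1; exists g.
Qed.

Lemma group_iso_sym (G H : groupType) : group_iso G H -> group_iso H G.
Proof.
case=> f [g fK gK]; apply: (group_iso_can (f := g) (g := f)) => // x y.
by rewrite -[x]gK -[y]gK -gmulfM !fK.
Qed.

Lemma group_iso_trans (G H K : groupType) :
  group_iso G H -> group_iso H K -> group_iso G K.
Proof.
case=> f [g fK gK] [f' [g' fK' gK']].
apply: (group_iso_can (f := f' \o f) (g := g \o g')) => x; last 2 first.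
- by rewrite /= fK'.
- by rewrite /= gK.
by move=> y /=; rewrite !gmulfM.
Qed.
End QuotientTheory.

Section CubeClasses.
Variable F : fieldType.
Implicit Types (x y : units F).
Local Open Scope group_scope.

Lemma cube_classM x y : cube_class (x * y) = cube_class x * cube_class y.
Proof. exact: quot_projM. Qed.

Lemma cube_class1 : cube_class (1 : units F) = 1.
Proof. by []. Qed.

Lemma cube_classX x n : cube_class (x ^+ n) = cube_class x ^+ n.
Proof. by elim: n => [//|n IHn]; rewrite !expgS cube_classM IHn. Qed.

Lemma cube_class_surj (a : cube_classes F) : exists x, cube_class x = a.
Proof. exact: quot_proj_surj. Qed.

Lemma in_cubes x : (x \in cubes F) = `[< exists y, x = y ^+ 3 >].
Proof. by []. Qed.

Lemma cube_classP x y :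
  cube_class x = cube_class y <-> exists z, y = x * z ^+ 3.
Proof.
split=> [/quot_projP|[z ->]].
  rewrite in_cubes => /asboolP[z e]; exists z.
  by rewrite -e mulVKg.
by apply/quot_projP; rewrite mulKg in_cubes; apply/asboolP; exists z.
Qed.

Lemma cube_class_mulC (a b : cube_classes F) : a * b = b * a.
Proof.
have [x <-] := cube_class_surj a; have [y <-] := cube_class_surj b.
by rewrite -!cube_classM units_mulC.
Qed.

Lemma cube_class_exp3 (a : cube_classes F) : a ^+ 3 = 1.
Proof.
have [x <-] := cube_class_surj a.
rewrite -cube_classX -cube_class1; apply/esym/cube_classP.
by exists x; rewrite mul1g.
Qed.

(** This is Phi read through the degrees of a frame, see [frame_Phi]. The exponents are
    representatives in {0, 1, 2}; additivity in p holds because cube classes have exponent 3. *)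
Definition class_of_pair (a b : cube_classes F) (p : Z3sq) : cube_classes F :=
  a ^+ p.1 * b ^+ p.2.

Lemma cube_class_expD (a : cube_classes F) (i j : 'Z_3) :
  a ^+ (i + j)%R = a ^+ i * a ^+ j.
Proof.
rewrite -expgnDr [in RHS](divn_eq (i + j) 3) expgnDr mulnC expgnA cube_class_exp3.
by rewrite expg1n mul1g.
Qed.

Lemma class_of_pairD a b p q :
  class_of_pair a b (p + q)%R = class_of_pair a b p * class_of_pair a b q.
Proof.
rewrite /class_of_pair !cube_class_expD -!mulgA; congr (_ * _).
by rewrite !mulgA; congr (_ * _); rewrite cube_class_mulC.
Qed.

Lemma class_of_pair0 a b : class_of_pair a b 0%R = 1.
Proof. by rewrite /class_of_pair !expg0 mulg1. Qed.

Lemma val_unitX x n : val (x ^+ n) = (val x ^+ n)%R.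
Proof. by elim: n => [|n IHn] //; rewrite expgS exprS /= IHn. Qed.

End CubeClasses.

(** * Consequences of a frame *)

Lemma linear_spanning_comp (F : fieldType) (A B : normed_alg F) (I : Type)
    (e : I -> A) (f : 'Hom(A, B)) : bijective f ->
  linear_spanning e -> linear_spanning (fun i => f (e i)).
Proof.
case=> g _ gK eP P P0 PD PZ Pe x; rewrite -[x]gK.
move: (g x); apply: (eP (fun y => P (f y))) => [|y z|k y|//].
- by rewrite linear0.
- by rewrite linearD; apply: PD.
- by rewrite linearZ; apply: PZ.
Qed.

Lemma alg_morph_spanning (F : fieldType) (A B : normed_alg F) (I : Type)
    (e : I -> A) (f : 'Hom(A, B)) : linear_spanning e ->
  (forall i j, f (amul (e i) (e j)) = amul (f (e i)) (f (e j))) ->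
  forall u v, f (amul u v) = amul (f u) (f v).
Proof.
move=> eP fe u v; move: u; apply: (eP _) => [|u u' h h'|k u h|i].
- by rewrite amul0l linear0 amul0l.
- by rewrite amulDl 2!linearD /= amulDl h h'.
- by rewrite amulZl 2!linearZ /= amulZl h.
move: v; apply: (eP _) => [|u u' h h'|k u h|//].
- by rewrite amul0r linear0 amul0r.
- by rewrite amulDr 2!linearD /= amulDr h h'.
- by rewrite amulZr 2!linearZ /= amulZr h.
Qed.

Section CubicForm.
Variables (F : fieldType) (A : normed_alg F).

Lemma cubic_formZ (c : F) (x : A) : cubic_form (c *: x) = c ^+ 3 * cubic_form x.
Proof.
rewrite /cubic_form amulZl amulZr polarZl !polarZr; ring.
Qed.
End CubicForm.

(** These are the three carries met in computing (e_p * e_p) * (e_p * e_p). In each coordinate they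
    add up to i, because 4i = i + 3i. *)
Lemma carry_cube (F : fieldType) (a b : F) (p : Z3sq) :
  carry a b p p * (carry a b p p * carry a b (p + p) (p + p)) = a ^+ p.1 * b ^+ p.2.
Proof.
have /andP[/eqP <- /eqP <-] :
    ((p.1 + p.1) %/ 3 + ((p.1 + p.1) %/ 3 + ((p + p)%R.1 + (p + p)%R.1) %/ 3) ==
      p.1)%N
    && ((p.2 + p.2) %/ 3 + ((p.2 + p.2) %/ 3 + ((p + p)%R.2 + (p + p)%R.2) %/ 3) ==
      p.2)%N.
  by move: p; apply: Z3sq_all; vm_compute.
by rewrite /carry !exprD; ring.
Qed.

Section FrameTheory.
Variables (F : fieldType) (A : normed_alg F) (G : zmodType).
Variables (Gamma : G -> {vspace A}) (alpha beta : units F).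
Variables (d : Z3sq -> G) (e : Z3sq -> A).
Hypothesis fr : okubo_frame Gamma alpha beta d e.
Local Notation phi := (sum_map alpha beta e).

Lemma frame_spanning : linear_spanning (fun s : Z3sq_nz => e (val s)).
Proof.
have sp : linear_spanning (fun s : Z3sq_nz => sc_basis F s : okubo_ab alpha beta).
  by move=> P *; apply: sc_basis_ind.
move=> P P0 PD PZ Pe; apply: (linear_spanning_comp (frame_iso fr) sp) => // s.
by rewrite sum_map_basis.
Qed.

Lemma sum_map_mul (x y : okubo_ab alpha beta) :
  phi (amul x y) = amul (phi x) (phi y).
Proof.
have sp : linear_spanning (fun s : Z3sq_nz => sc_basis F s : okubo_ab alpha beta).
  by move=> P *; apply: sc_basis_ind.
move: x y; apply: (alg_morph_spanning sp) => s t.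
rewrite !sum_map_basis (frameM fr) ?(valP s) ?(valP t) //= sc_prod_basis linear_sum
  /=.
have [st0|nst] := eqVneq (val s + val t) 0.
  rewrite st0 (frame0 fr) scaler0 big1 // => r _.
  by rewrite eq_sym (negbTE (valP r)) scale0r linear0.
rewrite (bigD1 (znz nst)) //= eqxx linearZ /= sum_map_basis big1 ?addr0 // => r nr.
by rewrite eq_sym -(inj_eq val_inj) /= in nr; rewrite (negbTE nr) scale0r linear0.
Qed.

Lemma lker_sum_map : lker phi == 0%VS.
Proof. by apply/lker0P; apply: bij_inj (frame_iso fr). Qed.

Lemma sum_mapK : cancel phi phi^-1%VF.
Proof. exact: lker0_lfunK lker_sum_map. Qed.

Lemma sum_mapVK : cancel phi^-1%VF phi.
Proof.
have [psi _ psiK] := frame_iso fr.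
by move=> v; rewrite -[v]psiK sum_mapK.
Qed.

Definition frame_map (V : vectType F) (b : Z3sq -> V) : 'Hom(A, V) :=
  (sum_map alpha beta b \o phi^-1)%VF.

Lemma frame_mapE (V : vectType F) (b : Z3sq -> V) p : b 0 = 0 ->
  frame_map b (e p) = b p.
Proof.
move=> b0; have [->|np] := eqVneq p 0; first by rewrite (frame0 fr) linear0.
by rewrite comp_lfunE -(sum_map_basis alpha beta e (znz np)) sum_mapK sum_map_basis.
Qed.

Lemma frame_ext (V : vectType F) (f g : 'Hom(A, V)) :
  (forall p, p != 0 -> f (e p) = g (e p)) -> f = g.
Proof.
move=> fg; apply/lfunP; apply: frame_spanning => [|x y h h'|k x h|s].
- by rewrite !linear0.
- by rewrite !linearD /= h h'.
- by rewrite !linearZ /= h.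
- by rewrite fg // (valP s).
Qed.

Lemma frame_morph (B : normed_alg F) (f : 'Hom(A, B)) :
  (forall p q, p != 0 -> q != 0 -> amul (f (e p)) (f (e q)) =
    (okubo_sign F p q * carry (val alpha) (val beta) p q) *: f (e (p + q))) ->
  forall u v, f (amul u v) = amul (f u) (f v).
Proof.
move=> fe; apply: (alg_morph_spanning frame_spanning) => s t.
by rewrite (frameM fr) ?fe ?linearZ ?(valP s) ?(valP t).
Qed.

Lemma frame_equivalent : equivalent_gradings Gamma (Gamma_ab alpha beta).
Proof.
exists phi^-1%VF; split; first split.
- by exists phi; [apply: sum_mapVK|apply: sum_mapK].
- move=> u v; rewrite -{1}[u]sum_mapVK -{1}[v]sum_mapVK -sum_map_mul sum_mapK //.
move=> g /(frame_supp fr)[p ->]; exists p.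
rewrite (frame_line fr) limg_line; congr (<[ _ ]>%VS).
have [->|np] := eqVneq p 0.
  rewrite (frame0 fr) linear0; apply/ffunP=> s.
  by rewrite !ffunE (negbTE (valP s)).
rewrite -(sum_map_basis alpha beta e (znz np)) sum_mapK; apply/ffunP=> s.
by rewrite !ffunE -(inj_eq val_inj).
Qed.

Lemma frame_square_square p : p != 0 ->
  amul (amul (e p) (e p)) (amul (e p) (e p)) =
  (val alpha ^+ p.1 * val beta ^+ p.2) *: e p.
Proof.
move=> np.
have np2 : p + p != 0 by move: p np; apply: Z3sq_rect9.
have pp : p + p + (p + p) = p by move: p {np np2}; apply: Z3sq_rect9; apply/eqP.
have s1 q : q != 0 -> okubo_sign F q q = 1.
  by rewrite okubo_signE; move: q; apply: Z3sq_rect9.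
rewrite !(frameM fr, amulZl, amulZr) // !s1 // !mul1r pp !scalerA.
by rewrite -mulrA carry_cube.
Qed.

Hypothesis symA : symmetric_composition A.
Hypotheses (gradG : is_grading Gamma) (specG : special_grading Gamma).

Lemma frame_degree p : e p \in Gamma (d p).
Proof. by rewrite (frame_line fr) memv_line. Qed.

Lemma frame_cubic_form p : p != 0 ->
  cubic_form (e p) = val alpha ^+ p.1 * val beta ^+ p.2.
Proof.
move=> np; have n0 := homogeneous_norm symA gradG specG (frame_degree p).
have /eqP := square_square symA n0.
rewrite frame_square_square // -subr_eq0 -scalerBl scaler_eq0.
by rewrite (negbTE (frame_neq0 fr np)) orbF subr_eq0 eq_sym => /eqP.
Qed.

Lemma frame_degree0 : d 0 = 0.
Proof. by apply: (addrI (d 0)); rewrite -(frame_degD fr) !addr0. Qed.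

Local Notation cl := (class_of_pair (cube_class alpha) (cube_class beta)).

Lemma cubic_form_class p c (nN : cubic_form (c *: e p) != 0) :
  cube_class (exist (fun x : F => x != 0) _ nN : units F) = cl p.
Proof.
have [p0|np] := eqVneq p 0.
  by exfalso; move: (nN); rewrite p0 (frame0 fr) scaler0 /cubic_form amul0l polar0l
    eqxx.
have nc : c != 0.
  by apply: contraNneq nN => ->; rewrite scale0r /cubic_form amul0l polar0l.
pose cu : units F := exist (fun x : F => x != 0) c nc.
rewrite /class_of_pair -!cube_classX -cube_classM.
apply/esym/cube_classP; exists cu; apply: val_inj => /=.
by rewrite cubic_formZ frame_cubic_form // mulrC !val_unitX.
Qed.

(** [Phi] is evaluated on an arbitrary nonzero vector of the component, a multiple c e_p of the
    frame vector; this changes N by the cube of c. *)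
Lemma frame_Phi p : Phi Gamma (d p) = cl p.
Proof.
rewrite /Phi -frame_degree0 (inj_eq (frame_deg_inj fr)).
case: eqP => [->|/eqP np]; first by rewrite class_of_pair0.
have nG : Gamma (d p) != 0%VS.
  by apply: contraNneq (frame_neq0 fr np) => G0; rewrite -memv0 -G0 frame_degree.
have [c ec] : exists c, vpick (Gamma (d p)) = c *: e p.
  by apply/vlineP; rewrite -(frame_line fr) memv_pick.
have nN : cubic_form (c *: e p) != 0.
  have := cubic_form_neq0 symA gradG specG (memv_pick (Gamma (d p))).
  by rewrite vpick0 ec => /(_ nG).
rewrite -(cubic_form_class nN); congr cube_class; apply: val_inj.
by rewrite ec; apply: insubdK; exact: nN.
Qed.

Lemma frame_generated : generated_by_support Gamma = range d.
Proof.
apply/seteqP; split=> k.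
  move=> /(_ (fun k => `[< exists p, k = d p >])) H.
  have : `[< exists p, k = d p >].
    apply: H => [|l /(frame_supp fr) ?]; last exact/asboolP.
    split=> [|_ _ /asboolP[p ->] /asboolP[q ->]].
      by apply/asboolP; exists 0; rewrite frame_degree0.
    apply/asboolP; exists (p - q); apply: (addIr (d q)).
    by rewrite -(frame_degD fr) !subrK.
  by move=> /asboolP[p ->]; exists p.
case=> p _ <- S [S0 SB] Ssupp; have [->|np] := eqVneq p 0;
  first by rewrite frame_degree0.
apply: Ssupp; apply: contraNneq (frame_neq0 fr np) => G0.
by rewrite -memv0 -G0 frame_degree.
Qed.

Lemma frame_Phi_image : Phi_image Gamma = range cl.
Proof.
rewrite /Phi_image frame_generated; apply/seteqP; split=> a.
  by case=> _ [p _ <-] <-; exists p => //; rewrite frame_Phi.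
by case=> p _ <-; exists (d p); [exists p|rewrite frame_Phi].
Qed.

Hypothesis dimA : \dim {:A} = 8.

(** Determinant 1 is the orientation that makes e_q * e_p = 0, so rescalings of e_p and e_q can
    serve as the generators x and y of a new frame. *)
Lemma reframe p q (alpha' beta' : units F) : zdet p q = 1 ->
  cube_class alpha' = cl p -> cube_class beta' = cl q ->
  exists d' e', okubo_frame Gamma alpha' beta' d' e'.
Proof.
move=> det1 ea eb.
have [np nq npq nNpq dqp] : [/\ p != 0, q != 0, q != p, q != - p & zdet q p == 2%:R].
  have : (zdet p q == 1) ==>
      (p != 0) && (q != 0) && (q != p) && (q != - p) && (zdet q p == 2%:R).
    by move: p q {det1 ea eb}; apply: Z3sq_all2; vm_compute.
  by rewrite det1 eqxx /= => /andP[/andP[/andP[/andP[-> ->] ->] ->] ->].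
(* Equality of classes provides a z whose cube is the ratio of gamma to N(e_r); scaling by z reaches
   gamma itself and not only its class. *)
have scaled r (gamma : units F) : r != 0 -> cube_class gamma = cl r ->
    exists c, c != 0 /\ cubic_form (c *: e r) = val gamma.
  move=> nr; rewrite /class_of_pair -!cube_classX -cube_classM.
  move=> /esym/cube_classP[z ->].
  exists (val z); split; first exact: (valP z).
  by rewrite cubic_formZ frame_cubic_form //= mulrC !val_unitX.
have [c [nc Nc]] := scaled p alpha' np ea.
have [c' [nc' Nc']] := scaled q beta' nq eb.
exists (pair_degree (d p) (d q)), (frame_vector (c *: e p) (c' *: e q)).
apply: frame_exists_pair; rewrite ?rpredZ ?frame_degree //.
- by rewrite scaler_eq0 negb_or nc (frame_neq0 fr).
- by rewrite scaler_eq0 negb_or nc' (frame_neq0 fr).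
- by move/(frame_deg_inj fr)/eqP; apply/negP.
- move=> /eqP; rewrite -addr_eq0 -(frame_degD fr) -frame_degree0.
  by rewrite (inj_eq (frame_deg_inj fr)) addr_eq0 (negbTE nNpq).
- rewrite amulZl amulZr (frameM fr) // /okubo_sign -/(zdet q p) dqp /=.
  by rewrite mul0r scale0r !scaler0.
Qed.
End FrameTheory.

(** * The action on degrees and the Weyl group *)

Lemma sum_ord2 (V : nmodType) (f : 'I_2 -> V) : \sum_i f i = f 0 + f 1.
Proof.
by rewrite !big_ord_recl big_ord0 addr0; congr (f _ + f _); apply: val_inj.
Qed.

Lemma det_mx22 (R : comNzRingType) (M : 'M[R]_2) :
  \det M = M 0 0 * M 1 1 - M 0 1 * M 1 0.
Proof.
rewrite (expand_det_row _ 0) sum_ord2 /cofactor !det_mx11 !mxE /=.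
rewrite expr0 mul1r expr1 mulN1r mulrN.
by congr (_ * M _ _ - _ * M _ _); apply: val_inj.
Qed.

Section MatrixAction.
Implicit Types (M N : 'M['Z_3]_2) (p q : Z3sq).

Definition mact M p : Z3sq :=
  (M 0 0 * p.1 + M 0 1 * p.2, M 1 0 * p.1 + M 1 1 * p.2).

Lemma mactD M p q : mact M (p + q) = mact M p + mact M q.
Proof. by rewrite /mact; congr (_, _) => /=; ring. Qed.

Lemma mact0 M : mact M 0 = 0.
Proof. by rewrite /mact /= !mulr0 addr0. Qed.

Lemma mact1 p : mact 1%:M p = p.
Proof. by case: p => i j; rewrite /mact !mxE /= !mul1r !mul0r addr0 add0r. Qed.

Lemma mactM M N p : mact (M *m N) p = mact M (mact N p).
Proof. by rewrite /mact !mxE !sum_ord2 /=; congr (_, _); ring. Qed.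

Lemma mact_inj M N : (forall p, mact M p = mact N p) -> M = N.
Proof.
move=> MN; have := MN (1, 0); have := MN (0, 1).
rewrite /mact /= !mulr1 !mulr0 !addr0 !add0r => -[e1 e2] [e3 e4].
apply/matrixP=> i j.
have I2 (k : 'I_2) : k = 0 \/ k = 1.
  by case: k => [[|[|k]] Hk] //; [left|right]; apply: val_inj.
by case: (I2 i) (I2 j) => -> [] ->.
Qed.

Lemma zdet_mact M p q : zdet (mact M p) (mact M q) = \det M * zdet p q.
Proof. rewrite det_mx22 /zdet /mact /=; ring. Qed.

Lemma zadd_mx (f : Z3sq -> Z3sq) : (forall p q, f (p + q) = f p + f q) ->
  exists M, forall p, f p = mact M p.
Proof.
move=> fD; pose M : 'M['Z_3]_2 := \matrix_(i, j)
  (let p := if j == 0 then f (1, 0) else f (0, 1) in if i == 0 then p.1 else p.2).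
exists M; have f0 : f 0 = 0 by apply: (addrI (f 0)); rewrite -fD !addr0.
have fMn (p : Z3sq) n : f (p *+ n) = f p *+ n.
  by elim: n => [|n IHn]; rewrite ?mulr0n // !mulrSr fD IHn.
have pE (p : Z3sq) : p = (1, 0) *+ p.1 + (0, 1) *+ p.2.
  by apply/eqP; move: p; apply: Z3sq_all; vm_compute.
have Mn1 (p : Z3sq) (i : 'Z_3) : (p *+ i).1 = p.1 * i.
  rewrite -[i in RHS]natr_Zp mulr_natr.
  by elim: (i : nat) => [|n IHn]; rewrite ?mulr0n // !mulrSr -IHn.
have Mn2 (p : Z3sq) (i : 'Z_3) : (p *+ i).2 = p.2 * i.
  rewrite -[i in RHS]natr_Zp mulr_natr.
  by elim: (i : nat) => [|n IHn]; rewrite ?mulr0n // !mulrSr -IHn.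
move=> p; rewrite [p in LHS]pE fD !fMn /mact !mxE /=.
by rewrite -!Mn1 -!Mn2.
Qed.
End MatrixAction.

Section AutFrame.
Variables (F : fieldType) (A : normed_alg F) (G : zmodType).
Variables (Gamma : G -> {vspace A}) (alpha beta : units F).
Variables (d : Z3sq -> G) (e : Z3sq -> A).
Hypothesis fr : okubo_frame Gamma alpha beta d e.
Hypothesis symA : symmetric_composition A.
Hypotheses (gradG : is_grading Gamma) (specG : special_grading Gamma).
Local Notation cl := (class_of_pair (cube_class alpha) (cube_class beta)).
Local Notation Aut := (Aut_grading Gamma).
Local Notation carry := (carry (val alpha) (val beta)).

Definition aut_fun (f : Aut) : 'End(A) := val (val f).

Lemma aut_funM (f g : Aut) : aut_fun (f * g)%g = (aut_fun f \o aut_fun g)%VF.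
Proof. by []. Qed.

Lemma aut_fun_inj : injective aut_fun.
Proof. by move=> f g /val_inj/val_inj. Qed.

Lemma aut_funP (f : Aut) : in_Aut Gamma (val f).
Proof. by case: f => f /= /asboolP. Qed.

Lemma aut_fun_lker (f : Aut) : lker (aut_fun f) == 0%VS.
Proof. exact: valP (val f). Qed.

Lemma frame_scale_eq p q c c' : q != 0 -> c' != 0 -> c *: e p = c' *: e q -> p = q.
Proof.
move=> nq nc' E; apply: (frame_deg_inj fr).
have ne : c *: e p != 0 by rewrite E scaler_eq0 negb_or nc' (frame_neq0 fr).
apply: (homogeneous_eq gradG _ _ ne); first by rewrite rpredZ ?(frame_degree fr).
by rewrite E rpredZ ?(frame_degree fr).
Qed.

Lemma frame_component_neq0 p : p != 0 -> Gamma (d p) != 0%VS.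
Proof.
move=> np; apply: contraNneq (frame_neq0 fr np) => G0.
by rewrite -memv0 -G0 (frame_degree fr).
Qed.

Lemma aut_frame (f : Aut) p : p != 0 ->
  exists q c, [/\ q != 0, c != 0 & aut_fun f (e p) = c *: e q].
Proof.
move=> np; have [_ fG _] := aut_funP f.
have [h fh] := fG _ (frame_component_neq0 np).
have nh : Gamma h != 0%VS by rewrite -fh GLV_eq0 frame_component_neq0.
have [q eq] := frame_supp fr nh; exists q.
have := memv_img (aut_fun f) (frame_degree fr p); rewrite fh eq (frame_line fr).
move=> /vlineP[c ec]; exists c; split=> //.
  by apply: contraNneq nh => q0; rewrite eq (frame_line fr) q0 (frame0 fr) -subv0;
    apply/subvP => v /vlineP[k ->]; rewrite scaler0 mem0v.
apply: contraNneq (frame_neq0 fr np) => c0.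
by rewrite -memv0 -(eqP (aut_fun_lker f)) memv_ker ec c0 scale0r.
Qed.

Definition aut_matrix (f : Aut) (M : 'M['Z_3]_2) : Prop :=
  forall p, exists2 c, c != 0 & aut_fun f (e p) = c *: e (mact M p).

Lemma aut_matrix_unique f M N : aut_matrix f M -> aut_matrix f N -> M = N.
Proof.
move=> fM fN; apply: mact_inj => p; have [->|np] := eqVneq p 0;
  first by rewrite !mact0.
have [q [c [nq nc ec]]] := aut_frame f np.
have [cM _ eM] := fM p; have [cN _ eN] := fN p.
rewrite (frame_scale_eq (p := mact M p) (c := cM) nq nc); last by rewrite -ec -eM.
by rewrite (frame_scale_eq (p := mact N p) (c := cN) nq nc) // -ec -eN.
Qed.

Lemma aut_matrixM f g M N : aut_matrix f M -> aut_matrix g N ->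
  aut_matrix (f * g)%g (M *m N).
Proof.
move=> fM gN p; have [c nc ec] := gN p; have [c' nc' ec'] := fM (mact N p).
exists (c * c'); first by rewrite mulf_neq0.
by rewrite aut_funM comp_lfunE ec linearZ /= ec' scalerA mactM.
Qed.

Lemma carry_neq0 p q : carry p q != 0.
Proof. by rewrite /Defs.carry mulf_neq0 // expf_neq0 // ?(valP alpha) ?(valP beta).
  Qed.

Lemma okubo_sign_eq0 p q : (okubo_sign F p q == 0) = (okubo_signz p q == 0).
Proof.
rewrite okubo_signE /okubo_signz; do 2?case: ifP => _; rewrite ?eqxx //.
  by rewrite rmorphN /= !oppr_eq0 oner_eq0.
by rewrite oner_eq0.
Qed.

(** The induced permutation of degrees is additive on (p, q) whenever e_p * e_q != 0. If p + q != 0,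
    this holds for (p, q) or for (q, p); if q = -p = 2p, additivity on (p, p) and 3p = 0
    conclude. *)
Lemma aut_matrix_exists f : exists M, aut_matrix f M.
Proof.
have /cid [pi piP] : exists pi : Z3sq -> Z3sq, forall p,
    [/\ p != 0 -> pi p != 0, pi 0 = 0 & exists2 c,
      c != 0 & aut_fun f (e p) = c *: e (pi p)].
  have H p : exists q, if p == 0 then q = 0 else q != 0 /\ exists2 c,
    c != 0 & aut_fun f (e p) = c *: e q.
    case: eqP => [_|/eqP np]; first by exists 0.
    by have [q [c [nq nc ec]]] := aut_frame f np; exists q; split => //; exists c.
  exists (fun p => sval (cid (H p))) => p; split.
  - by move=> /negbTE np; case: (cid (H p)) => /= q; rewrite np => -[].
  - by case: (cid (H 0)) => q.
  - case: (cid (H p)) => /= q; case: eqP => [-> ->|_ []//].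
    by exists 1; rewrite ?oner_eq0 // (frame0 fr) linear0 scaler0.
have [fmul _ _] := aut_funP f.
have pin0 p : p != 0 -> pi p != 0 by have [] := piP p.
have pi0 : pi 0 = 0 by have [] := piP 0.
have piD1 p q : p != 0 -> q != 0 -> okubo_signz p q != 0 -> pi (p + q) = pi p + pi q.
  move=> np nq spq.
  have npq : p + q != 0.
    by apply: contraNneq spq => pq; rewrite /okubo_signz pq eqxx orbT.
  have [_ _ [c nc ec]] := piP p; have [_ _ [c' nc' ec']] := piP q.
  have [_ _ [k nk ek]] := piP (p + q).
  have := fmul (e p) (e q); rewrite (frameM fr np nq) linearZ /=.
  rewrite -!/(aut_fun f) ec ec' ek amulZl amulZr (frameM fr (pin0 _ np) (pin0 _ nq)).
  rewrite !scalerA => E; apply/esym/(frame_scale_eq (pin0 _ npq) _ (esym E)).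
  by rewrite mulf_neq0 ?nk // mulf_neq0 ?carry_neq0 ?okubo_sign_eq0.
have piD p q : pi (p + q) = pi p + pi q.
  have [->|np] := eqVneq p 0; first by rewrite pi0 !add0r.
  have [->|nq] := eqVneq q 0; first by rewrite pi0 !addr0.
  have [pq|npq] := eqVneq (p + q) 0.
    have -> : q = p + p.
      have := Z3sq_all2 (P := fun p q => (p + q == 0) ==> (q == p + p)) isT p q.
      by rewrite pq eqxx /= => /eqP.
    rewrite [pi (p + p)]piD1 //.
      by have := Z3sq_all (P := fun p => p + (p + p) == 0) isT; move=> H;
        rewrite !(eqP (H _)) pi0.
    by have := Z3sq_all (P := fun p => (p != 0) ==> (okubo_signz p p != 0)) isT p;
      rewrite np.
  have : [==> p != 0, q != 0, p + q != 0 =>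
    (okubo_signz p q != 0) || (okubo_signz q p != 0)].
    by move: p q {np nq npq}; apply: Z3sq_all2; vm_compute.
  rewrite np nq npq /= => /orP[] s; first exact: piD1.
  by rewrite addrC piD1 // addrC.
have [M piM] := zadd_mx piD; exists M => p.
by have [_ _] := piP p; rewrite piM.
Qed.

Lemma aut_matrix_det f M : aut_matrix f M -> \det M = 1.
Proof.
move=> fM; have [fmul _ _] := aut_funP f.
have n10 : ((1, 0) : Z3sq) != 0 by [].
have n01 : ((0, 1) : Z3sq) != 0 by [].
have nz p : p != 0 -> mact M p != 0.
  move=> np; have [q [c [nq nc ec]]] := aut_frame f np.
  have [cM _ eM] := fM p.
  by rewrite (frame_scale_eq (p := mact M p) (c := cM) nq nc) // -ec -eM.
have sgn p q : p != 0 -> q != 0 -> p + q != 0 ->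
    (okubo_signz p q == 0) = (okubo_signz (mact M p) (mact M q) == 0).
  move=> np nq npq; have [c nc ec] := fM p; have [c' nc' ec'] := fM q.
  have [k nk ek] := fM (p + q).
  have := fmul (e p) (e q); rewrite (frameM fr np nq) linearZ /=.
  rewrite -!/(aut_fun f) ec ec' ek amulZl amulZr (frameM fr (nz _ np) (nz _ nq)).
  rewrite -mactD !scalerA => /eqP; rewrite -subr_eq0 -scalerBl scaler_eq0.
  rewrite (negbTE (frame_neq0 fr (nz _ npq))) orbF subr_eq0 => /eqP.
  move: (carry_neq0 p q) (carry_neq0 (mact M p) (mact M q)).
  move: (carry p q) (carry (mact M p) (mact M q)) => k1 k2 nk1 nk2.
  rewrite -!okubo_sign_eq0 => /eqP; rewrite -subr_eq0 => /eqP E.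
  apply/eqP/eqP=> s0; apply/eqP; move/eqP: E; rewrite s0 !(mul0r, mulr0).
    by rewrite sub0r oppr_eq0 !mulf_eq0 (negbTE nc) (negbTE nc') (negbTE nk2) /= orbF.
  by rewrite subr0 !mulf_eq0 (negbTE nk) (negbTE nk1) !orbF.
(* The product e_{1,0} * e_{0,1} is nonzero while the reversed one vanishes. The images of these
   degrees show the same pattern, which only pairs with [zdet] equal to 1 do. *)
have s1 := etrans (esym (sgn _ _ n10 n01 isT)) (erefl : _ = false).
have s2 := etrans (esym (sgn _ _ n01 n10 isT)) (erefl : _ = true).
have -> : \det M = zdet (mact M (1, 0)) (mact M (0, 1)).
  by rewrite zdet_mact (_ : zdet _ _ = 1) ?mulr1 //; apply/eqP.
have := Z3sq_all2 (P := fun p q => [==> okubo_signz p q != 0, okubo_signz q p == 0,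
  p != 0, q != 0 => zdet p q == 1]) isT (mact M (1,0)) (mact M (0,1)).
by rewrite s1 s2 !nz //= => /eqP.
Qed.

Lemma aut_cubic_form f p : p != 0 -> cubic_form (aut_fun f (e p)) = cubic_form (e p).
Proof.
move=> np; have [fmul _ _] := aut_funP f.
have [q [c [nq nc ec]]] := aut_frame f np.
have n1 : anorm (e p) = 0 := homogeneous_norm symA gradG specG (frame_degree fr p).
have n2 : anorm (aut_fun f (e p)) = 0.
  by rewrite ec; apply: (homogeneous_norm symA gradG specG (rpredZ c (frame_degree
    fr q))).
have := square_square symA n2; rewrite -!fmul square_square // linearZ /= => /eqP.
rewrite -subr_eq0 -scalerBl scaler_eq0 -/(aut_fun f) ec scaler_eq0 (negbTE nc).
by rewrite (negbTE (frame_neq0 fr nq)) !orbF subr_eq0 => /eqP <-.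
Qed.

Lemma aut_matrix_class f M p : aut_matrix f M -> cl (mact M p) = cl p.
Proof.
move=> fM; have [->|np] := eqVneq p 0; first by rewrite mact0.
have [c nc ec] := fM p.
have nN1 : cubic_form (1 *: e p) != 0.
  by rewrite scale1r; apply: (cubic_form_neq0 symA gradG specG (frame_degree fr
    p)); exact: (frame_neq0 fr).
have nN2 : cubic_form (c *: e (mact M p)) != 0.
  by rewrite -ec aut_cubic_form // -[e p]scale1r.
rewrite -(cubic_form_class fr symA gradG specG nN1).
rewrite -(cubic_form_class fr symA gradG specG nN2); congr cube_class.
by apply: val_inj; rewrite /= -ec aut_cubic_form // scale1r.
Qed.

Lemma aut_matrix_stab f M : aut_matrix f M -> (f \in Stab_grading Gamma) = (M ==
  1%:M).
Proof.
move=> fM; apply/asboolP/eqP => [fS|M1 g].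
  apply: (aut_matrix_unique fM) => p; have [->|np] := eqVneq p 0.
    by exists 1; rewrite ?oner_eq0 // mact0 (frame0 fr) linear0 scaler0.
  have := memv_img (aut_fun f) (frame_degree fr p).
  have -> : (aut_fun f @: Gamma (d p))%VS = Gamma (d p) := fS (d p).
  rewrite (frame_line fr) mact1 => /vlineP[c ec]; exists c => //.
  apply: contraNneq (frame_neq0 fr np) => c0.
  by rewrite -memv0 -(eqP (aut_fun_lker f)) memv_ker ec c0 scale0r.
have [g0|ng] := eqVneq (Gamma g) 0%VS; first by rewrite g0 limg0.
have [p ->] := frame_supp fr ng; rewrite (frame_line fr) limg_line.
have [c nc] := fM p; rewrite M1 mact1 => ec.
rewrite [X in <[X]>%VS]ec; apply/eqP; rewrite eqEsubv -!memvE rpredZ ?memv_line //=.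
by rewrite -[e p in X in X \in _](scalerK nc) rpredZ ?memv_line.
Qed.
End AutFrame.

Lemma GL_mulE (u v : {'GL_2['Z_3]}) :
  val (u * v)%g = val u *m val v :> 'M['Z_3]_2.
Proof. by []. Qed.

Lemma GL_divE (u v : {'GL_2['Z_3]}) :
  val (u / v)%g = val u *m invmx (val v) :> 'M['Z_3]_2.
Proof. by []. Qed.

Lemma group_of_GLM (S : subgroup {'GL_2['Z_3]}) (u v : group_of S) :
  val (val (u * v)%g) = val (val u) *m val (val v) :> 'M['Z_3]_2.
Proof. exact: (GL_mulE (val u) (val v)). Qed.

Section ClassSubgroup.
Variables (F : fieldType) (a b : cube_classes F).

(** By [aut_matrix_det] and [aut_matrix_class] every automorphism acts on degrees by such a matrix;
    in a good frame all of them occur. *)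
Definition class_stabilizes (M : 'M['Z_3]_2) : Prop :=
  \det M = 1 /\ forall p, class_of_pair a b (mact M p) = class_of_pair a b p.

Fact class_stabilizer_closed :
  group_closed [pred u : {'GL_2['Z_3]} | `[< class_stabilizes (val u) >]].
Proof.
split=> [|u v]; rewrite !inE; first by split=> [|p]; rewrite ?det1 ?mact1.
move=> [du cu] [dv cv]; split.
  by rewrite det_mulmx det_inv du dv mul1r invr1.
move=> p; rewrite GL_divE mactM cu -cv -mactM.
by rewrite mulmxV ?mact1 // unitmxE dv unitr1.
Qed.
Definition class_stabilizer : subgroup {'GL_2['Z_3]} := Subgroup
  class_stabilizer_closed.

Lemma in_class_stabilizer u : (u \in class_stabilizer) = `[< class_stabilizes (val
  u) >].
Proof. by []. Qed.

Lemma class_stabilizer_sub M : class_stabilizes M ->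
  exists k : group_of class_stabilizer, val (val k) = M.
Proof.
move=> kM; have uM : M \is a GRing.unit.
  by rewrite [_ \is a _]unitmxE kM.1 unitr1.
pose u : {'GL_2['Z_3]} := FinRing.unit _ uM.
have ku : u \in class_stabilizer by rewrite in_class_stabilizer; apply/asboolP.
by exists (exist _ u ku).
Qed.
End ClassSubgroup.

Lemma unit_mu3 (F : fieldType) (k : group_of (mu3 F)) : val (val k) ^+ 3 = 1 :> F.
Proof. by have := valP k; rewrite inE => /eqP/(congr1 val); rewrite val_unitX. Qed.

Section Monomial.
Variables (F : fieldType) (A : normed_alg F) (G : zmodType).
Variables (Gamma : G -> {vspace A}) (alpha beta : units F).
Variables (d : Z3sq -> G) (e : Z3sq -> A).
Hypothesis fr : okubo_frame Gamma alpha beta d e.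
Hypothesis symA : symmetric_composition A.
Hypotheses (gradG : is_grading Gamma) (specG : special_grading Gamma).
Local Notation cl := (class_of_pair (cube_class alpha) (cube_class beta)).
Local Notation Aut := (Aut_grading Gamma).
Local Notation carry := (carry (val alpha) (val beta)).

Definition monomial (M : 'M['Z_3]_2) (c c' : F) : 'End(A) :=
  frame_map alpha beta e (fun p => (c ^+ p.1 * c' ^+ p.2) *: e (mact M p)).

Lemma monomialE M c c' p :
  monomial M c c' (e p) = (c ^+ p.1 * c' ^+ p.2) *: e (mact M p).
Proof. by rewrite (frame_mapE fr) // mact0 (frame0 fr) scaler0. Qed.

Lemma expr_Z3D (c : F) (i j : 'Z_3) : c ^+ 3 = 1 -> c ^+ (i + j)%R = c ^+ i * c ^+ j.
Proof.
move=> c3; rewrite -exprD [in RHS](divn_eq (i + j) 3) exprD mulnC exprM c3.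
by rewrite expr1n mul1r.
Qed.

Lemma okubo_sign_mact M p q : \det M = 1 ->
  okubo_sign F (mact M p) (mact M q) = okubo_sign F p q.
Proof.
move=> dM; rewrite /okubo_sign -!/(zdet _ _) zdet_mact dM mul1r -mactD.
suff -> : (mact M (p + q) == 0) = (p + q == 0) by [].
apply/eqP/eqP=> [e0|->]; last exact: mact0.
by rewrite -[p + q]mact1 -(@mulVmx _ _ M) ?unitmxE ?dM ?unitr1 // mactM e0 mact0.
Qed.

(** Each part of the structure constants is respected: the sign by det M = 1, the carry by
    hypothesis, and the scalars because p -> c^{p.1} c'^{p.2} is a character of (Z/3)^2. *)
Lemma monomial_aut M c c' : \det M = 1 -> c ^+ 3 = 1 -> c' ^+ 3 = 1 ->
  (forall p q, carry (mact M p) (mact M q) = carry p q) ->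
  exists f : Aut, aut_fun f = monomial M c c'.
Proof.
move=> dM c3 c'3 car; set f := monomial M c c'; pose N := invmx M.
have uM : M \in unitmx by rewrite unitmxE dM unitr1.
have NM p : mact N (mact M p) = p by rewrite -mactM mulVmx // mact1.
have MN p : mact M (mact N p) = p by rewrite -mactM mulmxV // mact1.
have M0 p : p != 0 -> mact M p != 0.
  by apply: contraNneq => Mp; rewrite -[p]NM Mp mact0.
have nz (x : F) : x ^+ 3 = 1 -> x != 0.
  by move=> x3; apply: contra_eqN x3 => /eqP->; rewrite expr0n eq_sym oner_eq0.
pose t (p : Z3sq) := c ^+ p.1 * c' ^+ p.2.
have t0 p : t p != 0 by rewrite mulf_neq0 // expf_neq0 ?nz.
have fM : forall u v, f (amul u v) = amul (f u) (f v).
  apply: (frame_morph fr) => p q np nq; rewrite !monomialE amulZl amulZr.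
  rewrite (frameM fr (M0 _ np) (M0 _ nq)) okubo_sign_mact // car !scalerA -mactD.
  by congr (_ *: _); rewrite /= !expr_Z3D //; ring.
pose g : 'End(A) := frame_map alpha beta e (fun p =>
  (t (mact N p))^-1 *: e (mact N p)).
have gf : (g \o f)%VF = \1%VF.
  apply: (frame_ext fr) => p np; rewrite comp_lfunE id_lfunE monomialE linearZ /=.
  rewrite (frame_mapE fr); last by rewrite mact0 (frame0 fr) scaler0.
  by rewrite NM scalerA divff ?scale1r ?(t0 p).
have kf : lker f == 0%VS.
  by apply/lker0P; apply: (can_inj (g := g)) => x; rewrite -comp_lfunE gf id_lfunE.
have fline p : (f @: Gamma (d p))%VS = Gamma (d (mact M p)).
  rewrite !(frame_line fr) limg_line monomialE; apply/eqP; rewrite eqEsubv -!memvE.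
  rewrite rpredZ ?memv_line //= -[X in X \in _](scalerK (t0 p)) rpredZ ?memv_line //.
have inA : in_Aut Gamma (exist (fun h : 'End(A) => lker h == 0%VS) f kf : GLV A).
  split=> //= h /(frame_supp fr)[p ->]; first by exists (d (mact M p)).
  by exists (d (mact N p)); rewrite fline MN.
by exists (exist _ (exist (fun h : 'End(A) => lker h == 0%VS) f kf) (asboolT inA)).
Qed.

(** The vectors e_{1,0} and e_{0,1} generate A under the product. An element of the stabilizer is
    therefore determined by its two eigenvalues on them. *)
Lemma frame_generation (B : normed_alg F) (f g : 'Hom(A, B)) :
  (forall u v, f (amul u v) = amul (f u) (f v)) ->
  (forall u v, g (amul u v) = amul (g u) (g v)) ->
  f (e (1, 0)) = g (e (1, 0)) -> f (e (0, 1)) = g (e (0, 1)) -> f = g.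
Proof.
move=> fM gM e10 e01; apply: (frame_ext fr) => p _.
have H q r : f (e q) = g (e q) -> f (e r) = g (e r) -> q != 0 -> r != 0 ->
    okubo_signz q r != 0 -> f (e (q + r)) = g (e (q + r)).
  move=> eq er nq nr sqr; have := fM (e q) (e r); rewrite eq er -gM (frameM fr) //.
  rewrite !linearZ /=; apply: scalerI; rewrite mulf_neq0 ?(carry_neq0 alpha beta) //.
  by rewrite okubo_sign_eq0.
have e20 := H _ _ e10 e10 isT isT isT; have e02 := H _ _ e01 e01 isT isT isT.
have e11 := H _ _ e10 e01 isT isT isT; have e22 := H _ _ e11 e11 isT isT isT.
have e21 := H _ _ e01 e20 isT isT isT; have e12 := H _ _ e02 e10 isT isT isT.
have C q r : q == r -> f (e q) = g (e q) -> f (e r) = g (e r) by move=> /eqP->.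
move: p; apply: Z3sq_rect9.
- by rewrite (frame0 fr) !linear0.
- exact: e01.
- by apply: (C _ _ _ e02).
- exact: e10.
- by apply: (C _ _ _ e11).
- by apply: (C _ _ _ e12).
- by apply: (C _ _ _ e20).
- by apply: (C _ _ _ e21).
- by apply: (C _ _ _ e22).
Qed.

(* Then e_p |-> e_(M p) is an automorphism for each M preserving Phi, which splits
   the Weyl group. *)
Definition frame_good : Prop := forall M,
  class_stabilizes (cube_class alpha) (cube_class beta) M ->
  forall p q, carry (mact M p) (mact M q) = carry p q.

(** The section sends M to e_p -> e_(M p) with no scalars, hence is multiplicative; [split_quotient]
    applies to it and to the degree matrix. *)
Lemma Weyl_group_split : frame_good ->
  group_iso (Weyl_group Gamma)
    (group_of (class_stabilizer (cube_class alpha) (cube_class beta)))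
  /\ quotient_splits (Stab_grading Gamma).
Proof.
move=> good; set K := class_stabilizer _ _.
have fP (f : Aut) : exists k : group_of K, aut_matrix e f (val (val k)).
  have [M fM] := aut_matrix_exists fr gradG f.
  have [|k eM] := class_stabilizer_sub (a := cube_class alpha) (b := cube_class
    beta) (M := M).
    split; first exact: (aut_matrix_det fr gradG fM).
    by move=> p; apply: (aut_matrix_class fr symA gradG specG p fM).
  by exists k; rewrite eM.
have kP (k : group_of K) : class_stabilizes (cube_class alpha) (cube_class beta)
  (val (val k)).
  by apply/asboolP; exact: (valP k).
have sP (k : group_of K) : exists f : Aut, aut_fun f = monomial (val (val k)) 1 1.
  have [dk _] := kP k.
  by apply: monomial_aut; rewrite ?expr1n //; apply: good; exact: kP.
pose f h := sval (cid (fP h)); pose s k := sval (cid (sP k)).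
have fM h : aut_matrix e h (val (val (f h))) by exact: (svalP (cid (fP h))).
have sE k : aut_fun (s k) = monomial (val (val k)) 1 1 by exact: (svalP (cid (sP k))).
have fE h k : aut_matrix e h (val (val k)) -> f h = k.
  by move=> hk; apply/val_inj/val_inj/(aut_matrix_unique fr gradG (fM h) hk).
apply: (split_quotient (f := f) (s := s)).
- by move=> x y; apply: fE; rewrite group_of_GLM; apply: aut_matrixM.
- move=> x y; apply: aut_fun_inj; rewrite aut_funM !sE group_of_GLM.
  apply: (frame_ext fr) => p _; rewrite comp_lfunE !monomialE !expr1n !mul1r !scale1r.
  by rewrite monomialE !expr1n mul1r scale1r -mactM.
- move=> k; apply: fE => p; exists 1; rewrite ?oner_eq0 // sE monomialE.
  by rewrite !expr1n mul1r.
- move=> x; rewrite (aut_matrix_stab fr gradG (fM x)).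
  by apply/eqP/eqP=> [e1|->//]; apply/val_inj/val_inj.
Qed.

Lemma Stab_mu3 : group_iso (group_of (Stab_grading Gamma))
  (group_of (mu3 F) * group_of (mu3 F))%type.
Proof.
have sP (k : (group_of (mu3 F) * group_of (mu3 F))%type) :
    exists f : group_of (Stab_grading Gamma),
      aut_fun (val f) = monomial 1%:M (val (val k.1)) (val (val k.2)).
  have [|||p q|f ef] := @monomial_aut 1%:M (val (val k.1)) (val (val k.2));
    rewrite ?det1 ?unit_mu3 ?mact1 //.
  suff fS : f \in Stab_grading Gamma by exists (exist _ f fS).
  rewrite (@aut_matrix_stab _ _ _ _ _ _ _ _ fr gradG f 1%:M) ?eqxx // => p.
  exists (val (val k.1) ^+ p.1 * val (val k.2) ^+ p.2); last by rewrite ef monomialE.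
  by rewrite mulf_neq0 // expf_neq0 //;
    [exact: (valP (val k.1))|exact: (valP (val k.2))].
have fP (f : group_of (Stab_grading Gamma)) :
    exists k : (group_of (mu3 F) * group_of (mu3 F))%type,
      aut_fun (val f) = monomial 1%:M (val (val k.1)) (val (val k.2)).
  have [M fM] := aut_matrix_exists fr gradG (val f).
  have /eqP M1 : M == 1%:M by rewrite -(aut_matrix_stab fr gradG fM); exact: (valP f).
  have mk p : p != 0 -> exists k : group_of (mu3 F),
    aut_fun (val f) (e p) = val (val k) *: e p.
    move=> np; have [c nc] := fM p; rewrite M1 mact1 => ec.
    (* Since f(e_p) = c e_p, invariance of N reads c^3 N(e_p) = N(e_p). *)
    have c3 : c ^+ 3 = 1.
      have := aut_cubic_form fr symA gradG specG (val f) np.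
      rewrite ec cubic_formZ => /eqP;
        rewrite -subr_eq0 -{2}[cubic_form _]mul1r -mulrBl.
      rewrite mulf_eq0 (negbTE (cubic_form_neq0 symA gradG specG (frame_degree fr
        p) (frame_neq0 fr np))).
      by rewrite orbF subr_eq0 => /eqP.
    pose cu : units F := exist (fun x : F => x != 0) c nc.
    have cu3 : cu \in mu3 F by rewrite inE; apply/eqP/val_inj; rewrite val_unitX.
    by exists (exist _ cu cu3).
  have [k ek] := mk (1, 0) isT; have [k' ek'] := mk (0, 1) isT.
  have [g eg] := sP (k, k').
  exists (k, k'); rewrite -eg; apply: frame_generation.
  - by have [] := aut_funP (val f).
  - by have [] := aut_funP (val g).
  - by rewrite eg monomialE /= expr0 expr1 mulr1 mact1.
  - by rewrite eg monomialE /= expr0 expr1 mul1r mact1.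
pose s k := sval (cid (sP k)); pose t f := sval (cid (fP f)).
have sE k : aut_fun (val (s k)) = monomial 1%:M (val (val k.1)) (val (val k.2)).
  exact: (svalP (cid (sP k))).
have tE f : aut_fun (val f) = monomial 1%:M (val (val (t f).1)) (val (val (t f).2)).
  exact: (svalP (cid (fP f))).
have mono_inj (k k' : (group_of (mu3 F) * group_of (mu3 F))%type) :
  monomial 1%:M (val (val k.1)) (val (val k.2))
    = monomial 1%:M (val (val k'.1)) (val (val k'.2)) ->
    k = k' :> (group_of (mu3 F) * group_of (mu3 F))%type.
  move=> E; have E1 := congr1 (fun h : 'End(A) => h (e (1, 0))) E.
  have E2 := congr1 (fun h : 'End(A) => h (e (0, 1))) E.
  move: E1 E2; rewrite !monomialE !mact1 /= !expr0 !expr1 !mulr1 !mul1r.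
  have eqc p c c' : p != 0 -> c *: e p = c' *: e p -> c = c'.
    move=> np /eqP; rewrite -subr_eq0 -scalerBl scaler_eq0 (negbTE (frame_neq0 fr
      np)).
    by rewrite orbF subr_eq0 => /eqP.
  move=> /(eqc (1, 0) _ _ isT) E1 /(eqc (0, 1) _ _ isT) E2.
  by case: k k' E1 E2 {E} => k1 k2 [k1' k2'] /= E1 E2; congr (_, _);
    do 2!apply: val_inj.
apply: group_iso_sym; apply: (group_iso_can (f := s) (g := t)).
- move=> k k'; apply/val_inj/aut_fun_inj;
  rewrite [val (_ * _)%g](_ : _ = (val (s k) * val (s k'))%g) //.
  rewrite aut_funM !sE; apply: (frame_ext fr) => p _.
  rewrite comp_lfunE !monomialE linearZ /= monomialE !mact1 scalerA; congr (_ *: _).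
  by rewrite !exprMn; ring.
- by move=> k; apply: mono_inj; rewrite -tE sE.
- by move=> f; apply/val_inj/aut_fun_inj; rewrite sE -tE.
Qed.
End Monomial.

(** * Normal forms *)

Section CanonicalFrame.
Variables (F : fieldType) (alpha beta : units F).
Local Notation O := (okubo_ab alpha beta).

Definition okubo_vector (p : Z3sq) : O :=
  ([ffun s : Z3sq_nz => (val s == p)%:R] : {ffun Z3sq_nz -> F^o}).

Lemma okubo_vector_basis (s : Z3sq_nz) : okubo_vector (val s) = sc_basis F s.
Proof. by symmetry; apply/ffunP=> t; rewrite !ffunE -(inj_eq val_inj). Qed.

Lemma okubo_vector0 : okubo_vector 0 = 0.
Proof. by apply/ffunP=> s; rewrite !ffunE (negbTE (valP s)). Qed.

(** Makes the frame results available for O_{alpha,beta} itself: its products in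
    [equivalent_orientation], and the image of Phi for the rational examples. *)
Lemma canonical_frame : okubo_frame (Gamma_ab alpha beta) alpha beta id okubo_vector.
Proof.
split=> //; first exact: okubo_vector0.
- move=> p np; rewrite -[p]/(val (znz np)) okubo_vector_basis; apply/eqP.
  move/(congr1 (fun v : {ffun Z3sq_nz -> F^o} => v (znz np))).
  by rewrite !ffunE eqxx; apply/eqP/oner_neq0.
- move=> p q np nq; rewrite -[p]/(val (znz np)) -[q]/(val (znz nq)).
  move: (znz np) (znz nq) => s t {p q np nq}.
  rewrite !okubo_vector_basis /= sc_prod_basis.
  have [st0|nst] := eqVneq (val s + val t) 0.
    rewrite st0 okubo_vector0 scaler0 big1 // => r _.
    by rewrite eq_sym (negbTE (valP r)) scale0r.
  rewrite -[in RHS](_ : val (znz nst) = val s + val t) // okubo_vector_basis.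
  rewrite (bigD1 (znz nst)) //= eqxx.
  rewrite big1 ?addr0 // => r nr.
  by rewrite eq_sym -(inj_eq val_inj) /= in nr; rewrite (negbTE nr) scale0r.
- by move=> k _; exists k.
exists id => x; rewrite sum_mapE [RHS]sc_basisE; apply: eq_bigr => s _;
  by rewrite okubo_vector_basis.
Qed.
End CanonicalFrame.

Lemma frame_exists (F : fieldType) (A : normed_alg F) (G : zmodType)
    (Gamma : G -> {vspace A}) : symmetric_composition A -> \dim {:A} = 8 ->
  is_grading Gamma -> special_grading Gamma ->
  exists alpha beta d e, okubo_frame Gamma alpha beta d e.
Proof.
move=> symA dimA gradG specG.
have [g [h [ng nh hg hNg]]] := degree_pair symA gradG specG dimA.
have frame g' h' (x y : A) : x \in Gamma g' -> y \in Gamma h' -> x != 0 -> y != 0 ->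
    h' <> g' -> h' <> - g' -> amul y x = 0 ->
    exists alpha beta d e, okubo_frame Gamma alpha beta d e.
  move=> xg yh nx ny hg' hNg' yx.
  pose a : units F := exist (fun c : F =>
    c != 0) _ (cubic_form_neq0 symA gradG specG xg nx).
  pose b : units F := exist (fun c : F =>
    c != 0) _ (cubic_form_neq0 symA gradG specG yh ny).
  exists a, b, (pair_degree g' h'), (frame_vector x y).
  exact: frame_exists_pair.
pose x := vpick (Gamma g); pose y := vpick (Gamma h).
have xg : x \in Gamma g := memv_pick _; have yh : y \in Gamma h := memv_pick _.
have nx : x != 0 by rewrite vpick0.
have ny : y != 0 by rewrite vpick0.
have [xy|nxy] := eqVneq (amul x y) 0.
  apply: (frame h g y x) => // [e|e]; first by case: hg.
  by case: hNg; rewrite e opprK.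
apply: (frame g h x y) => //.
exact: (amul_eq0_or symA gradG specG xg yh nx ny hg hNg nxy).
Qed.

(** The cases are: Phi trivial, Phi neither trivial nor injective, Phi injective. In the second, the
    new frame has its first degree in the kernel of Phi, so that alpha can be taken equal to 1. *)
Lemma frame_normal (F : fieldType) (A : normed_alg F) (G : zmodType)
    (Gamma : G -> {vspace A}) : symmetric_composition A -> \dim {:A} = 8 ->
  is_grading Gamma -> special_grading Gamma ->
  exists alpha beta d e, okubo_frame Gamma alpha beta d e /\
   [\/ alpha = 1%g /\ beta = 1%g,
       alpha = 1%g /\ cube_class beta <> 1%g
     | injective (class_of_pair (cube_class alpha) (cube_class beta))].
Proof.
move=> symA dimA gradG specG.
have [alpha [beta [d [e fr]]]] := frame_exists symA dimA gradG specG.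
have re := reframe fr symA gradG specG dimA.
move: re; set cl := class_of_pair _ _ => re.
have clD p q : cl (p + q) = (cl p * cl q)%g by exact: class_of_pairD.
have cl0 : cl 0 = 1%g by exact: class_of_pair0.
have clN p : cl p = 1%g -> cl (- p) = 1%g.
  by move=> p1; have := clD p (- p); rewrite addrN cl0 p1 mul1g => <-.
have [all1|/existsNP[q q1]] := pselect (forall p, cl p = 1%g).
  have det1 : zdet (1, 0) (0, 1) = 1 by apply/eqP.
  have [d' [e' fr']] := re (1, 0) (0, 1) 1%g 1%g det1 (esym (all1 _)) (esym (all1 _)).
  by exists 1%g, 1%g, d', e'; split => //; apply: Or31.
have [inj|ninj] := pselect (injective cl).
  by exists alpha, beta, d, e; split => //; apply: Or33.
have [r nr r1] : exists2 r, r != 0 & cl r = 1%g.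
  apply: contrapT => no; apply: ninj => p p' epp'; apply/eqP; rewrite -subr_eq0.
  apply: contra_notT no => npp'; exists (p - p') => //.
  by rewrite clD epp' -clD addrN.
(* A nonzero r in the kernel and a q outside it are independent, as q would otherwise be 0, r or -r.
   Replacing r by -r if necessary then makes the determinant 1. *)
have n2 : zdet r q != 0.
  apply: contra_notN q1 => /eqP rq.
  have : [==> r != 0, zdet r q == 0 => [|| q == 0, q == r | q == - r]].
    by move: r q {nr r1 rq}; apply: Z3sq_all2; vm_compute.
  by rewrite nr rq eqxx /= => /or3P[] /eqP->; rewrite ?cl0 ?clN.
have [b eb] := cube_class_surj (cl q).
have [s s1 rq] : exists2 s, cl s = 1%g & zdet s q = 1.
  have [rq|nrq] := eqVneq (zdet r q) 1; first by exists r.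
  exists (- r); rewrite ?clN //; apply/eqP.
  have : [==> zdet r q != 0, zdet r q != 1 => zdet (- r) q == 1].
    by move: r q {q1 nr r1 n2 nrq eb}; apply: Z3sq_all2; vm_compute.
  by rewrite n2 nrq.
have [d' [e' fr']] := re s q 1%g b rq (esym s1) eb.
by exists 1%g, b, d', e'; split => //; apply: Or32; split => //; rewrite eb.
Qed.

(** * The group preserving Phi in each of the three cases *)

Section Stabilizers.
Variable F : fieldType.
Implicit Types alpha beta : units F.

Lemma frame_good1 : frame_good (1%g : units F) 1%g.
Proof. by move=> M _ p q; rewrite /carry !expr1n. Qed.

Lemma class_exp_inj (b : cube_classes F) : b <> 1%g ->
  injective (fun i : 'Z_3 => (b ^+ i)%g).
Proof.
move=> b1 i j; have b3 := cube_class_exp3 b.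
have b2 : (b ^+ 2 <> 1)%g.
  by move=> b2; apply: b1; rewrite -b3 expgS b2 mulg1.
have b12 : (b ^+ 2 <> b)%g.
  by move=> b12; apply: b1; apply: (mulgI b);
    rewrite mulg1 -[RHS]b12 !expgS expg0 mulg1.
by case: i j => [[|[|[|i]]] Hi] // [[|[|[|j]]] Hj] //=; rewrite ?expg0 ?expg1 => E;
  try apply: val_inj => //; exfalso; auto.
Qed.

Lemma class_of_pair1 (b : cube_classes F) p : class_of_pair 1%g b p = (b ^+ p.2)%g.
Proof. by rewrite /class_of_pair expg1n mul1g. Qed.

Lemma class_stabilizes1 (b : cube_classes F) M : b <> 1%g ->
  class_stabilizes 1%g b M -> forall p, (mact M p).2 = p.2.
Proof.
move=> b1 [_ cM] p; apply: (class_exp_inj b1).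
by have := cM p; rewrite !class_of_pair1.
Qed.

(** For alpha = 1 a carry depends only on second coordinates. These are fixed by M, because the
    class of beta has order 3 and M preserves its powers. *)
Lemma frame_good2 beta : cube_class beta <> 1%g -> frame_good 1%g beta.
Proof.
move=> b1 M MK p q; rewrite /carry !expr1n !mul1r.
by rewrite !(class_stabilizes1 b1 MK).
Qed.

Lemma frame_good3 alpha beta :
  injective (class_of_pair (cube_class alpha) (cube_class beta)) ->
  frame_good alpha beta.
Proof. by move=> inj M [_ cM] p q; rewrite !(inj _ _ (cM _)). Qed.

Lemma class_stabilizer_SL23 : group_iso (group_of (class_stabilizer (1 :
  cube_classes F)%g 1%g)) (group_of SL23).
Proof.
set K := class_stabilizer _ _.
have fP (u : group_of K) : val u \in SL23.
  by have /asboolP[du _] := valP u; rewrite inE; exact/eqP.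
have gP (u : group_of SL23) : val u \in K.
  have := valP u; rewrite inE => /eqP du; apply/asboolP; split => // p.
  by rewrite !class_of_pair1 !expg1n.
pose f (u : group_of K) : group_of SL23 := exist _ (val u) (fP u).
pose g (u : group_of SL23) : group_of K := exist _ (val u) (gP u).
by apply: (group_iso_can (f := f) (g := g)) => [u v|u|u]; apply: val_inj.
Qed.

(** Fixing second coordinates makes the second row (0, 1), and det M = 1 then makes the upper left
    entry 1: only the unipotent matrices [T k] remain. *)
Lemma class_stabilizer_Z3 (b : cube_classes F) : b <> 1%g ->
  group_iso (group_of (class_stabilizer 1%g b)) 'Z_3.
Proof.
move=> b1; set K := class_stabilizer _ _.
pose T (k : 'Z_3) : 'M['Z_3]_2 := \matrix_(i,
  j) if i == j then 1 else if i == 0 then k else 0.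
have T00 k : T k 0 0 = 1 by rewrite mxE.
have T11 k : T k 1 1 = 1 by rewrite mxE.
have T01 k : T k 0 1 = k by rewrite mxE.
have T10 k : T k 1 0 = 0 by rewrite mxE.
have TK k : class_stabilizes 1%g b (T k).
  split=> [|p]; first by rewrite det_mx22 T00 T11 T01 T10 mulr0 subr0 mulr1.
  rewrite !class_of_pair1; congr (b ^+ nat_of_ord _)%g.
  by rewrite /mact [LHS]/= T10 T11 mul0r add0r mul1r.
have gP k : exists u : group_of K, val (val u) = T k by apply: class_stabilizer_sub.
pose f (u : group_of K) : 'Z_3 := (val (val u) : 'M['Z_3]_2) 0 1.
pose g k := sval (cid (gP k)).
have gE k : val (val (g k)) = T k by exact: (svalP (cid (gP k))).
have uE (u : group_of K) : val (val u) = T (f u).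
  have uK : class_stabilizes 1%g b (val (val u)) by apply/asboolP; exact: (valP u).
  have M2 := class_stabilizes1 b1 uK; have [dM _] := uK.
  have := M2 (1, 0); have := M2 (0, 1);
    rewrite /= !mulr1 !mulr0 addr0 add0r => M11 M10.
  move: dM; rewrite det_mx22 M11 M10 mulr0 subr0 mulr1 => M00.
  apply: mact_inj => p; rewrite /mact T00 T11 T01 T10 M00 M11 M10 //.
apply: (group_iso_can (f := f) (g := g)).
- move=> u v; rewrite /f group_of_GLM.
  by rewrite mxE sum_ord2 (uE u) (uE v) !T00 !T01 !T11 mul1r mulr1 addrC.
- by move=> u; apply/val_inj/val_inj; rewrite gE -uE.
- by move=> k; rewrite /f gE.
Qed.

Lemma class_stabilizer_trivial (a b : cube_classes F) :
  injective (class_of_pair a b) -> trivial_group (group_of (class_stabilizer a b)).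
Proof.
move=> inj u; have /asboolP[_ cM] := valP u.
by apply/val_inj/val_inj/mact_inj => p; rewrite (inj _ _ (cM p)) mact1.
Qed.

Lemma group_iso_trivial (G H : groupType) :
  group_iso G H -> trivial_group H -> trivial_group G.
Proof.
by case=> f [g fK _] tH x; apply: (can_inj fK); rewrite [LHS]tH [RHS]tH.
Qed.
End Stabilizers.

Section Images.
Variable F : fieldType.
Implicit Types a b : cube_classes F.

Lemma range_class_trivial : range (class_of_pair (1 :
  cube_classes F)%g 1%g) = [set 1%g].
Proof.
apply/seteqP; split=> x; first by case=> p _ <-; rewrite class_of_pair1 expg1n.
by move=> ->; exists 0 => //; rewrite class_of_pair0.
Qed.

Lemma range_class_Z3 b : b <> 1%g -> subgroup_iso (range (class_of_pair 1%g b)) 'Z_3.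
Proof.
move=> b1; pose f (i : 'Z_3) := (b ^+ i)%g.
have fM : {morph f : i j / (i * j)%g} by move=> i j; exact: cube_class_expD.
exists (HB.pack_for {multiplicative 'Z_3 -> cube_classes F} f
  (isMultiplicative.Build 'Z_3 (cube_classes F) f fM)).
  exact: (class_exp_inj b1).
apply/seteqP; split=> x; case.
  by move=> i _ <-; exists (0, i) => //; rewrite class_of_pair1.
by move=> p _ <-; exists p.2 => //; rewrite class_of_pair1.
Qed.

Lemma range_class_Z3sq a b : injective (class_of_pair a b) ->
  subgroup_iso (range (class_of_pair a b)) ('Z_3 * 'Z_3)%type.
Proof.
move=> inj; pose f (p : ('Z_3 * 'Z_3)%type) := class_of_pair a b p.
have fM : {morph f : p q / (p * q)%g} by move=> p q; exact: class_of_pairD.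
by exists (HB.pack_for {multiplicative ('Z_3 * 'Z_3)%type -> cube_classes F} f
  (isMultiplicative.Build ('Z_3 * 'Z_3)%type (cube_classes F) f fM)).
Qed.
End Images.

Lemma subgroup_iso_eq1 (H K : groupType) (I : set H) :
  subgroup_iso I K -> I = [set 1%g] -> trivial_group K.
Proof.
move=> [f finj <-] f1 x; apply: finj.
have fE y : f y = 1%g.
  by have : (range f) (f y); [exists y|rewrite f1].
by rewrite !fE.
Qed.

Lemma Z3_not_trivial : ~ trivial_group 'Z_3.
Proof. by move=> /(_ 1). Qed.

Lemma Z3sq_not_trivial : ~ trivial_group ('Z_3 * 'Z_3)%type.
Proof. by move=> /(_ (1, 1)). Qed.

Lemma subgroup_iso_Z3_Z3sq (H : groupType) (I : set H) :
  subgroup_iso I 'Z_3 -> subgroup_iso I ('Z_3 * 'Z_3)%type -> False.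
Proof.
move=> [f finj fI] [g ginj gI].
have hP x : exists i, f i = g x.
  have : (range g) (g x) by exists x.
  by rewrite gI -fI => -[i _ <-]; exists i.
pose h (x : ('Z_3 * 'Z_3)%type) : 'Z_3 := sval (cid (hP x)).
have hE x : f (h x) = g x by exact: (svalP (cid (hP x))).
have hinj : injective h by move=> x y e; apply: ginj; rewrite -!hE e.
by have := leq_card h hinj; rewrite card_prod !card_ord.
Qed.

Lemma group_iso_prod (G H K L : groupType) :
  group_iso G H -> group_iso K L -> group_iso (G * K)%type (H * L)%type.
Proof.
move=> [f [f' fK f'K]] [g [g' gK g'K]].
apply: (group_iso_can (f := fun x : (G * K)%type => (f x.1, g x.2))
  (g := fun x : (H * L)%type => (f' x.1, g' x.2))).
- by move=> [x1 x2] [y1 y2] /=; rewrite !gmulfM.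
- by move=> [x1 x2]; rewrite /= fK gK.
- by move=> [x1 x2]; rewrite /= f'K g'K.
Qed.

(** * Cubic roots of unity *)

Section Mu3.
Variable F : fieldType.

(** In characteristic 3, c^3 - 1 = (c - 1)^3 by Frobenius. In the other case the order of c divides
    3 and is not 3. *)
Lemma mu3_trivial :
  3%N \in [pchar F] \/ (3%N \notin [pchar F] /\ ~ exists w :
    F, 3.-primitive_root w) ->
  trivial_group (group_of (mu3 F)).
Proof.
move=> H k; do 2!apply: val_inj; move: (unit_mu3 k); move: (val (val k)) => c c3 /=.
case: H => [ch3|[_ noprim]].
  have : pFrobenius_aut ch3 (c - 1) = 0.
    by rewrite pFrobenius_autB_comm ?pFrobenius_aut1 ?pFrobenius_autE ?c3 ?subrr
      //; apply: commr1.
  by rewrite pFrobenius_autE => /eqP; rewrite expf_eq0 subr_eq0 => /eqP.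
have [m mprim] := prim_order_exists (isT : (0 < 3)%N) c3.
case/(primeP (isT : prime 3)).2/orP => /eqP m3; rewrite m3 in mprim.
  exact: prim_expr_order mprim.
by case: noprim; exists c.
Qed.

Lemma mu3_Z3 (w : F) : 3.-primitive_root w -> group_iso (group_of (mu3 F)) 'Z_3.
Proof.
move=> wprim; have w3 := prim_expr_order wprim.
have w0 : w != 0 by apply: contra_eqN w3 => /eqP->; rewrite expr0n eq_sym oner_eq0.
pose wu : units F := exist (fun x : F => x != 0) w w0.
have wuE i : val (wu ^+ i)%g = w ^+ i by rewrite val_unitX.
have wmu (i : nat) : (wu ^+ i)%g \in mu3 F.
  by rewrite inE; apply/eqP/val_inj; rewrite !val_unitX exprAC w3 expr1n.
pose f (i : 'Z_3) : group_of (mu3 F) := exist (fun x => x \in mu3 F) _ (wmu i).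
have gP (k : group_of (mu3 F)) : exists i, f i = k.
  have [i ei] := prim_rootP wprim (unit_mu3 k); exists i.
  by do 2!apply: val_inj; rewrite /= wuE -ei.
pose g k := sval (cid (gP k)).
have gE k : f (g k) = k by exact: (svalP (cid (gP k))).
have finj : injective f.
  move=> i j /(congr1 (fun k : group_of (mu3 F) => val (val k))) /=; rewrite !wuE.
  by move/eqP; rewrite (eq_prim_root_expr wprim) !modn_small ?(ltn_ord i) ?(ltn_ord
    j) // => /eqP/val_inj.
apply: group_iso_sym; apply: (group_iso_can (f := f) (g := g)) => [i j|i|//].
  do 2!apply: val_inj; rewrite /= !wuE -exprD.
  by rewrite -[RHS](prim_expr_mod wprim).
by apply: finj; rewrite gE.
Qed.
End Mu3.

(** The norm of u is the scalar by which y -> (u * y) * u acts, so the product determines it. *)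
Lemma alg_iso_norm (F : fieldType) (A B : normed_alg F) (f : 'Hom(A, B)) :
  symmetric_composition A -> symmetric_composition B -> (exists y : A, y != 0) ->
  alg_iso f -> forall u, anorm (f u) = anorm u.
Proof.
move=> [h1 _ _] [h2 _ _] [y ny] [fb fM] u.
have fy : f y != 0 by rewrite -(inj_eq (bij_inj fb)) linear0 in ny.
have := h2 (f u) (f y); rewrite -!fM h1 linearZ /= => /eqP.
by rewrite -subr_eq0 -scalerBl scaler_eq0 (negbTE fy) orbF subr_eq0 => /eqP.
Qed.

(* The last conjunct tells Gamma_{a,b} from Gamma_{b,a}: z_{0,1} * z_{1,0} = 0 whereas
   z_{1,0} * z_{0,1} != 0. *)
Lemma equivalent_orientation (F : fieldType) (A : normed_alg F) (G : zmodType)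
    (Gamma : G -> {vspace A}) (alpha beta a b : units F) d e :
  symmetric_composition A -> is_grading Gamma -> special_grading Gamma ->
  okubo_frame Gamma alpha beta d e ->
  equivalent_gradings Gamma (Gamma_ab a b) ->
  let cl := class_of_pair (cube_class alpha) (cube_class beta) in
  exists p q, [/\ p != 0, q != 0, cl p = cube_class a, cl q = cube_class b
    & okubo_signz q p = 0].
Proof.
move=> symA gradG specG fr [f [[fb fM] fG]] cl.
have frB := canonical_frame a b; set z := okubo_vector a b in frB.
have z0 : z 0 = 0 := frame0 frB.
have fe s : s != 0 -> exists h c, [/\ h != 0, c != 0 & f (e s) = c *: z h].
  move=> ns; have [h fh] := fG _ (frame_component_neq0 fr ns); exists h.
  have := memv_img f (frame_degree fr s); rewrite fh => /vlineP[c ec]; exists c.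
  have : f (e s) != 0 by rewrite -(linear0 f) (inj_eq (bij_inj fb)) (frame_neq0 fr).
  rewrite ec scaler_eq0 negb_or => /andP[nc nz]; split => //.
  by apply: contraNneq nz => ->; apply/eqP; exact: z0.
(* If no frame vector were sent into the line of z_r, the coordinate of index r would vanish on the
   whole image of f, against surjectivity. *)
have ef r : r != 0 -> exists p c, [/\ p != 0, c != 0 & f (e p) = c *: z r].
  move=> nr; apply: contrapT => no.
  suff f0 v : (f v : {ffun Z3sq_nz -> F^o}) (znz nr) = 0.
    have [g _ gK] := fb; have := f0 (g (z r)); rewrite gK ffunE eqxx => /eqP.
    by rewrite oner_eq0.
  move: v; apply: (frame_spanning fr) => [|x y h h'|k x h|s].
  - by rewrite linear0 ffunE.
  - by rewrite linearD ffunE h h' addr0.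
  - by rewrite linearZ ffunE h; apply: mulr0.
  have [h [c [nh nc ec]]] := fe _ (valP s); rewrite ec !ffunE /=.
  have [rh|_] := eqVneq r h; last exact: mulr0.
  case: no; exists (val s), c; rewrite rh; split => //; exact: valP s.
have cube p c r : p != 0 -> c != 0 -> r != 0 -> f (e p) = c *: z r ->
    cl p = class_of_pair (cube_class a) (cube_class b) r.
  move=> np nc nr ec.
  have n0 := homogeneous_norm symA gradG specG (frame_degree fr p).
  have := congr1 f (square_square symA n0).
  rewrite [RHS]linearZ /= !fM ec !(amulZl,
    amulZr) (frame_square_square frB) // !scalerA => /eqP.
  rewrite -subr_eq0 -scalerBl scaler_eq0 (negbTE (frame_neq0 frB nr)) orbF subr_eq0
    => /eqP E.
  have nN : cubic_form (1 *: e p) != 0.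
    by rewrite scale1r (cubic_form_neq0 symA gradG specG (frame_degree fr p)
      (frame_neq0 fr np)).
  rewrite /cl -(cubic_form_class fr symA gradG specG nN) /class_of_pair
    -!cube_classX -cube_classM.
  pose cu : units F := exist (fun x : F => x != 0) c nc.
  apply/esym/cube_classP; exists cu; apply: val_inj => /=;
    rewrite scale1r !val_unitX /=.
  by apply: (mulIf nc); rewrite -E; ring.
have [p [c [np nc ec]]] := ef (1, 0) isT; have [q [c' [nq nc' ec']]] := ef (0, 1) isT.
exists p, q; split => //.
- by rewrite (cube p c (1, 0)) // /class_of_pair /= expg1 expg0 mulg1.
- by rewrite (cube q c' (0, 1)) // /class_of_pair /= expg1 expg0 mul1g.
have := fM (e q) (e p); rewrite ec ec' amulZl amulZr (frameM frB) // /okubo_sign /=.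
rewrite mul0r scale0r !scaler0 (frameM fr) // linearZ /= => /eqP.
have [pq|npq] := eqVneq (q + p) 0; first by rewrite /okubo_signz pq eqxx orbT.
rewrite scaler_eq0 -(linear0 f) (inj_eq (bij_inj fb)) (negbTE (frame_neq0 fr npq))
  orbF.
by rewrite mulf_eq0 (negbTE (carry_neq0 _ _ _ _)) orbF okubo_sign_eq0 => /eqP.
Qed.

(** * The three possibilities for the image of Phi *)

Section Main.
Variables (F : fieldType) (A : normed_alg F) (G : zmodType).
Variable Gamma : G -> {vspace A}.
Hypotheses (symA : symmetric_composition A) (dimA : \dim {:A} = 8).
Hypotheses (gradG : is_grading Gamma) (specG : special_grading Gamma).
Local Notation I := (Phi_image Gamma).
Local Notation W := (Weyl_group Gamma).

Lemma normal_Phi_image : exists alpha beta d e,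
  okubo_frame Gamma alpha beta d e /\
  [\/ [/\ alpha = 1%g, beta = 1%g & I = [set 1%g]],
      [/\ alpha = 1%g, cube_class beta <> 1%g & subgroup_iso I 'Z_3]
    | injective (class_of_pair (cube_class alpha) (cube_class beta))
      /\ subgroup_iso I ('Z_3 * 'Z_3)%type].
Proof.
have [alpha [beta [d [e [fr cases]]]]] := frame_normal symA dimA gradG specG.
exists alpha, beta, d, e; split => //.
rewrite (frame_Phi_image fr symA gradG specG).
case: cases => [[-> ->]|[-> b1]|inj].
- by apply: Or31; rewrite range_class_trivial.
- by apply: Or32; split => //; apply: range_class_Z3.
- by apply: Or33; split => //; apply: range_class_Z3sq.
Qed.

Lemma grading_splits : quotient_splits (Stab_grading Gamma).
Proof.
have [alpha [beta [d [e [fr cases]]]]] := frame_normal symA dimA gradG specG.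
have good : frame_good alpha beta.
  case: cases => [[-> ->]|[-> b1]|inj]; first exact: frame_good1.
    exact: frame_good2.
  exact: frame_good3.
by have [] := Weyl_group_split fr symA gradG specG good.
Qed.

Lemma grading_Stab :
  group_iso (group_of (Stab_grading Gamma)) (group_of (mu3 F) * group_of (mu3
    F))%type.
Proof.
have [alpha [beta [d [e fr]]]] := frame_exists symA dimA gradG specG.
exact: (Stab_mu3 fr symA gradG specG).
Qed.

Lemma Phi_image_cases :
  I = [set 1%g] \/ subgroup_iso I 'Z_3 \/ subgroup_iso I ('Z_3 * 'Z_3)%type.
Proof.
have [? [? [? [? [_ [[_ _ ?]|[_ _ ?]|[_ ?]]]]]]] := normal_Phi_image; tauto.
Qed.

Lemma Phi_image_trivial : I = [set 1%g] ->
  normed_alg_iso A (split_okubo F)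
  /\ equivalent_gradings Gamma (Gamma_ab (1%g : units F) 1%g)
  /\ group_iso W (group_of SL23).
Proof.
move=> I1; have [alpha [beta [d [e [fr cases]]]]] := normal_Phi_image.
case: cases => [[a1 b1 _]|[_ _ /subgroup_iso_eq1 H]|[_ /subgroup_iso_eq1 H]];
  last 2 first.
- by case: Z3_not_trivial; apply: H.
- by case: Z3sq_not_trivial; apply: H.
subst alpha beta; have eqv := frame_equivalent fr; split; last split => //.
  have [f [fiso _]] := eqv; rewrite -okubo_ab11; exists f; split => //.
  apply: (alg_iso_norm symA _ _ fiso).
    by rewrite okubo_ab11; apply: split_okubo_symmetric.
  by exists (e (1, 0)); apply: (frame_neq0 fr).
apply: group_iso_trans (class_stabilizer_SL23 F).
by have [] := Weyl_group_split fr symA gradG specG (@frame_good1 F).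
Qed.

Lemma generated_sub (H : groupType) (X : set H) (S : subgroup H) :
  (forall x, X x -> x \in S) -> forall x, generated X x -> x \in S.
Proof. by move=> XS x; apply. Qed.

Lemma sub_generated (H : groupType) (X : set H) x : X x -> generated X x.
Proof. by move=> Xx S; apply. Qed.

Fact trivial_closed (H : groupType) : group_closed [pred x : H | x == 1%g].
Proof. by split=> [|x y]; rewrite !inE // => /eqP-> /eqP->; rewrite mulgV. Qed.

Lemma generated_trivial (H : groupType) (X : set H) :
  (forall x, X x -> x = 1%g) -> generated X = [set 1%g].
Proof.
move=> X1; apply/seteqP; split=> x; last by move=> -> S _;
  exact: (subgroup_closed S).1.
move=> gx; apply/eqP; apply: (generated_sub (S := Subgroup (@trivial_closed H)) _ gx).
by move=> y /X1 ->; rewrite inE.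
Qed.

Lemma Phi_image_cyclic : subgroup_iso I 'Z_3 ->
  (forall alpha : units F, generated [set cube_class alpha] = I ->
    equivalent_gradings Gamma (Gamma_ab 1%g alpha))
  /\ group_iso W 'Z_3.
Proof.
move=> I3; have [alpha [beta [d [e [fr cases]]]]] := normal_Phi_image.
case: cases => [[_ _ I1]|[a1 b1 _]|[_ I9]].
- by case: Z3_not_trivial; apply: (subgroup_iso_eq1 I3 I1).
- subst alpha; split=> [a gen|]; last first.
    apply: group_iso_trans (class_stabilizer_Z3 b1).
    by have [] := Weyl_group_split fr symA gradG specG (frame_good2 b1).
  have IE := frame_Phi_image fr symA gradG specG.
  have [p _ pa] : range (class_of_pair (cube_class 1%g) (cube_class beta))
    (cube_class a).
    by rewrite -IE -gen; apply: sub_generated.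
  have a1 : cube_class a <> 1%g.
    move=> a1; case: Z3_not_trivial; apply: (subgroup_iso_eq1 I3).
    by rewrite -gen; apply: generated_trivial => x ->.
  have p2 : p.2 != 0.
    by apply: contra_notN a1 => /eqP p2; rewrite -pa class_of_pair1 p2 expg0.
  (* The second vector has the class of a, since only p.2 matters when alpha = 1. The first lies in
     the kernel of Phi and is chosen so that the determinant is p.2^2 = 1. *)
  have det1 : zdet (p.2, 0) (0, p.2) = 1.
    apply/eqP; have : (p.2 != 0) ==> (zdet (p.2, 0) (0, p.2) == 1).
      by move: p {pa p2}; apply: Z3sq_all; vm_compute.
    by rewrite p2.
  have [||d' [e' fr']] := reframe fr symA gradG specG dimA (alpha' := 1%g) (beta'
    := a) det1.
  + by rewrite class_of_pair1 expg0.
  + by rewrite -pa !class_of_pair1.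
  exact: frame_equivalent fr'.
- by case: (subgroup_iso_Z3_Z3sq I3 I9).
Qed.

Lemma Phi_image_full : subgroup_iso I ('Z_3 * 'Z_3)%type ->
  trivial_group W
  /\ (forall alpha beta : units F,
      generated [set cube_class alpha; cube_class beta] = I ->
      (equivalent_gradings Gamma (Gamma_ab alpha beta)
       \/ equivalent_gradings Gamma (Gamma_ab beta alpha))
      /\ ~ (equivalent_gradings Gamma (Gamma_ab alpha beta)
            /\ equivalent_gradings Gamma (Gamma_ab beta alpha))).
Proof.
move=> I9; have [alpha [beta [d [e [fr cases]]]]] := normal_Phi_image.
case: cases => [[_ _ I1]|[_ _ I3]|[inj _]].
- by case: Z3sq_not_trivial; apply: (subgroup_iso_eq1 I9 I1).
- by case: (subgroup_iso_Z3_Z3sq I3 I9).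
split.
  have [Wiso _] := Weyl_group_split fr symA gradG specG (frame_good3 inj).
  exact: (group_iso_trivial Wiso (class_stabilizer_trivial inj)).
move=> a b gen; have IE := frame_Phi_image fr symA gradG specG.
set cl := class_of_pair _ _ in inj IE.
have [p _ pa] : range cl (cube_class a) by rewrite -IE -gen; apply: sub_generated;
  left.
have [q _ qb] : range cl (cube_class b) by rewrite -IE -gen; apply: sub_generated;
  right.
(* If p and q were dependent, both would lie on a line spanned by some r. As Phi is injective, the
   classes of that line form a proper subgroup of the image, yet it contains both generators. *)
have det0 : zdet p q != 0.
  apply/negP=> /eqP det0.
  have [r nr [rp rq]] : exists2 r : Z3sq, r != 0 & zdet r p = 0 /\ zdet r q = 0.
    have dd (s : Z3sq) : zdet s s = 0 by rewrite /zdet mulrC subrr.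
    have [p0|np] := eqVneq p 0; last by exists p.
    have [q0|nq] := eqVneq q 0; last first.
      by exists q; rewrite // dd p0 /zdet /= !mulr0 subrr.
    by exists (1, 0) => //; rewrite p0 q0 /zdet /= !mulr0 subrr.
  have clB s t : cl (s - t) = (cl s / cl t)%g.
    apply: (canRL (mulgK _)); rewrite -class_of_pairD subrK //.
  have Sclosed : group_closed [pred c | `[< exists s, c = cl s /\ zdet r s = 0 >]].
    split=> [|x y]; rewrite !inE.
      by exists 0; rewrite /cl class_of_pair0 /zdet /= !mulr0 subrr.
    move=> [s [-> rs]] [t [-> rt]]; exists (s - t); split; first by rewrite clB.
    by transitivity (zdet r s - zdet r t); [rewrite /zdet /=;
      ring|rewrite rs rt subrr].
  have [s rs] : exists s, zdet r s != 0.
    have : (r != 0) ==> (zdet r (1, 0) != 0) || (zdet r (0, 1) != 0).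
      by move: r {nr rp rq clB Sclosed}; apply: Z3sq_all; vm_compute.
    by rewrite nr => /orP[] ?; [exists (1, 0)|exists (0, 1)].
  have : cl s \in Subgroup Sclosed.
    apply: (@generated_sub _ [set cube_class a; cube_class b]); last first.
      by rewrite gen IE; exists s.
    by move=> x [->|->]; rewrite inE; [exists p; rewrite pa|exists q; rewrite qb].
  by rewrite inE => -[t [/inj <- rs0]]; rewrite rs0 eqxx in rs.
split.
  (* A nonzero determinant is 1 or 2; in the latter case exchanging p and q gives 1. This sign
     decides which of the two equivalences holds. *)
  have := Z3sq_all2 (P := fun p q => (zdet p q != 0) ==> (zdet p q == 1) || (zdet q
    p == 1)) isT p q.
  have re := reframe fr symA gradG specG dimA.
  rewrite det0 => /orP[] /eqP det1; [left|right].
    have [d' [e' fr']] := re p q a b det1 (esym pa) (esym qb).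
    exact: frame_equivalent fr'.
  have [d' [e' fr']] := re q p b a det1 (esym qb) (esym pa).
  exact: frame_equivalent fr'.
move=> [E1 E2].
(* Injectivity of Phi identifies the degrees provided by both equivalences with p and q. Then e_q *
   e_p and e_p * e_q would both have sign 0, impossible for independent degrees. *)
have [p1 [q1 [_ _ e1 e2 s1]]] := equivalent_orientation symA gradG specG fr E1.
have [q2 [p2 [_ _ e3 e4 s2]]] := equivalent_orientation symA gradG specG fr E2.
have ? : p1 = p by apply: inj; rewrite pa.
have ? : q1 = q by apply: inj; rewrite qb.
have ? : p2 = p by apply: inj; rewrite pa.
have ? : q2 = q by apply: inj; rewrite qb.
subst p1 q1 p2 q2.
have := Z3sq_all2 (P := fun p q => [==> zdet p q != 0, okubo_signz p q == 0 =>
  okubo_signz q p != 0]) isT p q.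
by rewrite det0 s1 s2 eqxx.
Qed.
End Main.

(** * Examples over the rationals *)

Lemma closed_cube_root (K : closedFieldType) (c : K) : exists a, a ^+ 3 = c.
Proof.
have : exists x, root ('X^3 - c%:P) x.
  by apply/closed_rootP; rewrite size_XnsubC.
by case=> a; rewrite /root !hornerE subr_eq0 => /eqP; exists a.
Qed.

Section OkuboAb.
Variables (F : fieldType) (K : closedFieldType) (iota : {rmorphism F -> K}).
Variables alpha beta : units F.
Local Notation A := (okubo_ab alpha beta).

(** The isomorphism [psi] is the K-linear extension of the embedding z_{i,j} -> a^i b^j z_{i,j},
    with cubic roots a and b in K. It reaches a multiple of each basis vector, and equality of
    dimensions gives injectivity. The norm is not additive, so it is compared through the polar form
    first. *)
Lemma okubo_ab_scalar_ext : normed_alg_iso (scalar_ext iota A) (split_okubo K).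
Proof.
have [a a3] := closed_cube_root (iota (val alpha)).
have [b b3] := closed_cube_root (iota (val beta)).
pose f (x : A) : split_okubo K :=
    \sum_(s : Z3sq_nz) (iota ((x : {ffun Z3sq_nz -> F^o}) s)
       * (a ^+ (val s).1 * b ^+ (val s).2)) *: (sc_basis K s : split_okubo K).
have [f_inj fM fn] : [/\ injective f,
      forall x y, f (amul x y) = amul (f x) (f y)
    & forall x, anorm (f x) = iota (anorm x)].
  exact: okubo_ab_embedding.
pose g (v : A) : scalar_ext iota A :=
  \sum_i iota (coord (vbasis {:A}) i v) *: (sc_basis K i : scalar_ext iota A).
have [gM gn] : (forall u v, g (amul u v) = amul (g u) (g v))
  /\ (forall v, anorm (g v) = iota (anorm v)) by exact: scalar_ext_embedding.
have fD x y : f (x + y) = f x + f y.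
  rewrite /f -big_split; apply: eq_bigr => s _ /=.
  by rewrite ffunE rmorphD mulrDl scalerDl.
have fZ c x : f (c *: x) = iota c *: f x.
  rewrite /f scaler_sumr; apply: eq_bigr => s _ /=.
  by rewrite ffunE rmorphM -mulrA scalerA.
have gD x y : g (x + y) = g x + g y.
  rewrite /g -big_split; apply: eq_bigr => s _ /=.
  by rewrite linearD rmorphD scalerDl.
pose h (x : scalar_ext iota A) : split_okubo K :=
  \sum_i (x : {ffun 'I_(\dim {:A}) -> K^o}) i *: f (vbasis {:A})`_i.
have hlin : linear h.
  move=> c x y; rewrite /h scaler_sumr -big_split /=; apply: eq_bigr => s _.
  by rewrite !ffunE scalerDl scalerA.
pose hL := HB.pack_for {linear (scalar_ext iota A) -> (split_okubo K)} h
  (GRing.isLinear.Build K _ _ _ h hlin).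
pose psi : 'Hom(scalar_ext iota A, split_okubo K) := linfun hL.
have psiE x : psi x = h x by rewrite lfunE.
have psi_basis (i : 'I_(\dim {:A})) : psi (sc_basis K i) = f (vbasis {:A})`_i.
  rewrite psiE /h (bigD1 i) //= ffunE eqxx scale1r big1 ?addr0 // => j nj.
  by rewrite ffunE (negbTE nj) scale0r.
have f_sum (I : Type) (r : seq I) (E : I -> A) :
  f (\sum_(i <- r) E i) = \sum_(i <- r) f (E i).
  elim/big_rec2: _ => [|i x y _ <-]; last exact: fD.
  by rewrite -(scale0r (0 : A)) fZ rmorph0 scale0r.
have psig v : psi (g v) = f v.
  rewrite [in RHS](coord_vbasis (memvf v)) f_sum linear_sum; apply: eq_bigr => i _.
  by rewrite fZ linearZ /= psi_basis.
have ge (i : 'I_(\dim {:A})) : g (vbasis {:A})`_i = sc_basis K i.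
  apply/ffunP=> j; rewrite /g sum_ffunE (bigD1 i) //= big1 ?addr0 => [|k nk].
    by rewrite coord_free ?(basis_free (vbasisP _)) // eqxx rmorph1 scale1r.
  by rewrite coord_free ?(basis_free (vbasisP _)) // [i == k]eq_sym (negbTE nk)
    rmorph0 scale0r ffunE.
have sp : linear_spanning (fun i => sc_basis K i : scalar_ext iota A).
  by move=> P *; apply: sc_basis_ind.
have psiM u v : psi (amul u v) = amul (psi u) (psi v).
  move: u v; apply: (alg_morph_spanning sp) => i j.
  by rewrite -!ge -gM !psig.
have psi_polar u v : apolar (psi u) (psi v) = apolar u v.
  move: u; apply: (sp _) => [|x y e1 e2|k x e1|i].
  - by rewrite linear0 !polar0l.
  - by rewrite linearD !polarDl e1 e2.
  - by rewrite linearZ !polarZl e1.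
  move: v; apply: (sp _) => [|x y e1 e2|k x e1|j].
  - by rewrite linear0 !polar0r.
  - by rewrite linearD !polarDr e1 e2.
  - by rewrite linearZ !polarZr e1.
  by rewrite -!ge !psig /apolar /polar -fD -gD !fn !gn.
have psin u : anorm (psi u) = anorm u.
  move: u; apply: (sp _) => [|x y e1 e2|k x e1|i].
  - by rewrite linear0 !anorm0.
  - by rewrite linearD !anormD e1 e2 psi_polar.
  - by rewrite linearZ !anormZ e1.
  by rewrite -ge psig fn gn.
have nz c (r : units F) : c ^+ 3 = iota (val r) -> c != 0.
  by move=> c3; have := valP r; rewrite -(fmorph_eq0 iota) -c3 expf_eq0.
have surj : limg psi = fullv.
  apply/eqP; rewrite eqEsubv subvf; apply/subvP=> y _; move: y.
  apply: sc_basis_ind => [|x y|k x|s]; [exact: mem0v|exact: rpredD|exact: rpredZ|].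
  have w0 : a ^+ (val s).1 * b ^+ (val s).2 != 0 by rewrite mulf_neq0 // expf_neq0
    ?(nz _ _ a3) ?(nz _ _ b3).
  rewrite -[sc_basis K s](scalerK w0) rpredZ //.
  suff -> : (a ^+ (val s).1 * b ^+ (val s).2) *: sc_basis K s = psi (g (sc_basis F
    s)).
    by rewrite memv_img ?memvf.
  rewrite psig /f (bigD1 s) //= ffunE eqxx rmorph1 mul1r big1 ?addr0 // => t nt.
  by rewrite ffunE (negbTE nt) rmorph0 mul0r scale0r.
have inj : lker psi == 0%VS.
  rewrite -dimv_eq0; have := limg_ker_dim psi fullv; rewrite surj capfv.
  rewrite !dim_sc card_ord => /eqP; rewrite -[X in _ == X -> _]add0n.
  by rewrite eqn_add2r.
exists psi; split => //; split => //.
exists (psi^-1)%VF; first exact: lker0_lfunK.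
by move=> v; apply: limg_lfunVK; rewrite surj memvf.
Qed.
End OkuboAb.

Lemma okubo_ab_is_okubo (F : fieldType) (K : closedFieldType)
    (iota : {rmorphism F -> K}) (alpha beta : units F) :
  algebraic_closure iota -> is_okubo (okubo_ab alpha beta).
Proof.
by move=> alg; exists K, iota; split => //; apply: okubo_ab_scalar_ext.
Qed.

(** Writing z as a reduced fraction, the p-adic valuations in num^3 = n den^3 differ by the
    valuation of n. *)
Lemma rat_cube_logn (z : rat) (p n : nat) : (0 < n)%N ->
  z ^+ 3 = n%:R -> (3 %| logn p n)%N.
Proof.
move=> n0 zn; have d0 : (denq z)%:~R != 0 :> rat by rewrite intr_eq0 denq_neq0.
have E : (`|numq z| ^ 3 = n * `|denq z| ^ 3)%N.
  rewrite -!abszX -[n in RHS]absz_nat -abszM; congr absz.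
  apply: (@intr_inj rat); rewrite rmorphXn rmorphM rmorphXn /= -[n%:~R]zn.
  by rewrite -exprMn -{2}[z]divq_num_den divfK.
have z0 : (0 < `|numq z|)%N.
  rewrite absz_gt0 numq_eq0; apply: contraTneq n0 => ez.
  move: zn; rewrite ez expr0n /= => /esym/eqP;
    rewrite Num.Theory.pnatr_eq0 => /eqP->; by [].
have := congr1 (logn p) E; rewrite lognM ?expn_gt0 ?absz_gt0 ?denq_neq0 // !lognX.
by move=> e; rewrite -(dvdn_addl _ (dvdn_mulr (logn p `|denq z|) (dvdnn 3))) -e
  dvdn_mulr.
Qed.

Section RatExamples.
Definition rat2 : units rat := exist (fun x : rat => x != 0) 2%:R isT.
Definition rat3 : units rat := exist (fun x : rat => x != 0) 3%:R isT.

(** If 2^i 3^j is a rational cube, its valuations i at 2 and j at 3 are divisible by 3, and both are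
    less than 3. *)
Lemma class_of_rat2_rat3 (i j : 'Z_3) :
  class_of_pair (cube_class rat2) (cube_class rat3) (i, j) = 1%g -> i = 0 /\ j = 0.
Proof.
rewrite /class_of_pair -!cube_classX -cube_classM => /esym/cube_classP[z].
rewrite mul1g => /(congr1 val); rewrite [LHS]/= !val_unitX /= -!natrX -natrM =>
  /esym e.
have n0 : (0 < 2 ^ i * 3 ^ j)%N by rewrite muln_gt0 !expn_gt0.
have := rat_cube_logn 2 n0 e; have := rat_cube_logn 3 n0 e.
rewrite !lognM ?expn_gt0 // !lognX (_ : logn 3 2 = 0)%N // (_ : logn 3 3 = 1)%N //.
rewrite (_ : logn 2 2 = 1)%N // (_ : logn 2 3 = 0)%N // !muln0 !muln1 addn0 add0n.
by move: e n0 => _ _; case: i j => [[|[|[|i]]] Hi] // [[|[|[|j]]] Hj] //= _ _;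
  split; apply: val_inj.
Qed.

Lemma class_of_rat_inj : injective (class_of_pair (cube_class rat2) (cube_class
  rat3)).
Proof.
move=> p q epq; apply/eqP; rewrite -subr_eq0; apply/eqP.
have : class_of_pair (cube_class rat2) (cube_class rat3) (p - q) = 1%g.
  apply: (mulIg (class_of_pair (cube_class rat2) (cube_class rat3) q)).
  by rewrite -class_of_pairD subrK epq mul1g.
by case: (p - q) => i j /class_of_rat2_rat3[-> ->].
Qed.

Lemma rat2_class : cube_class rat2 <> 1%g.
Proof.
move=> e; suff [/eqP] : (1 : 'Z_3) = 0 /\ (0 : 'Z_3) = 0 by [].
by apply: class_of_rat2_rat3; rewrite /class_of_pair e expg1n expg0 mulg1.
Qed.

Lemma Phi_image_appears_ab (alpha beta : units rat)
    (P : forall F : fieldType, set (cube_classes F) -> Prop) :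
  P rat (range (class_of_pair (cube_class alpha) (cube_class beta))) ->
  Phi_image_appears P.
Proof.
move=> H; have okA : is_okubo (okubo_ab alpha beta).
  apply: (@okubo_ab_is_okubo rat algC ratr) => x; apply/integral_algebraic.
  exact: algC_algebraic.
have [symA dimA] := okubo_symmetric okA.
have [gradG specG] := Gamma_ab_grading alpha beta.
exists rat, (okubo_ab alpha beta), Z3sq, (Gamma_ab alpha beta); split => //.
by rewrite (frame_Phi_image (canonical_frame alpha beta) symA gradG specG).
Qed.
End RatExamples.

Theorem theorem4p6 :
  (forall (F : fieldType) (O : normed_alg F) (G : zmodType)
      (Gamma : G -> {vspace O}),
    is_okubo O -> is_grading Gamma -> special_grading Gamma ->
    let StabG := group_of (Stab_grading Gamma) in
    let W := Weyl_group Gamma in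
    let I := Phi_image Gamma in
    let has_primitive_cubic_root := exists w : F, 3.-primitive_root w in
    quotient_splits (Stab_grading Gamma)
    /\ group_iso StabG (group_of (mu3 F) * group_of (mu3 F))%type
    /\ (3%N \in [pchar F] \/ (3%N \notin [pchar F] /\ ~ has_primitive_cubic_root) ->
        trivial_group StabG)
    /\ (3%N \notin [pchar F] /\ has_primitive_cubic_root ->
        group_iso StabG ('Z_3 * 'Z_3)%type)
    /\ (I = [set 1%g] \/ subgroup_iso I 'Z_3 \/ subgroup_iso I ('Z_3 * 'Z_3)%type)
    /\ (I = [set 1%g] ->
        normed_alg_iso O (split_okubo F)
        /\ equivalent_gradings Gamma (Gamma_ab (1%g : units F) 1%g)
        /\ group_iso W (group_of SL23))
    /\ (subgroup_iso I 'Z_3 ->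
        (forall alpha : units F, generated [set cube_class alpha] = I ->
          equivalent_gradings Gamma (Gamma_ab 1%g alpha))
        /\ group_iso W 'Z_3)
    /\ (subgroup_iso I ('Z_3 * 'Z_3)%type ->
        trivial_group W
        /\ (forall alpha beta : units F,
            generated [set cube_class alpha; cube_class beta] = I ->
            (equivalent_gradings Gamma (Gamma_ab alpha beta)
             \/ equivalent_gradings Gamma (Gamma_ab beta alpha))
            /\ ~ (equivalent_gradings Gamma (Gamma_ab alpha beta)
                  /\ equivalent_gradings Gamma (Gamma_ab beta alpha)))))
  /\ Phi_image_appears (fun F I => I = [set 1%g])
  /\ Phi_image_appears (fun F I => subgroup_iso I 'Z_3)
  /\ Phi_image_appears (fun F I => subgroup_iso I ('Z_3 * 'Z_3)%type).
Proof.
split=> [F O G Gamma okO gradG specG StabG W I has_root|].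
  have [symO dimO] := okubo_symmetric okO.
  have StabE := grading_Stab symO dimO gradG specG.
  split; first exact: grading_splits.
  split; first exact: StabE.
  split=> [H|].
    apply: group_iso_trivial StabE _ => -[k l].
    by congr (_, _); apply: mu3_trivial H _.
  split=> [[_ [w wprim]]|].
    apply: group_iso_trans StabE _.
    by apply: group_iso_prod; apply: mu3_Z3 wprim.
  split; first exact: Phi_image_cases.
  split; first exact: Phi_image_trivial.
  split; first exact: Phi_image_cyclic.
  exact: Phi_image_full.
split; last split.
- by apply: (@Phi_image_appears_ab 1%g 1%g); apply: range_class_trivial.
- apply: (@Phi_image_appears_ab 1%g rat2); apply: range_class_Z3.
  exact: rat2_class.
- apply: (@Phi_image_appears_ab rat2 rat3); apply: range_class_Z3sq.
  exact: class_of_rat_inj.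
Qed.
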